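(* Let $Q\in\mathscr{I}_{1,\mathrm{loc}}(E,\mu)$ be the operator of orthogonal projection onto a closed subspace $L\subset L_2(E,\mu)$, let $V$ be a finite-dimensional subspace of $L_{2,\mathrm{loc}}(E,\mu)$, let $E_0\subset E$ be a Borel subset, and set $H=L+V$. Assume that: (a) $\chi_{E\setminus E_0}Q\chi_{E\setminus E_0}\in\mathscr{I}_1(E,\mu)$; (b) $\chi_{E_0}V\subset L_2(E,\mu)$; (c) if $\varphi\in V$ satisfies $\chi_{E_0}\varphi\in\chi_{E_0}L$, then $\varphi=0$; (d) if $\varphi\in L$ satisfies $\chi_{E_0}\varphi=0$, then $\varphi=0$; and assume additionally that $V\cap L_2(E,\mu)=0$. Let $g_n:E\to(0,1]$, $n\in\mathbb{N}$, be a sequence of positive measurable functions such that: (1) for all $n\in\mathbb{N}$ we have $\sqrt{1-g_n}\,Q\sqrt{1-g_n}\in\mathscr{I}_1(E,\mu)$; (2) for all $n\in\mathbb{N}$ we have $\sqrt{g_n}V\subset L_2(E,\mu)$; (3) there exists $\alpha_0>0$ such that for all $n$ we have $\alpha(\sqrt{g_n}L,\sqrt{g_n}V)\ge\alpha_0$; (4) for any bounded $B\subset E$ we have $$\inf_{n\in\mathbb{N},\,x\in E_0\cup B}g_n(x)>0\quad\text{and}\quad\lim_{n\to\infty}\sup_{x\in E_0\cup B}|g_n(x)-1|=0.$$ Then, as $n\to\infty$, we have $\Pi^{g_n}\to Q$ in $\mathscr{I}_{1,\mathrm{loc}}(E,\mu)$.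
   Context: $E$ is a locally compact complete metric space and $\mu$ is a $\sigma$-finite Borel measure on $E$. $\chi_A$ denotes the indicator function of $A$ and also the operator of multiplication by it. $L_{2,\mathrm{loc}}(E,\mu)$ is the space of measurable functions $f:E\to\mathbb{C}$ with $\int_B|f|^2d\mu<\infty$ for every bounded $B\subset E$. $\mathscr{I}_1(E,\mu)$ is the space of trace-class operators on $L_2(E,\mu)$; $\mathscr{I}_{1,\mathrm{loc}}(E,\mu)$ is the space of operators $K$ on $L_2(E,\mu)$ such that $\chi_BK\chi_B\in\mathscr{I}_1(E,\mu)$ for every bounded Borel $B\subset E$, with the topology given by the seminorms $\|\chi_BK\chi_B\|_{\mathscr{I}_1}$, $B$ bounded Borel. Under the stated assumptions $\sqrt{g_n}H$ is a closed subspace of $L_2(E,\mu)$, and $\Pi^{g_n}$ denotes the operator of orthogonal projection onto it. For two closed subspaces $H_1,H_2\subset L_2(E,\mu)$, $\alpha(H_1,H_2)$ denotes the angle between them, defined as the infimum of the angles between nonzero vectors of $H_1$ and nonzero vectors of $H_2$. *)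

(* Defs.v *)
From HB Require Import structures.
From mathcomp Require Import all_boot all_order all_algebra.
From mathcomp Require Import all_classical all_reals all_analysis.
From mathcomp Require Import complex.

Set Implicit Arguments.
Unset Strict Implicit.
Unset Printing Implicit Defensive.

Import Order.TTheory GRing.Theory Num.Theory.
Import numFieldNormedType.Exports.

Local Open Scope classical_set_scope.
Local Open Scope ring_scope.
Local Open Scope complex_scope.

#[short(type="completeMetricType")]
HB.structure Definition CompleteMetric (R : numDomainType) :=
  {M of Complete M & Metric R M}.

Notation borel E := (g_sigma_algebraType (@open E)).

(* Elements of L_2(T, mu) are represented by functions T -> R[i], and equality
   in L_2(T, mu) by mu-almost everywhere equality.  A linear subspace is a set
   of functions that is a union of a.e.-equality classes (of measurable
   functions). An operator on L_2(T, mu) is represented by a map on functions,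
   only whose behaviour on square-integrable functions is relevant. *)
Section ComplexL2.
Context {d : measure_display} {T : measurableType d} {R : realType}.
Variable mu : {measure set T -> \bar R}.

Local Notation C := R[i].
Local Notation fn := (T -> C).
Local Notation op := (fn -> fn).

Definition cmeasurable (f : fn) : Prop :=
  measurable_fun setT (fun x => complex.Re (f x)) /\
  measurable_fun setT (fun x => complex.Im (f x)).

Definition aeq (f g : fn) : Prop := {ae mu, forall x, f x = g x}.

Definition sqmod (z : C) : R := complex.Re z ^+ 2 + complex.Im z ^+ 2.

Definition L2 : set fn :=
  [set f | cmeasurable f /\ (\int[mu]_x (sqmod (f x))%:E < +oo)%E].

Definition inner (f g : fn) : C :=
  let h x := f x * (g x)^* in
  Rintegral mu setT (fun x => complex.Re (h x)) +i*
  Rintegral mu setT (fun x => complex.Im (h x)).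

Definition L2norm (f : fn) : R :=
  Num.sqrt (Rintegral mu setT (fun x => sqmod (f x))).

Definition linear_subspace (S : set fn) : Prop :=
  [/\ S `<=` cmeasurable,
      S (fun=> 0),
      (forall (a : C) f g, S f -> S g -> S (fun x => a * f x + g x)) &
      (forall f g, S f -> cmeasurable g -> aeq f g -> S g)].

Definition finite_dimensional (S : set fn) : Prop :=
  exists (n : nat) (v : 'I_n -> fn), (forall i, S (v i)) /\
    forall f, S f ->
      exists c : 'I_n -> C, aeq f (fun x => \sum_(i < n) c i * v i x).

Definition closed_linear_subspace (S : set fn) : Prop :=
  [/\ linear_subspace S, S `<=` L2 &
      forall f, L2 f ->
        (forall e : R, 0 < e ->
           exists2 h, S h & L2norm (fun x => f x - h x) < e) -> S f].

Definition sum_space (A B : set fn) : set fn :=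
  [set (fun x => f x + g x) | f in A & g in B].

Definition mulop (h : T -> R) : op := fun f x => (h x)%:C * f x.

Definition compress (h : T -> R) (K : op) : op :=
  fun f => mulop h (K (mulop h f)).

(* The vector h in S with f - h orthogonal to S; it exists, and is unique up to
   a.e. equality, for f in L_2 and S a closed subspace of L_2. *)
Definition orth_proj (S : set fn) : op := fun f =>
  xget (fun=> 0)
    [set h | S h /\ forall k, S k -> inner (fun x => f x - h x) k = 0].

Definition bounded_op (K : op) : Prop :=
  [/\ (forall f, L2 f -> L2 (K f)),
      (forall (a : C) f g, L2 f -> L2 g ->
         aeq (K (fun x => a * f x + g x)) (fun x => a * K f x + K g x)) &
      exists M : R, forall f, L2 f -> L2norm (K f) <= M * L2norm f].

(* The order of R[i] makes [0 <= z] mean that z is real and nonnegative. *)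
Definition positive_op (K : op) : Prop :=
  bounded_op K /\ forall f, L2 f -> 0 <= inner (K f) f.

Definition is_adjoint (K K' : op) : Prop :=
  bounded_op K' /\
  forall f g, L2 f -> L2 g -> inner (K f) g = inner f (K' g).

(* |K|: the positive square root of K^*K, for K bounded. *)
Definition abs_op (K : op) : op :=
  xget (fun _ _ => 0)
    [set A | positive_op A /\
       exists2 K', is_adjoint K K' & forall f, L2 f -> aeq (A (A f)) (K' (K f))].

Definition orthonormal (S : set fn) : Prop :=
  [/\ S `<=` L2, (forall e, S e -> inner e e = 1) &
      forall e e', S e -> S e' -> e <> e' -> inner e e' = 0].

Definition orthonormal_basis (S : set fn) : Prop :=
  orthonormal S /\
  forall f, L2 f -> (forall e, S e -> inner f e = 0) -> aeq f (fun=> 0).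

(* Only used for positive A, for which the sum over an orthonormal basis does
   not depend on the basis, so that the set below is a singleton. *)
Definition trace (A : op) : \bar R :=
  ereal_sup
    [set \esum_(e in S) (complex.Re (inner (A e) e))%:E
       | S in orthonormal_basis].

Definition trace_norm (K : op) : \bar R := trace (abs_op K).

Definition trace_class (K : op) : Prop :=
  bounded_op K /\ (trace_norm K < +oo)%E.

Definition vec_angle (f g : fn) : R :=
  acos (complex.Re (inner f g) / (L2norm f * L2norm g)).

(* Extended-real infimum: the angle is +oo if one of the spaces is 0. *)
Definition angle (H1 H2 : set fn) : \bar R :=
  ereal_inf [set (vec_angle fg.1 fg.2)%:E | fg in
    [set fg : fn * fn | [/\ H1 fg.1, H2 fg.2, ~ aeq fg.1 (fun=> 0) &
                           ~ aeq fg.2 (fun=> 0)]]].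

End ComplexL2.

Definition metric_bounded {R : realType} {E : metricType R} (B : set E) : Prop :=
  exists M : R, forall x y, B x -> B y -> mdist x y <= M.

Section LocalSpaces.
Context {R : realType} {E : completeMetricType R}.
Variable mu : {measure set (borel E) -> \bar R}.

Definition L2loc : set (borel E -> R[i]) :=
  [set f | cmeasurable f /\
     forall B : set (borel E), measurable B -> metric_bounded (B : set E) ->
       (\int[mu]_(x in B) (sqmod (f x))%:E < +oo)%E].

Definition I1loc (K : (borel E -> R[i]) -> (borel E -> R[i])) : Prop :=
  bounded_op mu K /\
  forall B : set (borel E), measurable B -> metric_bounded (B : set E) ->
    trace_class mu (compress \1_B K).

Definition cvg_I1loc (K : nat -> (borel E -> R[i]) -> (borel E -> R[i]))
    (K' : (borel E -> R[i]) -> (borel E -> R[i])) : Prop :=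
  [/\ forall n, I1loc (K n), I1loc K' &
      forall B : set (borel E), measurable B -> metric_bounded (B : set E) ->
        trace_norm mu (compress \1_B (fun f x => K n f x - K' f x))
          @[n --> \oo] --> 0%E].

End LocalSpaces.

(* Main.v *)
From HB Require Import structures.
From mathcomp Require Import all_boot all_order all_algebra.
From mathcomp Require Import all_classical all_reals all_analysis.
From mathcomp Require Import measurable_realfun complex ring lra.
Require Import Defs.

(* Write T_n for the multiplication by sqrt g_n.  Since chi_(E \ E0) Q is
   Hilbert-Schmidt and g_n -> 1 uniformly on E0 and on bounded sets, T_n is almost
   isometric on L for large n; hence T_n L is closed, and its projection P_n is
   such that (P_n - Q) chi_B tends to 0 in Hilbert-Schmidt norm.  The space
   sqrt g_n H exceeds T_n L by the image of V, of bounded dimension.  As no nonzero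
   element of V is in L_2, a compactness argument shows that the mass of
   sqrt g_n phi on a bounded set becomes negligible with respect to its norm,
   uniformly in phi in V; by the bound on the angle this remains true of
   sqrt g_n phi - P_n (sqrt g_n phi), so that the remaining part of the projection
   times chi_B also tends to 0 in Hilbert-Schmidt norm.  Finally
   chi (Pi - Q) chi = (Pi chi)^* ((Pi - Q) chi) + ((Pi - Q) chi)^* (Q chi) turns
   Hilbert-Schmidt estimates into trace-norm estimates.  For small n, T_n is
   almost isometric on a subspace of L of finite codimension, by condition (1).

   Everything is done in the real Hilbert space underlying L_2; vectors are
   functions rather than classes, so the inner product is only semidefinite. *)

Set Implicit Arguments.
Unset Strict Implicit.
Unset Printing Implicit Defensive.

Import Order.TTheory GRing.Theory Num.Theory.
Import numFieldNormedType.Exports.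

Local Open Scope classical_set_scope.
Local Open Scope ring_scope.

(** * Real semi-Hilbert spaces and Hilbert-Schmidt sums *)

(** [orth_proj] and [abs_op] are choices, determined only up to null functions. Operators are
    therefore bare maps used through pairings and quadratic forms, and each exact identity becomes a
    difference with [nsq] equal to 0. Trace norms involve an absolute value, met from two sides.
    Upper bounds remove it by polar decomposition. To extract Hilbert-Schmidt bounds from the
    hypotheses, the compression of a projection must be recognized as its own absolute value, which
    is uniqueness of the positive square root. The obstacle is that g_n need not be near 1 far from
    E0, and that V lies outside L_2. On L the far region costs little, because cutting chi_(E \ E0)
    Q off outside large bounded sets makes it small in Hilbert-Schmidt norm. For V the compactness
    argument needs one fixed space of square-integrable functions: sqrt g_0 V serves, and the other
    weights are compared with g_0 on bounded sets. Its seminorms are the masses of phi on growing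
    bounded sets; were they bounded for some nonzero phi, phi would be in L_2. *)

HB.mixin Record isSemiHilbert (R : realType) X of GRing.Lmodule R X := {
  ip : X -> X -> R;
  ip_linear : forall a x y z, ip (a *: x + y) z = a * ip x z + ip y z;
  ipC : forall x y, ip x y = ip y x;
  ip_ge0 : forall x, 0 <= ip x x;
  ip_complete : forall u : nat -> X,
    (forall e : R, 0 < e -> exists N, forall i j, (N <= i)%N -> (N <= j)%N ->
       ip (u i - u j) (u i - u j) < e) ->
    exists x, forall e : R, 0 < e -> exists N, forall k, (N <= k)%N ->
       ip (u k - x) (u k - x) < e }.

#[short(type="semiHilbertType")]
HB.structure Definition SemiHilbert (R : realType) :=
  {X of isSemiHilbert R X & GRing.Lmodule R X}.

Section SemiHilbertTheory.
Context {R : realType} {X : semiHilbertType R}.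
Implicit Types (x y z : X) (S : set X) (a e : R).

Definition nsq x : R := ip x x.

Lemma nsq_ge0 x : 0 <= nsq x. Proof. exact: ip_ge0. Qed.

Lemma ipDl x y z : ip (x + y) z = ip x z + ip y z.
Proof. by rewrite -[x in LHS]scale1r ip_linear mul1r. Qed.

Lemma ip0l z : ip 0 z = 0.
Proof. by have := ip_linear 1 0 0 z; rewrite scale1r addr0 => ?; lra. Qed.

Lemma ipZl a x z : ip (a *: x) z = a * ip x z.
Proof. by rewrite -[a *: x]addr0 ip_linear ip0l addr0. Qed.

Lemma ipNl x z : ip (- x) z = - ip x z.
Proof. by rewrite -scaleN1r ipZl mulN1r. Qed.

Lemma ipBl x y z : ip (x - y) z = ip x z - ip y z.
Proof. by rewrite ipDl ipNl. Qed.

Lemma ipDr x y z : ip z (x + y) = ip z x + ip z y.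
Proof. by rewrite ipC ipDl !(ipC z). Qed.

Lemma ip0r z : ip z 0 = 0. Proof. by rewrite ipC ip0l. Qed.

Lemma ipZr a x z : ip z (a *: x) = a * ip z x.
Proof. by rewrite ipC ipZl (ipC z). Qed.

Lemma ipNr x z : ip z (- x) = - ip z x.
Proof. by rewrite ipC ipNl (ipC z). Qed.

Lemma ipBr x y z : ip z (x - y) = ip z x - ip z y.
Proof. by rewrite ipDr ipNr. Qed.

Definition ipE := (ipDl, ipDr, ipNl, ipNr, ipZl, ipZr, ip0l, ip0r).

Lemma nsq0 : nsq 0 = 0. Proof. exact: ip0l. Qed.

Lemma nsqN x : nsq (- x) = nsq x.
Proof. by rewrite /nsq !ipE opprK. Qed.

Lemma nsqB_sym x y : nsq (x - y) = nsq (y - x).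
Proof. by rewrite -nsqN opprB. Qed.

Lemma nsqZ a x : nsq (a *: x) = a ^+ 2 * nsq x.
Proof. by rewrite /nsq !ipE; ring. Qed.

Lemma nsqD x y : nsq (x + y) = nsq x + 2 * ip x y + nsq y.
Proof. by rewrite /nsq !ipE (ipC y x); ring. Qed.

Lemma nsqB x y : nsq (x - y) = nsq x - 2 * ip x y + nsq y.
Proof. by rewrite /nsq !ipE (ipC y x); ring. Qed.

(* Cauchy-Schwarz for a positive semidefinite symmetric form, here presented
   through its values on the plane spanned by two vectors. *)
Lemma psd_CS (p q r : R) : (forall s t : R, 0 <= s ^+ 2 * p + 2 * s * t * q + t ^+ 2 * r) ->
  q ^+ 2 <= p * r.
Proof.
move=> H.
have p0 : 0 <= p by have := H 1 0; lra.
have [p1|p1] := eqVneq p 0.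
  rewrite p1 mul0r; have [->|q0] := eqVneq q 0; first by rewrite expr0n.
  have := H (- (r + 1) / (2 * q)) 1; rewrite {}p1.
  have -> : (- (r + 1) / (2 * q)) ^+ 2 * 0 + 2 * (- (r + 1) / (2 * q)) * 1 * q + 1 ^+ 2 * r = -1 :> R.
    by field; rewrite q0.
  lra.
(* At s = -q, t = p the form equals p (p r - q^2). *)
have := H (- q) p; have : 0 < p by rewrite lt_def p1.
nra.
Qed.

Lemma CS x y : ip x y ^+ 2 <= nsq x * nsq y.
Proof.
apply: psd_CS => s t; have := nsq_ge0 (s *: x + t *: y).
by rewrite nsqD !nsqZ !ipE; congr (_ <= _); ring.
Qed.

Lemma ip_null x y : nsq x = 0 -> ip x y = 0.
Proof.
move=> h; have := CS x y; rewrite h mul0r => h1.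
by apply/eqP; rewrite -sqrf_eq0 eq_le h1 sqr_ge0.
Qed.

Lemma ip_nullr x y : nsq x = 0 -> ip y x = 0.
Proof. by rewrite ipC; exact: ip_null. Qed.

Lemma ip_eql x y z : nsq (x - y) = 0 -> ip x z = ip y z.
Proof. by move=> /ip_null -/(_ z); rewrite ipBl => ?; lra. Qed.

Lemma nsq_eq x y : nsq (x - y) = 0 -> nsq x = nsq y.
Proof. by move=> h; rewrite /nsq (ip_eql _ h) ipC (ip_eql _ h). Qed.

Lemma nsq_weak x : (forall z, ip x z = 0) -> nsq x = 0. Proof. exact. Qed.

Lemma AMGM x y t : 0 < t -> 2 * ip x y <= t * nsq x + t^-1 * nsq y.
Proof.
move=> t0; have := nsq_ge0 (t *: x - y); rewrite nsqB nsqZ !ipE => h.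
rewrite -(ler_pM2l t0) mulrDr [t * (_^-1 * _)]mulrA divff ?gt_eqF // mul1r; nra.
Qed.

Lemma AMGMN x y t : 0 < t -> - (2 * ip x y) <= t * nsq x + t^-1 * nsq y.
Proof. by move=> t0; have := AMGM x (- y) t0; rewrite nsqN ipNr; lra. Qed.

Lemma subBB x y z : x - y - (x - z) = z - y.
Proof. by rewrite opprB addrC addrA subrK. Qed.

Lemma nsqD_le x y : nsq (x + y) <= 2 * nsq x + 2 * nsq y.
Proof. by have := nsq_ge0 (x - y); rewrite nsqB (nsqD x); lra. Qed.

Lemma nsqB_le x y : nsq (x - y) <= 2 * nsq x + 2 * nsq y.
Proof. by have := nsqD_le x (- y); rewrite nsqN. Qed.

Lemma nsqB_le3 x y z : nsq (x - z) <= 2 * nsq (x - y) + 2 * nsq (y - z).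
Proof. by have := nsqD_le (x - y) (y - z); rewrite addrA subrK. Qed.

Definition convergesto (u : nat -> X) x := forall e : R, 0 < e ->
  exists N, forall k, (N <= k)%N -> nsq (u k - x) < e.

Definition cauchyseq (u : nat -> X) := forall e : R, 0 < e ->
  exists N, forall i j, (N <= i)%N -> (N <= j)%N -> nsq (u i - u j) < e.

Lemma cauchyseq_cvg u : cauchyseq u -> exists x, convergesto u x.
Proof. exact: ip_complete. Qed.

Lemma convergesto_cauchy u x : convergesto u x -> cauchyseq u.
Proof.
move=> h e e0; have [|N hN] := h (e / 4); first lra.
exists N => i j /hN hi /hN hj.
by have := nsqB_le3 (u i) x (u j); rewrite (nsqB_sym x); lra.
Qed.

Definition subspace S := S 0 /\ forall a x y, S x -> S y -> S (a *: x + y).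

Lemma subspaceD S x y : subspace S -> S x -> S y -> S (x + y).
Proof. by case=> _ h sx sy; have := h 1 x y sx sy; rewrite scale1r. Qed.

Lemma subspaceZ S a x : subspace S -> S x -> S (a *: x).
Proof. by case=> h0 h sx; have := h a x 0 sx h0; rewrite addr0. Qed.

Lemma subspaceB S x y : subspace S -> S x -> S y -> S (x - y).
Proof.
by case=> _ h sx sy; have := h (-1) y x sy sx; rewrite scaleN1r addrC.
Qed.

Definition clos S x := forall e : R, 0 < e -> exists2 s, S s & nsq (x - s) < e.

Lemma clos_seq S x : clos S x ->
  exists2 u : nat -> X, (forall k, S (u k)) & convergesto u x.
Proof.
move=> h.
have h' (k : nat) : exists s, S s /\ nsq (x - s) < k.+1%:R^-1.
  by have [|s ss ?] := h (k.+1%:R^-1); [rewrite invr_gt0|exists s].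
have [u hu] := choice h'; exists u; first by move=> k; have [] := hu k.
move=> e e0; exists `|Num.ceil e^-1|%N => k hk.
rewrite nsqB_sym; apply: (lt_le_trans (hu k).2).
rewrite invf_ple ?posrE //; apply: (le_trans (ceil_ge _)).
have : 0 <= Num.ceil e^-1.
  by rewrite -(ler_int R) (le_trans _ (ceil_ge _))// invr_ge0 ltW.
move=> h0; rewrite -[Num.ceil _](gez0_abs h0) /= pmulrn -pmulrn.
by rewrite ler_nat (leq_trans hk).
Qed.

(** First-order condition at a minimum: if b is nonzero, t = -b / (1 + |c|) lets the linear term
    win. *)
Lemma quad_eq0 (b c : R) : (forall t : R, 0 <= t * b + t ^+ 2 * c) -> b = 0.
Proof.
move=> h; apply/eqP; rewrite eq_le; apply/andP; split; rewrite leNgt; apply/negP => b0.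
- have := h (- b / (1 + `|c|)); have c0 := normr_ge0 c; have cc := ler_norm c.
  set d := 1 + `|c|; have d0 : 0 < d by rewrite /d; lra.
  have -> : - b / d * b + (- b / d) ^+ 2 * c = b ^+ 2 * (c - d) / d ^+ 2.
    by field; rewrite gt_eqF.
  rewrite leNgt => /negP; apply; rewrite pmulr_llt0 ?invr_gt0 ?exprn_gt0//.
  by rewrite pmulr_rlt0 ?exprn_gt0// /d; lra.
- have := h (- b / (1 + `|c|)); have c0 := normr_ge0 c; have cc := ler_norm c.
  set d := 1 + `|c|; have d0 : 0 < d by rewrite /d; lra.
  have -> : - b / d * b + (- b / d) ^+ 2 * c = b ^+ 2 * (c - d) / d ^+ 2.
    by field; rewrite gt_eqF.
  rewrite leNgt => /negP; apply; rewrite pmulr_llt0 ?invr_gt0 ?exprn_gt0//.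
  by rewrite pmulr_rlt0 ?exprn_even_gt0 //= ?lt_eqF// /d; lra.
Qed.

Lemma nsq_near x e : 0 < e ->
  exists2 d, 0 < d & forall z, nsq z < d -> `|nsq (x + z) - nsq x| < e.
Proof.
move=> e0; have nx := nsq_ge0 x.
pose t := e / (2 * (nsq x + 1)).
have t0 : 0 < t by rewrite divr_gt0 //; lra.
have tx : t * nsq x < e / 2.
  by rewrite /t mulrAC ltr_pdivrMr ?mulr_gt0//; [nra|lra].
clearbody t; have ti : 0 < t^-1 by rewrite invr_gt0.
exists (e / (2 * (1 + t^-1))); first by rewrite divr_gt0 // mulr_gt0 // addr_gt0.
move=> z; rewrite ltr_pdivlMr ?mulr_gt0 ?addr_gt0// => hz.
have h1 := AMGM x z t0; have h2 := AMGMN x z t0; have h3 := nsq_ge0 z.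
by rewrite nsqD ltr_norml; apply/andP; split; nra.
Qed.

(** S is not assumed closed, so the nearest point is sought in [clos S]. A minimizing sequence in S
    is Cauchy by the parallelogram identity at midpoints; orthogonality of the limit is the
    first-order condition along each line. *)
Lemma closure_proj S : subspace S ->
  forall y, exists2 p, clos S p & forall s, S s -> ip (y - p) s = 0.
Proof.
move=> sS y; have [S0 Sl] := sS.
pose A := [set nsq (y - s) | s in S].
have A0 : A (nsq (y - 0)) by exists 0.
have hiA : has_inf A.
  by split; [exists (nsq (y - 0))|exists 0 => _ [s _ <-]; exact: nsq_ge0].
pose d := inf A.
have dle s : S s -> d <= nsq (y - s) by move=> ss; apply: ge_inf; [case: hiA|exists s].
have h (k : nat) : exists s, S s /\ nsq (y - s) < d + k.+1%:R^-1.
  have [|_ [s ss <-] hs] := inf_adherent (eps := k.+1%:R^-1) _ hiA; first by rewrite invr_gt0.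
  by exists s.
have [u hu] := choice h.
have inve (e : R) : 0 < e -> exists N, forall k, (N <= k)%N -> k.+1%:R^-1 < e.
  move=> e0; have [N _ hN] : \forall k \near \oo, (k.+1%:R^-1 : R) < e.
    have := near_infty_natSinv_lt (PosNum e0); apply.
  by exists N => k /hN.
have cu : cauchyseq u.
  move=> e e0; have [|N hN] := inve (e / 4); first lra.
  exists N => i j /hN hi /hN hj; have [si li] := hu i; have [sj lj] := hu j.
  have hm : d <= nsq (y - (1/2) *: (u i + u j)).
    by apply: dle; apply: subspaceZ => //; exact: subspaceD.
  suff heq : nsq (u i - u j) = 2 * nsq (y - u i) + 2 * nsq (y - u j)
           - 4 * nsq (y - (1/2) *: (u i + u j)) by
      move: hi hj li lj; rewrite heq; move: (i.+1%:R^-1) (j.+1%:R^-1) => p q; lra.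
  rewrite /nsq !ipE (ipC _ y) (ipC (u j) y) (ipC (u j) (u i)); by field.
have [p hp] := cauchyseq_cvg cu; exists p.
  move=> e /hp[N /(_ N (leqnn _))]; rewrite nsqB_sym => ?.
  by exists (u N) => //; have [] := hu N.
have pd t s : S s -> d <= nsq (y - p - t *: s).
  move=> ss; rewrite leNgt; apply/negP => hlt.
  set x := y - p - t *: s in hlt *.
  have [|d1 d10 hd] := @nsq_near x (d - nsq x); first lra.
  have [N /(_ N (leqnn _))] := hp _ d10; rewrite nsqB_sym => /hd.
  rewrite ltr_norml => /andP[_ h1].
  have : nsq (x + (p - u N)) < d by lra.
  rewrite /x.
  have -> : y - p - t *: s + (p - u N) = y - (t *: s + u N).
    by rewrite addrACA subrK opprD.
  rewrite ltNge dle //; apply: Sl => //; by have [] := hu N.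
have dp : nsq (y - p) <= d.
  rewrite leNgt; apply/negP => hlt.
  have [|d1 d10 hd] := @nsq_near (y - p) ((nsq (y - p) - d) / 2); first lra.
  have [N hN] := hp _ d10.
  have [|N1 hN1] := inve ((nsq (y - p) - d) / 2); first lra.
  have := hN (maxn N N1) (leq_maxl _ _); rewrite nsqB_sym => /hd.
  have := hN1 (maxn N N1) (leq_maxr _ _); have [_] := hu (maxn N N1).
  rewrite addrA subrK ltr_norml; move: (_^-1) => q h1 h2 /andP[h3 h4]; lra.
move=> s ss.
suff : -2 * ip (y - p) s = 0 by lra.
apply: (@quad_eq0 _ (nsq s)) => t.
have := pd t s ss; rewrite (nsqB (y - p)) nsqZ ipZr; lra.
Qed.

(** P may be any choice of nearest points: it is determined up to null vectors and is linear only in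
    that sense. *)
Definition is_proj S (P : X -> X) :=
  forall x, S (P x) /\ forall k, S k -> ip (x - P x) k = 0.

Definition projectable S := exists P, is_proj S P.

Lemma closed_projectable S : subspace S ->
  (forall x, clos S x -> exists2 s, S s & nsq (x - s) = 0) -> projectable S.
Proof.
move=> sS cS.
suff h x : exists h, S h /\ forall k, S k -> ip (x - h) k = 0.
  by have [P hP] := choice h; exists P.
have [p /cS[s ss hs] hp] := closure_proj sS x.
exists s; split=> // k sk; have := hp k sk.
by rewrite !ipBl (ip_eql _ hs).
Qed.

Definition adj (K K' : X -> X) := forall x y, ip (K x) y = ip x (K' y).

Lemma adjC K K' : adj K K' -> adj K' K.
Proof. by move=> h x y; rewrite ipC -h ipC. Qed.

Lemma adj_comp K K' J J' : adj K K' -> adj J J' -> adj (K \o J) (J' \o K').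
Proof. by move=> h h' x y /=; rewrite h h'. Qed.

Lemma adjB K K' J J' : adj K K' -> adj J J' ->
  adj (fun x => K x - J x) (fun x => K' x - J' x).
Proof. by move=> h h' x y /=; rewrite ipBl ipBr h h'. Qed.

(** An adjoint controls pairings only, hence linearity modulo null vectors; the same holds for the
    next three facts. *)
Lemma adj_linB K K' x y : adj K K' -> nsq (K (x - y) - (K x - K y)) = 0.
Proof. by move=> h; apply: nsq_weak => z; rewrite ipBl ipBl !h ipBl subrr. Qed.

Lemma adj_linD K K' x y : adj K K' -> nsq (K (x + y) - (K x + K y)) = 0.
Proof. by move=> h; apply: nsq_weak => z; rewrite ipBl ipDl !h ipDl subrr. Qed.

Lemma adj_linZ K K' a x : adj K K' -> nsq (K (a *: x) - (a *: K x)) = 0.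
Proof. by move=> h; apply: nsq_weak => z; rewrite ipBl ipZl !h ipZl subrr. Qed.

Lemma adj_null K K' x y : adj K K' -> nsq (x - y) = 0 -> nsq (K x - K y) = 0.
Proof. by move=> h e; apply: nsq_weak => z; rewrite ipBl !h (ip_eql _ e) subrr. Qed.

(** * Orthogonal projections, up to null vectors *)

Section Projection.
Context {S : set X} {P : X -> X} (sS : subspace S) (hP : is_proj S P).

Lemma proj_mem x : S (P x). Proof. by have [] := hP x. Qed.

Lemma proj_ip x k : S k -> ip (P x) k = ip x k.
Proof. by move=> sk; have [_ /(_ k sk)] := hP x; rewrite ipBl => ?; lra. Qed.

Lemma proj_adj : adj P P.
Proof.
move=> x y; rewrite -(proj_ip x (proj_mem y)) ipC [RHS]ipC.
by rewrite (proj_ip y (proj_mem x)).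
Qed.

Lemma nsq_proj x : nsq (P x) = ip x (P x).
Proof. by rewrite /nsq proj_ip //; exact: proj_mem. Qed.

Lemma nsqB_proj x : nsq (x - P x) = nsq x - nsq (P x).
Proof. by rewrite nsqB -nsq_proj; lra. Qed.

Lemma nsq_proj_le x : nsq (P x) <= nsq x.
Proof. by have := nsq_ge0 (x - P x); rewrite nsqB_proj; lra. Qed.

Lemma proj_uniq x h : S h -> (forall k, S k -> ip (x - h) k = 0) -> nsq (P x - h) = 0.
Proof.
move=> sh hh; have sk : S (P x - h) by apply: subspaceB => //; exact: proj_mem.
by have := hh _ sk; rewrite /nsq ipBl (ipBl (P x)) proj_ip.
Qed.

Lemma proj_id x : S x -> nsq (P x - x) = 0.
Proof. by move=> sx; apply: proj_uniq => // k _; rewrite subrr ip0l. Qed.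

Lemma proj_closed x : clos S x -> exists2 s, S s & nsq (x - s) = 0.
Proof.
move=> cx; exists (P x); first exact: proj_mem.
apply/eqP; rewrite eq_le nsq_ge0 andbT; apply/ler_addgt0Pl => e e0.
have [s ss hs] := cx e e0; rewrite addr0; apply: (le_trans _ (ltW hs)).
have -> : x - s = (x - P x) + (P x - s) by rewrite addrA subrK.
have k : S (P x - s) by apply: subspaceB => //; exact: proj_mem.
rewrite (nsqD (x - P x)) ipBl proj_ip // subrr; have := nsq_ge0 (P x - s); lra.
Qed.

End Projection.

Lemma proj_mono S S' P P' : is_proj S P -> is_proj S' P' -> S `<=` S' ->
  forall x, nsq (P x) <= nsq (P' x).
Proof.
move=> hP hP' ss x; have pm := proj_mem hP x.
have e : ip (P' x) (P x) = nsq (P x) by rewrite (proj_ip hP') ?(nsq_proj hP)//; exact: ss.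
by have := nsq_ge0 (P' x - P x); rewrite nsqB e; lra.
Qed.

Definition addv S v : set X := [set x | exists c : R, S (x - c *: v)].

(** S plus the real span of s, as an iterated one-vector extension, so that projections can be
    updated one rank at a time. *)
Definition span S (s : seq X) : set X := foldr (fun v T => addv T v) S s.

Lemma addv_subspace S v : subspace S -> subspace (addv S v).
Proof.
move=> [S0 Sl]; split; first by exists 0; rewrite scale0r subr0.
move=> a x y [c hc] [d hd]; exists (a * c + d); have := Sl a _ _ hc hd.
by congr S; rewrite scalerBr scalerA scalerDl opprD addrACA.
Qed.

Lemma addv_sub S v : S `<=` addv S v.
Proof. by move=> x Sx; exists 0; rewrite scale0r subr0. Qed.

Lemma addv_mem S v : subspace S -> addv S v v.
Proof. by case=> S0 _; exists 1; rewrite scale1r subrr. Qed.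

Lemma span_subspace S s : subspace S -> subspace (span S s).
Proof. by move=> h; elim: s => //= v s; exact: addv_subspace. Qed.

Lemma span_sub S s : S `<=` span S s.
Proof. by elim: s => //= v s h; apply: subset_trans h _; exact: addv_sub. Qed.

Lemma span_mem S s v : subspace S -> v \in s -> span S s v.
Proof.
move=> sS; elim: s => //= w s IH; rewrite inE => /orP[/eqP->|/IH h].
  by apply: addv_mem; exact: span_subspace.
exact: addv_sub.
Qed.

Lemma span_min S T s : subspace T -> S `<=` T -> (forall v, v \in s -> T v) ->
  span S s `<=` T.
Proof.
move=> sT ST; elim: s => //= v s IH h x [c hc].
have -> : x = c *: v + (x - c *: v) by rewrite addrC subrK.
apply: sT.2; first by apply: h; rewrite inE eqxx.
by apply: IH => // w ws; apply: h; rewrite inE ws orbT.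
Qed.

Lemma span_split S s x : subspace S -> span S s x ->
  exists y z, [/\ S y, span [set 0] s z & x = y + z].
Proof.
move=> sS; elim: s x => /= [x Sx|v s IH x [c /IH[y [z [Sy sz e]]]]].
  by exists x, 0; split=> //; rewrite addr0.
exists y, (z + c *: v); split=> //; first by exists c; rewrite addrK.
by rewrite addrA -e subrK.
Qed.

Lemma subspace0 : subspace [set (0 : X)].
Proof. by split=> // a x y -> ->; rewrite scaler0 addr0. Qed.

Lemma proj0 : is_proj [set 0] (fun _ : X => 0).
Proof. by move=> x; split => // k ->; rewrite ip0r. Qed.

(** A Gram-Schmidt step. If v is already in S up to a null vector, then [nsq w] is 0 and division by
    zero gives coefficient 0, so the formula stays correct. *)
Lemma addv_proj S P v (w := v - P v) : subspace S -> is_proj S P ->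
  is_proj (addv S v) (fun x => P x + (ip x w / nsq w) *: w).
Proof.
move=> sS hP x; set c := ip x w / nsq w.
have hw k : S k -> ip w k = 0 by move=> sk; have [_ ->] := hP v.
have hc : c * nsq w = ip x w.
  have [n0|n0] := eqVneq (nsq w) 0; last by rewrite /c divfK.
  by rewrite n0 mulr0 ip_nullr.
split.
  exists c; rewrite -addrA -scalerBr /w addrAC subrr sub0r scalerN.
  by apply: subspaceB => //; [exact: (proj_mem hP)|apply: subspaceZ => //; exact: (proj_mem hP)].
move=> k [b hb]; have -> : k = (k - b *: v) + b *: v by rewrite subrK.
rewrite opprD addrA ipBl ipZl !(ipDr (_ - _)) (hw _ hb) add0r !ipZr.
rewrite (proj2 (hP x)) //.
have Pm u : S (P u) by exact: (proj_mem hP).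
have e1 : ip w v = nsq w.
  by rewrite -{1}(subrK (P v) v) ipDr (hw (P v)) ?addr0.
have e2 : ip (x - P x) v = ip x w.
  rewrite -{1}(subrK (P v) v) ipDr (proj2 (hP x) (P v)) ?addr0//.
  by rewrite ipBl [ip (P x) _]ipC hw ?subr0.
by rewrite e1 e2 -hc; ring.
Qed.

(** If D = A - B is not positive, let -m < 0 be the bottom of its form. Near the bottom D x is close
    to -m x, while <D x, (A + B) x> = |A x|^2 - |B x|^2 = 0. So m <x, (A + B) x> would have to be
    small; but <x, (A + B) x> is at least -<D x, x>, which is close to m |x|^2. *)
Lemma sqrt_uniq_le (A B : X -> X) (c : R) : adj A A -> adj B B ->
  (forall x, 0 <= ip (A x) x) -> (forall x, 0 <= ip (B x) x) ->
  (forall x, nsq (B x) <= c * nsq x) ->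
  (forall x, nsq (A x) = nsq (B x)) ->
  forall x, ip (B x) x <= ip (A x) x.
Proof.
move=> aA aB pA pB hB eAB x0; rewrite leNgt; apply/negP => hlt.
have c0 : 0 <= `|c| by [].
have {}hB x : nsq (B x) <= `|c| * nsq x.
  by apply: (le_trans (hB x)); apply: ler_wpM2r; [exact: nsq_ge0|exact: ler_norm].
have {}hlt0 : 0 < nsq x0.
  rewrite lt_def nsq_ge0 andbT; apply/eqP => n0.
  by move: hlt; rewrite !(ip_nullr _ n0) ltxx.
pose D x := A x - B x; pose d x := ip (D x) x.
have dB x : - d x <= (`|c| + 1) / 2 * nsq x.
  rewrite /d /D ipBl; have := AMGM (B x) x ltr01; rewrite invr1.
  have := hB x; have := pA x; lra.
pose V := [set - d x / nsq x | x in [set x | 0 < nsq x]].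
have V0 : V (- d x0 / nsq x0) by exists x0.
have hsV : has_sup V.
  split; first by exists (- d x0 / nsq x0).
  by exists ((`|c| + 1) / 2) => _ [x /= hx <-]; rewrite ler_pdivrMr.
pose m := sup V.
have m0 : 0 < m.
  apply: (@lt_le_trans _ _ (- d x0 / nsq x0)); last by apply: sup_upper_bound.
  by rewrite divr_gt0 // /d /D ipBl; lra.
have q0 x : 0 <= d x + m * nsq x.
  have [n0|n0] := eqVneq (nsq x) 0.
    by rewrite n0 mulr0 addr0 /d (ip_nullr _ n0).
  have hx : 0 < nsq x by rewrite lt_def n0 nsq_ge0.
  have : - d x / nsq x <= m by apply: sup_upper_bound => //; exists x.
  by rewrite ler_pdivrMr //; lra.
have aD : adj D D by exact: adjB.
pose P x := D x + m *: x.
have aP : adj P P by move=> x y; rewrite /P ipDl ipDr aD ipZl ipZr.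
have qE x : ip (P x) x = d x + m * nsq x by rewrite /P ipDl ipZl.
have qCS x y : ip (P x) y ^+ 2 <= ip (P x) x * ip (P y) y.
  apply: psd_CS => s t; have h := q0 (s *: x + t *: y); move: h; rewrite -qE.
  have -> : ip (P (s *: x + t *: y)) (s *: x + t *: y) =
      s * (s * ip x (P x) + t * ip y (P x)) + t * (s * ip x (P y) + t * ip y (P y)).
    by rewrite ipDr !ipZr !(aP (_ + _)) !ipDl !ipZl.
  by rewrite -!aP (ipC (P y) x) -aP => h; apply: (le_trans h); rewrite le_eqVlt; apply/orP; left; apply/eqP; ring.
pose C := (`|c| + 1) + m.
have C0 : 0 < C by rewrite /C; lra.
have dU x : d x <= (`|c| + 1) * nsq x.
  rewrite /d /D ipBl; have := AMGM (A x) x ltr01; rewrite invr1 eAB.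
  have := hB x; have := pB x; have := nsq_ge0 x; nra.
have qC x : ip (P x) x <= C * nsq x by rewrite qE /C; have := dU x; lra.
(* Cauchy-Schwarz for the form of P, at x and P x: a small value of the form forces P x to be
   small. *)
have nP x : nsq (P x) <= C * ip (P x) x.
  have [n0|n0] := eqVneq (nsq (P x)) 0; first by rewrite n0 mulr_ge0 ?(ltW C0)// qE.
  have hx : 0 < nsq (P x) by rewrite lt_def n0 nsq_ge0.
  have := qCS x (P x); rewrite -/(nsq (P x)) => h1.
  have := qC (P x) => h2; have h3 := q0 x; rewrite -qE in h3.
  rewrite -(ler_pM2r hx); apply: (le_trans _ (le_trans h1 _)); first by rewrite expr2.
  by rewrite [C * _]mulrC -mulrA ler_wpM2l.
(* Chosen so that t times 4 (|c| + 1) |x|^2, a bound for t |(A + B) x|^2, is half of m^2 |x|^2. *)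
pose t := m ^+ 2 / (8 * (`|c| + 1)).
have c1 : 0 < `|c| + 1 by lra.
have t0 : 0 < t by rewrite divr_gt0 ?exprn_gt0 ?mulr_gt0.
have key x : m ^+ 2 / 2 * nsq x <= (C * t^-1 + 2 * m) * ip (P x) x.
  pose Sx := A x + B x.
  have z : ip (D x) Sx = 0.
    by rewrite /D /Sx ipBl !ipDr -/(nsq (A x)) -/(nsq (B x)) eAB (ipC (B x) (A x)); ring.
  have e1 : ip (D x) Sx = ip (P x) Sx - m * ip x Sx by rewrite /P ipDl ipZl; ring.
  have e2 : - d x <= ip x Sx.
    by rewrite /d /D /Sx ipBl ipDr !(ipC x); have := pA x; have := pB x; lra.
  have e3 := AMGM Sx (P x) t0; rewrite (ipC Sx) in e3.
  have e4 : nsq Sx <= 4 * `|c| * nsq x.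
    by have := nsqD_le (A x) (B x); rewrite eAB -/Sx; have := hB x; lra.
  have e5 : t * nsq Sx <= m ^+ 2 / 2 * nsq x.
    apply: (@le_trans _ _ (t * (4 * (`|c| + 1) * nsq x))).
      rewrite ler_pM2l //; apply: (le_trans e4); have := nsq_ge0 x; nra.
    by rewrite /t le_eqVlt; apply/orP; left; apply/eqP; field; rewrite gt_eqF.
  have e6 : t^-1 * nsq (P x) <= t^-1 * (C * ip (P x) x).
    by rewrite ler_pM2l ?invr_gt0 //.
  have e7 : m * - d x <= m * ip x Sx by rewrite ler_pM2l.
  have e8 : m * - d x = m ^+ 2 * nsq x - m * ip (P x) x by rewrite qE; ring.
  rewrite mulrDl; have -> : C * t^-1 * ip (P x) x = t^-1 * (C * ip (P x) x) by ring.
  have e9 : 0 <= m ^+ 2 * nsq x by apply: mulr_ge0; [exact: sqr_ge0|exact: nsq_ge0].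
  lra.
pose L := C * t^-1 + 2 * m.
have L0 : 0 < L by rewrite /L addr_gt0 ?mulr_gt0 ?invr_gt0.
pose k := m ^+ 2 / 2 / L.
have k0 : 0 < k by rewrite divr_gt0 // divr_gt0 ?exprn_gt0.
(* The form of P is bounded below by k > 0, so the supremum defining m can be lowered by k. *)
have : m <= m - k.
  apply: ge_sup; first by exists (- d x0 / nsq x0).
  move=> _ [x /= hx <-]; rewrite ler_pdivrMr //.
  have := key x; rewrite -/L qE => h.
  have : k * nsq x <= d x + m * nsq x.
    by rewrite /k mulrAC ler_pdivrMr // [_ * L]mulrC.
  lra.
lra.
Qed.

Lemma sqrt_uniq (A B : X -> X) (c : R) : adj A A -> adj B B ->
  (forall x, 0 <= ip (A x) x) -> (forall x, 0 <= ip (B x) x) ->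
  (forall x, nsq (B x) <= c * nsq x) ->
  (forall x, nsq (A x) = nsq (B x)) ->
  forall x, ip (A x) x = ip (B x) x.
Proof.
move=> aA aB pA pB hB e x; apply/eqP; rewrite eq_le.
rewrite (sqrt_uniq_le aB aA _ _ (c := c))//= ?(sqrt_uniq_le aA aB _ _ (c := c))//.
by move=> y; rewrite e.
Qed.

Lemma clos_orth S z v : clos S v -> (forall s, S s -> ip z s = 0) -> ip z v = 0.
Proof.
move=> cv h; apply/eqP; rewrite -sqrf_eq0 eq_le sqr_ge0 andbT.
apply/ler_addgt0Pl => e e0; rewrite addr0.
have nz : 0 < nsq z + 1 by have := nsq_ge0 z; lra.
have [|s ss hs] := cv (e / (nsq z + 1)); first by rewrite divr_gt0.
have -> : ip z v = ip z (v - s) by rewrite ipBr (h _ ss) subr0.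
apply: (le_trans (CS _ _)); move: hs; rewrite ltr_pdivlMr // => hs.
have := nsq_ge0 (v - s); nra.
Qed.

(** * Polar decomposition by extending an isometry to closures *)

Section Polar.
Variables A A' J J' : X -> X.
Hypotheses (aA : adj A A') (aJ : adj J J') (eAJ : forall x, nsq (A x) = nsq (J x)).

(** The closure of the relation sending K x to M x. When A and J have equal norms, [graph_clos A J]
    is the graph of the isometric extension to the closure of the range of A; a relation is used
    because values are fixed only up to null vectors. *)
Definition graph_clos (K M : X -> X) (a b : X) := forall e : R, 0 < e ->
  exists x, nsq (a - K x) < e /\ nsq (b - M x) < e.

Lemma graph_closC K M (a b : X) : graph_clos K M a b -> graph_clos M K b a.
Proof. by move=> h e /h[x [? ?]]; exists x. Qed.

Lemma graph_clos_clos K M (a b : X) : graph_clos K M a b -> clos (range K) a.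
Proof. by move=> h e /h[x [? ?]]; exists (K x) => //; exists x. Qed.

Lemma graph_clos_nsq (a b : X) : graph_clos A J a b -> nsq a = nsq b.
Proof.
move=> h; apply/eqP; rewrite -subr_eq0 -normr_eq0 eq_le normr_ge0 andbT.
apply/ler_addgt0Pl => e e0; rewrite addr0.
have [|d d0 hd] := @nsq_near a (e / 2); first lra.
have [|d' d0' hd'] := @nsq_near b (e / 2); first lra.
have [|x [h1 h2]] := h (Num.min d d'); first by rewrite lt_min d0.
rewrite lt_min in h1; rewrite lt_min in h2.
have /hd : nsq (A x - a) < d by rewrite nsqB_sym; case/andP: h1.
have /hd' : nsq (J x - b) < d' by rewrite nsqB_sym; case/andP: h2.
rewrite ![_ + (_ - _)]addrC !subrK eAJ => l1 l2.
have -> : nsq a - nsq b = (nsq (J x) - nsq b) - (nsq (J x) - nsq a) by ring.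
apply: (le_trans (ler_normB _ _)); lra.
Qed.

Lemma graph_closD (a b a' b' : X) : graph_clos A J a b -> graph_clos A J a' b' ->
  graph_clos A J (a + a') (b + b').
Proof.
move=> h h' e e0; have e4 : 0 < e / 4 by lra.
have [x [h1 h2]] := h _ e4; have [x' [h1' h2']] := h' _ e4.
have tri (K K' : X -> X) c c' : adj K K' -> nsq (c - K x) < e / 4 -> nsq (c' - K x') < e / 4 ->
    nsq (c + c' - K (x + x')) < e.
  move=> aK l1 l2; rewrite (@nsq_eq _ ((c - K x) + (c' - K x'))).
    by have := nsqD_le (c - K x) (c' - K x'); lra.
  have := adj_linD x x' aK; rewrite -nsqN => <-; congr nsq.
  by rewrite [c - _ + _]addrACA -opprD subBB opprB.
by exists (x + x'); split; [exact: tri aA _ _|exact: tri aJ _ _].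
Qed.

Lemma graph_clos_ip (a b a' b' : X) : graph_clos A J a b -> graph_clos A J a' b' ->
  ip a a' = ip b b'.
Proof.
move=> h h'; have := graph_clos_nsq (graph_closD h h').
by rewrite !nsqD (graph_clos_nsq h) (graph_clos_nsq h'); lra.
Qed.

Lemma graph_clos_refl x : graph_clos A J (A x) (J x).
Proof. by move=> e e0; exists x; rewrite !subrr nsq0. Qed.

Lemma graph_clos_proj y : exists p u, graph_clos A J p u /\ forall x, ip (A x) (y - p) = 0.
Proof.
(* The range of A is a subspace only modulo null vectors, so it is saturated by them. *)
pose S := [set x | exists z, nsq (x - A z) = 0].
have sS : subspace S.
  split; first by exists 0; rewrite sub0r nsqN /nsq aA ip0l.
  move=> a x y' [z hz] [w hw]; exists (a *: z + w).
  apply: nsq_weak => t; rewrite ipBl aA !ipDl !ipZl -!aA.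
  by rewrite (ip_eql _ hz) (ip_eql _ hw) subrr.
have [p /clos_seq[v hv vp] hp] := closure_proj sS y.
have [z hz] := choice hv.
have zp : convergesto (A \o z) p.
  move=> e /vp[N hN]; exists N => k /hN; congr (_ < _); apply: nsq_eq => /=.
  by have := hz k; rewrite opprB addrA subrK.
(* A z_k and J z_k have the same mutual distances. *)
have cz : cauchyseq (J \o z).
  move=> e /(convergesto_cauchy zp)[N hN]; exists N => i j /hN h /h.
  congr (_ < _) => /=; rewrite -(nsq_eq (adj_linB (z i) (z j) aA)).
  by rewrite -(nsq_eq (adj_linB (z i) (z j) aJ)) eAJ.
have [u hu] := cauchyseq_cvg cz.
exists p, u; split; last first.
  by move=> x; rewrite ipC hp//; exists x; rewrite subrr nsq0.
move=> e e0; have [N hN] := zp e e0; have [M hM] := hu e e0.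
exists (z (maxn N M)); rewrite (nsqB_sym p) (nsqB_sym u); split.
  by apply: hN; rewrite leq_maxl.
by apply: hM; rewrite leq_maxr.
Qed.

End Polar.

(* U and W stand for the partial isometry of the polar decomposition J = U A
   and for its adjoint. *)
Lemma polar (A A' J J' : X -> X) : adj A A' -> adj J J' ->
  (forall x, nsq (A x) = nsq (J x)) ->
  exists U W : X -> X, [/\ (forall x y, ip (A x) y = ip (J x) (U y)),
    adj W U & forall v, nsq (W v) <= nsq v].
Proof.
move=> aA aJ e; have e' x : nsq (J x) = nsq (A x) by rewrite e.
have hU y : exists u, exists p, graph_clos A J p u /\ forall x, ip (A x) (y - p) = 0.
  by have [p [u h]] := graph_clos_proj aA aJ e y; exists u, p.
have hW v : exists w, exists q, graph_clos J A q w /\ forall x, ip (J x) (v - q) = 0.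
  by have [q [w h]] := graph_clos_proj aJ aA e' v; exists w, q.
have [U {}hU] := choice hU; have [W {}hW] := choice hW; exists U, W; split.
- move=> x y; have [p [gp hp]] := hU y.
  rewrite -(graph_clos_ip aA aJ e (graph_clos_refl _ _ x) gp).
  by have := hp x; rewrite ipBr => ?; lra.
- move=> v y; have [p [gp hp]] := hU y; have [q [gq hq]] := hW v.
  have g := graph_clos_ip aA aJ e (graph_closC gq) gp.
  have h1 : ip (v - q) (U y) = 0.
    apply: (clos_orth (graph_clos_clos (graph_closC gp))) => _ [x _ <-].
    by rewrite ipC.
  have h2 : ip (y - p) (W v) = 0.
    apply: (clos_orth (graph_clos_clos (graph_closC gq))) => _ [x _ <-].
    by rewrite ipC.
  by move: h1 h2; rewrite !ipBl (ipC y) (ipC p) => ? ?; lra.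
- move=> v; have [q [gq hq]] := hW v.
  rewrite (graph_clos_nsq e (graph_closC gq)).
  have : ip q (v - q) = 0.
    rewrite ipC; apply: (clos_orth (graph_clos_clos gq)) => _ [x _ <-].
    by rewrite ipC.
  by rewrite ipBr => h; have := nsq_ge0 (v - q); rewrite nsqB (ipC v) /nsq; lra.
Qed.

(** * Parseval families and Hilbert-Schmidt norms *)

Section Frames.
Implicit Types (I : choiceType).

(** Parseval's identity alone; it is all that the independence of Hilbert-Schmidt sums from the
    family requires. *)
Definition frame I (D : set I) (f : I -> X) := forall x,
  (\esum_(i in D) ((ip x (f i)) ^+ 2)%:E = (nsq x)%:E)%E.

(** The square of the Hilbert-Schmidt norm. *)
Definition HS I (D : set I) (f : I -> X) (Y : X -> X) : \bar R :=
  (\esum_(i in D) (nsq (Y (f i)))%:E)%E.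

Lemma ge0_esumZl I (D : set I) (a : R) (g : I -> \bar R) : 0 <= a ->
  (forall i, 0 <= g i)%E ->
  (\esum_(i in D) (a%:E * g i) = a%:E * \esum_(i in D) g i)%E.
Proof.
rewrite le_eqVlt => /predU1P[<-|a0] g0.
  by rewrite mul0e esum1 // => i _; rewrite mul0e.
have le (b : R) (h : I -> \bar R) : 0 < b -> (forall i, 0 <= h i)%E ->
    (\esum_(i in D) (b%:E * h i) <= b%:E * \esum_(i in D) h i)%E.
  move=> b0 h0; apply: ge_ereal_sup => _ [F [fF FD] <-].
  rewrite -ge0_mule_fsumr //; apply: lee_pmul => //.
  - exact: ltW.
  - by rewrite fsume_ge0.
  - by apply: ereal_sup_ubound; exists F.
apply/eqP; rewrite eq_le le //=.
rewrite -(@lee_pdivlMl _ a) //.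
apply: (le_trans _ (le a^-1 _ _ _)); last first.
- by move=> i; rewrite mule_ge0 // lee_fin ltW.
- by rewrite invr_gt0.
- by apply: le_esum => i _; rewrite muleA -EFinM mulVf ?mul1e // gt_eqF.
Qed.

Lemma HS_ge0 I (D : set I) f Y : (0 <= HS D f Y)%E.
Proof. by apply: esum_ge0 => i _; rewrite lee_fin nsq_ge0. Qed.

Lemma HS_le I (D : set I) f Y Z : (forall x, nsq (Y x) <= nsq (Z x)) ->
  (HS D f Y <= HS D f Z)%E.
Proof. by move=> h; apply: le_esum => i _; rewrite lee_fin. Qed.

Lemma esum_lin I (D : set I) (q z w : I -> R) a b c d : 0 <= a -> 0 <= b ->
  (forall i, 0 <= z i) -> (forall i, 0 <= w i) ->
  (forall i, D i -> q i <= a * z i + b * w i) ->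
  (\esum_(i in D) (z i)%:E <= c%:E)%E -> (\esum_(i in D) (w i)%:E <= d%:E)%E ->
  (\esum_(i in D) (q i)%:E <= (a * c + b * d)%:E)%E.
Proof.
move=> a0 b0 z0 w0 h hZ hW.
apply: (@le_trans _ _ (\esum_(i in D) (a%:E * (z i)%:E + b%:E * (w i)%:E))%E).
  by apply: le_esum => i Di; rewrite -!EFinM -EFinD lee_fin h.
rewrite esumD => [|i _|i _]; rewrite -?EFinM ?lee_fin ?mulr_ge0 //.
rewrite !ge0_esumZl //.
by rewrite EFinD !EFinM; apply: leeD; apply: lee_wpmul2l; rewrite ?lee_fin.
Qed.

Lemma HS_lin I (D : set I) f Y Z W a b c d : 0 <= a -> 0 <= b ->
  (forall x, nsq (Y x) <= a * nsq (Z x) + b * nsq (W x)) ->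
  (HS D f Z <= c%:E)%E -> (HS D f W <= d%:E)%E ->
  (HS D f Y <= (a * c + b * d)%:E)%E.
Proof. by move=> a0 b0 h; apply: esum_lin => // i; exact: nsq_ge0. Qed.

Lemma esum_swap I I' (D : set I) (D' : set I') (a : I -> I' -> \bar R) :
  (forall i j, 0 <= a i j)%E ->
  (\esum_(i in D) \esum_(j in D') a i j = \esum_(j in D') \esum_(i in D) a i j)%E.
Proof.
move=> a0; rewrite !esum_esum //.
rewrite (reindex_esum (D' `*` D) _ (fun w => (w.2, w.1)))//; split=> //=.
- by move=> [i j] [/=].
- by move=> [i1 i2] [j1 j2] /= _ _ [] -> ->.
- by move=> [i1 i2] [Pi1 Qi2] /=; exists (i2, i1).
Qed.

(** The squared matrix coefficients are summed in both orders. This gives at once the invariance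
    under adjoints and the independence from the family. *)
Lemma HS_adj I (D : set I) f I' (D' : set I') f' Y Y' : frame D f -> frame D' f' ->
  adj Y Y' -> HS D f Y = HS D' f' Y'.
Proof.
move=> hf hf' aY; rewrite /HS.
transitivity (\esum_(i in D) \esum_(j in D') ((ip (Y (f i)) (f' j)) ^+ 2)%:E)%E.
  by apply: eq_esum => i _; rewrite hf'.
rewrite esum_swap; last by move=> i j; rewrite lee_fin sqr_ge0.
by apply: eq_esum => j _; rewrite -hf; apply: eq_esum => i _; rewrite aY ipC.
Qed.

Lemma HS_opnorm I (D : set I) f Y Y' c : frame D f -> adj Y Y' ->
  (HS D f Y <= c%:E)%E -> forall y, nsq (Y' y) <= c * nsq y.
Proof.
move=> hf aY hc y; rewrite -lee_fin -hf mulrC EFinM.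
apply: (@le_trans _ _ ((nsq y)%:E * HS D f Y)%E); last first.
  by apply: lee_wpmul2l => //; rewrite lee_fin nsq_ge0.
rewrite /HS -ge0_esumZl ?nsq_ge0 // => [|i]; last by rewrite lee_fin nsq_ge0.
apply: le_esum => i _; rewrite -EFinM lee_fin.
by rewrite ipC -aY; apply: (le_trans (CS _ _)); rewrite mulrC.
Qed.

(** Taking adjoints moves U to the left as W, where a contraction acts term by term. *)
Lemma HS_compr I (D : set I) f Y Y' U W : frame D f -> adj Y Y' -> adj W U ->
  (forall v, nsq (W v) <= nsq v) -> (HS D f (Y \o U) <= HS D f Y)%E.
Proof.
move=> hf aY aW hW.
rewrite (HS_adj hf hf (adj_comp aY (adjC aW))) (HS_adj hf hf aY).
by apply: HS_le => x; exact: hW.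
Qed.

Lemma esum_tail I (D : set I) (g : I -> \bar R) e : (forall i, D i -> 0 <= g i)%E ->
  (\esum_(i in D) g i < +oo)%E -> 0 < e ->
  exists2 F, finite_set F /\ F `<=` D & (\esum_(i in D `&` ~` F) g i <= e%:E)%E.
Proof.
move=> g0 goo e0; have fin : (\esum_(i in D) g i)%E \is a fin_num.
  by rewrite ge0_fin_numE // esum_ge0.
have [|_ [F [fF FD] <-] h] := ub_ereal_sup_adherent e0 (S := [set \sum_(x \in A) g x | A in fsets D]%E).
  exact: fin.
exists F => //; move: h; rewrite -/(esum D g) (esumID F) //.
have -> : D `&` F = F by apply/setIidr.
rewrite esum_fset //; last (by move=> i Fi; apply: g0; apply: FD; rewrite inE in Fi); move=> h.
set s := (\sum_(x \in F) g x)%E in h *; set r := (\esum_(i in _) _)%E in h *.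
have s0 : (0 <= s)%E by rewrite fsume_ge0 // => i /FD /g0.
have r0 : (0 <= r)%E by apply: esum_ge0 => i [Di _]; exact: g0.
move: fin; rewrite (esumID F) // (_ : D `&` F = F); last by apply/setIidr.
rewrite esum_fset //; last by move=> i Fi; apply: g0; apply: FD; rewrite inE in Fi.
rewrite -/s -/r; move: s r h s0 r0 => [s| |] [r| |] //.
by rewrite -!EFinD !lte_fin !lee_fin => *; lra.
Qed.

(** Contractions tending strongly to 0 tend to 0 in Hilbert-Schmidt norm once composed with a
    Hilbert-Schmidt Y: the tail of the sum is small uniformly in k, and finitely many terms
    remain. *)
Lemma HS_strong0 I (D : set I) f (T : nat -> X -> X) Y : (HS D f Y < +oo)%E ->
  (forall k x, nsq (T k x) <= nsq x) ->
  (forall x e, 0 < e -> exists N, forall k, (N <= k)%N -> nsq (T k x) < e) ->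
  forall e, 0 < e -> exists N, forall k, (N <= k)%N -> (HS D f (T k \o Y) <= e%:E)%E.
Proof.
move=> hY hT T0 e e0.
have n0 k : (0 <= (nsq (Y (f k)))%:E)%E by rewrite lee_fin nsq_ge0.
have [|F [fF FD] hF] := @esum_tail _ D (fun i => (nsq (Y (f i)))%:E) (e / 2) (fun i _ => n0 i) hY.
  lra.
have [N hN] : exists N, forall k, (N <= k)%N ->
    (\esum_(i in F) (nsq (T k (Y (f i))))%:E <= (e / 2)%:E)%E.
  suff sN (s : seq I) b : 0 < b -> exists N, forall k, (N <= k)%N ->
      \sum_(i <- s) nsq (T k (Y (f i))) < b.
    have [|N hN] := sN (finmap.enum_fset (fset_set F)) (e / 2); first lra.
    exists N => k /hN /ltW h; rewrite esum_fset // => [|i _]; last by rewrite lee_fin nsq_ge0.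
    by rewrite fsbig_finite // sumEFin lee_fin.
  elim: s b => [|i s IH] b b0; first by exists 0%N => k _; rewrite big_nil.
  have b2 : 0 < b / 2 by lra.
  have [M hM] := T0 (Y (f i)) _ b2; have [N hN] := IH _ b2.
  exists (maxn N M) => k; rewrite geq_max => /andP[/hN h1 /hM h2].
  by rewrite big_cons; lra.
exists N => k /hN h; rewrite /HS (esumID F) => [|i _]; last by rewrite lee_fin nsq_ge0.
have -> : D `&` F = F by apply/setIidr.
have -> : e = e / 2 + e / 2 by lra.
rewrite EFinD; apply: leeD => //.
by apply: (le_trans _ hF); apply: le_esum => i _; rewrite lee_fin; exact: hT.
Qed.

(** Each new vector adds a projection of rank at most one, orthogonal to the difference accumulated
    so far, and by Parseval its squared norm is at most 1. *)
Lemma span_proj S P I (D : set I) f s : subspace S -> is_proj S P -> frame D f ->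
  exists2 P', is_proj (span S s) P' &
    (HS D f (fun x => (P' x - P x)%R) <= (size s)%:R%:E)%E.
Proof.
move=> sS hP hf; elim: s => [|v s [P1 hP1 h1]].
  by exists P => //; rewrite /HS esum1 // => i _; rewrite subrr nsq0.
have hP' := addv_proj v (span_subspace s sS) hP1; set w := v - P1 v in hP'.
eexists; first exact: hP'.
rewrite -natr1 -[_%:R]mul1r -[X in (_ + X)%:E]mul1r.
apply: (@esum_lin _ _ _ (fun i => nsq (P1 (f i) - P (f i)))
  (fun i => (nsq w)^-1 * ip w (f i) ^+ 2)) => //.
- by move=> i; exact: nsq_ge0.
- by move=> i; rewrite mulr_ge0 ?invr_ge0 ?nsq_ge0 ?sqr_ge0.
- move=> i _; rewrite (addrAC (P1 (f i))) (nsqD (P1 (f i) - P (f i))) nsqZ ipZr.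
  have -> : ip (P1 (f i) - P (f i)) w = 0.
    have [_ ow] := hP1 v; rewrite ipC ow //.
    apply: subspaceB; [exact: span_subspace|exact: (proj_mem hP1)|].
    by apply: span_sub; exact: (proj_mem hP).
  rewrite !mulr0 addr0 !mul1r lerD2l ipC exprMn exprVn.
  have [->|n0] := eqVneq (nsq w) 0; first by rewrite invr0 mulr0 mul0r.
  by rewrite le_eqVlt; apply/orP; left; apply/eqP; field.
- under eq_esum do rewrite EFinM.
  rewrite ge0_esumZl ?invr_ge0 ?nsq_ge0 // => [|i]; last by rewrite lee_fin sqr_ge0.
  rewrite hf -EFinM lee_fin.
  by have [->|n0] := eqVneq (nsq w) 0; rewrite ?mulr0 // mulVf.
Qed.

(** The list consists of the vectors Q h f_i over a finite set of indices carrying all but e of the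
    sum. For x in L orthogonal to them the corresponding coefficients of h x vanish, and
    Cauchy-Schwarz bounds the others by the tail. *)
Lemma HS_small L Q I (D : set I) f h e : is_proj L Q -> frame D f -> adj h h ->
  (HS D f (Q \o h) < +oo)%E -> 0 < e ->
  exists2 s : seq X, (forall v, v \in s -> L v) &
    forall x, L x -> (forall v, v \in s -> ip x v = 0) -> nsq (h x) <= e * nsq x.
Proof.
move=> hQ hf ah hfin e0.
have n0 i : (0 <= (nsq (Q (h (f i))))%:E)%E by rewrite lee_fin nsq_ge0.
have [F [fF FD] hF] := esum_tail (g := fun i => (nsq (Q (h (f i))))%:E) (fun i _ => n0 i) hfin e0.
exists (map (Q \o h \o f) (finmap.enum_fset (fset_set F))).
  by move=> v /mapP[i _ ->]; exact: (proj_mem hQ).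
move=> x Lx hx; rewrite -lee_fin -hf (esumID F) => [|i _]; last by rewrite lee_fin sqr_ge0.
have E i : ip (h x) (f i) = ip x (Q (h (f i))).
  by rewrite ah ipC -(proj_ip hQ) // ipC.
rewrite esum1 ?add0e => [|i [_ Fi]].
  rewrite mulrC EFinM; apply: (@le_trans _ _ ((nsq x)%:E * \esum_(i in D `&` ~` F) (nsq (Q (h (f i))))%:E)%E).
    rewrite -ge0_esumZl ?nsq_ge0 //; apply: le_esum => i _.
    by rewrite -EFinM lee_fin E CS.
  by apply: lee_wpmul2l; rewrite ?lee_fin ?nsq_ge0.
rewrite E hx ?expr0n //; apply/mapP; exists i => //.
by have := in_fset_set fF; move=> /(_ i) ->; rewrite inE.
Qed.

End Frames.

Lemma span_add S s y z : subspace S -> S y -> span [set 0] s z -> span S s (y + z).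
Proof.
move=> sS Sy; elim: s z => /= [z ->|v s IH z [c /IH h]]; first by rewrite addr0.
by exists c; rewrite -addrA.
Qed.

Definition ortho_in L (s : seq X) : set X := [set x | L x /\ forall v, v \in s -> ip x v = 0].

Lemma ortho_in_subspace L s : subspace L -> subspace (ortho_in L s).
Proof.
move=> [L0 Ll]; split; first by split=> // v _; rewrite ip0l.
move=> a x y [Lx hx] [Ly hy]; split; first exact: Ll.
by move=> v vs; rewrite ipDl ipZl hx // hy // mulr0 addr0.
Qed.

Lemma ortho_in_projectable L Q s : subspace L -> is_proj L Q ->
  projectable (ortho_in L s).
Proof.
move=> sL hQ; apply: closed_projectable; first exact: ortho_in_subspace.
move=> x cx; have [y Ly xy] : exists2 y, L y & nsq (x - y) = 0.
  by apply: (proj_closed sL hQ) => e /cx[z [Lz _] ?]; exists z.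
exists y => //; split=> // v vs; rewrite -(ip_eql _ xy) ipC.
by apply: (clos_orth cx) => z [_ hz]; rewrite ipC hz.
Qed.

Lemma ortho_in_span L s : subspace L -> (forall v, v \in s -> L v) ->
  L `<=` span (ortho_in L s) s.
Proof.
move=> sL hs x Lx.
have [P hP] : projectable (span [set 0] s).
  elim: s {hs} => [|v s [P hP]]; first by exists (fun=> 0); exact: proj0.
  eexists; apply: addv_proj hP; apply: span_subspace; exact: subspace0.
have Ls : span [set 0] s `<=` L.
  by apply: span_min => // y ->; case: sL.
have -> : x = (x - P x) + P x by rewrite subrK.
apply: span_add; [exact: ortho_in_subspace| |exact: (proj_mem hP)].
split; first by apply: subspaceB => //; apply: Ls; exact: (proj_mem hP).
by move=> v vs; apply: (proj2 (hP x)); apply: span_mem => //; exact: subspace0.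
Qed.

Definition lin_fun (T : X -> X) := forall a x y, T (a *: x + y) = a *: T x + T y.

Lemma linear_image_subspace (T : X -> X) L : lin_fun T -> subspace L -> subspace (T @` L).
Proof.
move=> lT [L0 Ll]; split.
  by exists 0 => //; have := lT (-1) 0 0; rewrite scaleN1r !addNr scaleN1r addNr.
by move=> a _ _ [x Lx <-] [y Ly <-]; exists (a *: x + y); [exact: Ll|exact: lT].
Qed.

Lemma linear_funB (T : X -> X) x y : lin_fun T -> T (x - y) = T x - T y.
Proof. by move=> lT; rewrite addrC -scaleN1r lT scaleN1r addrC. Qed.

Lemma linear_funZ (T : X -> X) a x : lin_fun T -> T (a *: x) = a *: T x.
Proof.
move=> lT; rewrite -[a *: x]addr0 lT.
by have := lT (-1) 0 0; rewrite scaleN1r !addNr scaleN1r addNr => ->; rewrite addr0.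
Qed.

(** Since e < 1, T is bounded below on L: convergence of images forces the preimages to be Cauchy,
    so the image is closed up to null vectors. *)
Lemma image_projectable L Q (T : X -> X) e : subspace L -> is_proj L Q -> lin_fun T ->
  (forall x, nsq (T x) <= nsq x) -> e < 1 ->
  (forall x, L x -> nsq x - nsq (T x) <= e * nsq x) -> projectable (T @` L).
Proof.
move=> sL hQ lT hT e1 hL; apply: closed_projectable; first exact: linear_image_subspace.
move=> x /clos_seq[u hu ux].
have hu' k : exists v, L v /\ T v = u k by have [v ? ?] := hu k; exists v.
have [v hv] := choice hu'.
have cv : cauchyseq v.
  move=> d d0; have [|N hN] := convergesto_cauchy ux (e := (1 - e) * d).
    by rewrite mulr_gt0 //; lra.
  exists N => i j hi hj; have := hN i j hi hj.
  have [Li <-] := hv i; have [Lj <-] := hv j.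
  rewrite -linear_funB // => h.
  have := hL _ (subspaceB sL Li Lj) => h'.
  by rewrite -(ltr_pM2l (_ : 0 < 1 - e)); lra.
have [y vy] := cauchyseq_cvg cv.
have [z Lz yz] : exists2 z, L z & nsq (y - z) = 0.
  apply: (proj_closed sL hQ) => d /vy[N /(_ N (leqnn _)) ?].
  by exists (v N); rewrite ?(nsqB_sym y)//; have [] := hv N.
exists (T z); first by exists z.
apply/eqP; rewrite eq_le nsq_ge0 andbT; apply/ler_addgt0Pl => d d0; rewrite addr0.
have [|N1 hN1] := ux (d / 4); first lra.
have [|N2 hN2] := vy (d / 4); first lra.
have h1 := hN1 (maxn N1 N2) (leq_maxl _ _).
have h2 := hN2 (maxn N1 N2) (leq_maxr _ _).
have [_ e2] := hv (maxn N1 N2); rewrite -e2 in h1.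
have := nsqB_le3 x (T (v (maxn N1 N2))) (T z).
rewrite -(linear_funB _ _ lT) (nsqB_sym x (T (v (maxn N1 N2)))) => h3.
have := hT (v (maxn N1 N2) - z).
have <- : nsq (v (maxn N1 N2) - y) = nsq (v (maxn N1 N2) - z).
  by apply: nsq_eq; rewrite subBB -nsqN opprB.
lra.
Qed.

(** Write P h = T xi with xi in L and k = xi - Q h. Orthogonality of h - T xi to T k expresses |k|^2
    as <xi, k> - <T xi, T k> minus <Q (h - T h), k>. The first difference is a positive form of size
    at most e on L, and the second term is the given error. *)
Lemma proj_perturb L Q P (T : X -> X) e : subspace L -> is_proj L Q ->
  is_proj (T @` L) P -> lin_fun T -> adj T T ->
  (forall x, nsq (T x) <= nsq x) ->
  (forall x, nsq (x - T x) <= nsq x - nsq (T x)) -> 0 <= e <= 1 / 8 ->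
  (forall x, L x -> nsq x - nsq (T x) <= e * nsq x) ->
  forall h, nsq (P h - Q h) <= 24 * e * nsq (Q h) + 10 * nsq (Q (h - T h)).
Proof.
move=> sL hQ hP lT aT hT h1T /andP[e0 e1] hL h.
have [xi Lxi hxi] := proj_mem hP h.
have Lk : L (xi - Q h) by apply: subspaceB => //; exact: (proj_mem hQ).
set k := xi - Q h in Lk *; set b := Q (h - T h); set a := Q h.
have o : ip (h - T xi) (T k) = 0.
  by rewrite hxi; apply: (proj2 (hP h)); exists k.
have hk : nsq k = (ip xi k - ip (T xi) (T k)) - ip b k.
  rewrite /b (proj_ip hQ) // ipBl (aT h) {1}/k /nsq ipBl (proj_ip hQ) //.
  by move: o; rewrite ipBl; lra.
have kE : k + a = xi by rewrite /k subrK.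
have kE' : xi - a = k by [].
clearbody k.
(* The form |x|^2 - |T x|^2 is nonnegative at xi - k / 2. *)
have s1 : ip xi k - ip (T xi) (T k) <= (nsq xi - nsq (T xi)) + (nsq k - nsq (T k)) / 4.
  have := hT (xi - (1/2) *: k); rewrite linear_funB //.
  have -> : T ((1/2) *: k) = (1/2) *: T k.
    exact: linear_funZ.
  by rewrite !nsqB !nsqZ !ipZr; lra.
have s2 : - ip b k <= nsq b + nsq k / 4.
  by have := AMGMN b k (ltr0Sn _ 1); lra.
have s3 := hL _ Lxi; have s4 := hL _ Lk.
have s5 : nsq xi <= 2 * nsq k + 2 * nsq a.
  by have := nsqD_le k a; rewrite kE.
have s6 : nsq (P h - a) <= 2 * nsq (T xi - xi) + 2 * nsq k.
  by rewrite -hxi -kE'; exact: nsqB_le3.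
have s7 := h1T xi; rewrite nsqB_sym in s7.
have n1 := nsq_ge0 xi; have n2 := nsq_ge0 k; have n3 := nsq_ge0 a; have n4 := nsq_ge0 b.
have n5 := nsq_ge0 (T k).
have s8 : e * nsq k <= nsq k / 8 by nra.
have s9 : e * nsq xi <= nsq xi / 8 by nra.
have k1 : nsq k <= 2 * (e * nsq xi) + 2 * nsq b by lra.
have x1 : nsq xi <= 8 * nsq b + 4 * nsq a by lra.
have x2 : e * nsq xi <= e * (8 * nsq b + 4 * nsq a) by apply: ler_wpM2l.
have x3 : e * nsq b <= nsq b / 8 by nra.
(* With a = Q h and b = Q (h - T h): the distance is at most 6 e |xi|^2 + 4 |b|^2, and e |xi|^2 is
   at most 4 e |a|^2 + 8 e |b|^2. This gives 24 = 6 * 4 and, as e <= 1/8, 10 = 48 / 8 + 4. *)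
lra.
Qed.

(** * Uniform growth of increasing seminorms on a finite-dimensional space *)

Section Growth.
Variables (T : nat -> X -> X).
Hypotheses (aT : forall k, adj (T k) (T k))
  (mT : forall k l x, (k <= l)%N -> nsq (T k x) <= nsq (T l x))
  (bT : forall k, exists c, forall x, nsq (T k x) <= c * nsq x).

Let span0_sub s : subspace (span [set 0] s).
Proof. exact: (span_subspace _ subspace0). Qed.

Let span0_proj s : projectable (span [set 0] s).
Proof.
elim: s => [|v s [P hP]]; first by exists (fun=> 0); exact: proj0.
by eexists; apply: addv_proj hP; exact: span0_sub.
Qed.

(* Induction on s: unless the seminorms of v - y are unbounded uniformly in y in
   the previous span, near-minimizers y_k form a Cauchy sequence, and v minus its
   limit has bounded seminorms, so that v adds nothing to the span. *)
Lemma seminorm_growth s :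
  (forall x, span [set 0] s x -> (exists D, forall k, nsq (T k x) <= D) -> nsq x = 0) ->
  forall M, exists k, forall x, span [set 0] s x -> M * nsq x <= nsq (T k x).
Proof.
elim: s => [|v s IH] hs M.
  by exists 0%N => x /= ->; rewrite nsq0 mulr0; exact: nsq_ge0.
have {}IH : forall M, exists k, forall x, span [set 0] s x -> M * nsq x <= nsq (T k x).
  by apply: IH => x sx; apply: hs; exact: addv_sub.
have sV := span0_sub s; have [P hP] := span0_proj s.
set V := span [set 0] s in IH sV hP *.
have lT k x y : nsq (T k (x + y)) = nsq (T k x + T k y).
  exact: nsq_eq (adj_linD _ _ (aT k)).
have lTB k x y : nsq (T k (x - y)) = nsq (T k x - T k y).
  exact: nsq_eq (adj_linB _ _ (aT k)).
have lTZ k a x : nsq (T k (a *: x)) = a ^+ 2 * nsq (T k x).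
  by rewrite (nsq_eq (adj_linZ _ _ (aT k))) nsqZ.
have [caseA|/existsNP[D hD]] :=
    pselect (forall D, exists k, forall y, V y -> D <= nsq (T k (v - y))).
  pose M1 := `|M|; have M10 : 0 <= M1 by exact: normr_ge0.
  have MM1 : M <= M1 by exact: ler_norm.
  clearbody M1.
  (* Half of [nsq (T k x)] pays for x - c v, through k1; the other half, through k2, pays for c v
     and for the error made when passing from x - c v to x under T_k1. *)
  have [k1 hk1] := IH (8 * M1).
  have [k2 hk2] := caseA (2 * (2 * M1 * nsq v + 1 / 2 * nsq (T k1 v))).
  exists (maxn k1 k2) => x [c hc].
  have m1 := mT x (leq_maxl k1 k2); have m2 := mT x (leq_maxr k1 k2).
  apply: (@le_trans _ _ (M1 * nsq x)); first by rewrite ler_wpM2r ?nsq_ge0.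
  have e1 := hk1 _ hc.
  have e2 : nsq (T k1 (x - c *: v)) <= 2 * nsq (T k1 x) + 2 * (c ^+ 2 * nsq (T k1 v)).
    by rewrite lTB -lTZ; exact: nsqB_le.
  have e3 : nsq x <= 2 * nsq (x - c *: v) + 2 * (c ^+ 2 * nsq v).
    by rewrite -nsqZ -{1}(subrK (c *: v) x); exact: nsqD_le.
  have e4 : c ^+ 2 * (2 * (2 * M1 * nsq v + 1 / 2 * nsq (T k1 v))) <= nsq (T k2 x).
    have [->|c0] := eqVneq c 0; first by rewrite expr0n mul0r nsq_ge0.
    have -> : x = c *: (v - (- c^-1) *: (x - c *: v)).
      by rewrite scaleNr opprK scalerDr scalerA divff // scale1r addrC subrK.
    rewrite lTZ ler_wpM2l ?sqr_ge0 //; apply: hk2; exact: subspaceZ.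
  have e5 : M1 * nsq x <= M1 * (2 * nsq (x - c *: v) + 2 * (c ^+ 2 * nsq v)).
    exact: ler_wpM2l.
  lra.
have {}hD k : exists y, V y /\ nsq (T k (v - y)) < D.
  move/forallNP: hD => /(_ k) /existsNP[y /not_implyP[Vy /negP]].
  by rewrite -ltNge => h; exists y.
have [u hu] := choice hD.
have hu' k l : (k <= l)%N -> nsq (T k (v - u l)) < D.
  by move=> kl; apply: le_lt_trans (mT _ kl) _; case: (hu l).
have D0 : 0 < D by apply: le_lt_trans (proj2 (hu 0%N)); exact: nsq_ge0.
(* The induction hypothesis makes T_k expansive on V by a large factor, whereas T_k (u i - u j)
   stays bounded once i and j exceed k. *)
have cu : cauchyseq u.
  move=> e e0; have [k hk] := IH (4 * D / e); exists k => i j ki kj.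
  have := hk _ (subspaceB sV (proj1 (hu i)) (proj1 (hu j))).
  have -> : u i - u j = (v - u j) - (v - u i) by rewrite subBB.
  rewrite lTB => h.
  have := nsqB_le (T k (v - u j)) (T k (v - u i)).
  have := hu' _ _ ki; have := hu' _ _ kj => h1 h2 h3.
  have : 4 * D / e * nsq (v - u j - (v - u i)) < 4 * D by lra.
  by rewrite mulrAC ltr_pdivrMr // ltr_pM2l //; lra.
have [y0 uy0] := cauchyseq_cvg cu.
have [y Vy yy0] : exists2 y, V y & nsq (y0 - y) = 0.
  apply: (proj_closed sV hP) => d /uy0[N /(_ N (leqnn _)) ?].
  by exists (u N); rewrite ?(nsqB_sym y0)//; case: (hu N).
have vy0 : nsq (v - y) = 0.
  apply: hs; first by exists 1; rewrite scale1r addrAC subrr sub0r -scaleN1r; exact: subspaceZ.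
  (* For l >= k large, v - u l has k-th seminorm below D by monotonicity, and u l - y has k-th
     seminorm at most 1 by continuity of T_k. *)
  exists (2 * D + 2) => k; have [c hc] := bT k.
  have c1 : 0 < `|c| + 1 by have := normr_ge0 c; lra.
  have [|N hN] := uy0 (1 / (`|c| + 1)); first by rewrite divr_gt0.
  pose l := maxn k N.
  have -> : v - y = (v - u l) + (u l - y) by rewrite addrA subrK.
  rewrite lT; apply: (le_trans (nsqD_le _ _)).
  have h1 := hu' k l (leq_maxl _ _).
  have : nsq (T k (u l - y)) <= 1.
    apply: (le_trans (hc _)).
    have <- : nsq (u l - y0) = nsq (u l - y).
      by apply: nsq_eq; rewrite subBB -nsqN opprB.
    have := hN l (leq_maxr _ _); rewrite ltr_pdivlMr // => h2.
    have := ler_norm c; have := nsq_ge0 (u l - y0); nra.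
  lra.
have [k hk] := IH M; exists k => x [c hc].
have Vz : V (c *: y + (x - c *: v)) by apply: sV.2.
have xz : nsq (x - (c *: y + (x - c *: v))) = 0.
  have -> : x - (c *: y + (x - c *: v)) = c *: (v - y).
    by rewrite opprD addrCA opprB [x + _]addrC subrK addrC scalerBr.
  by rewrite nsqZ vy0 mulr0.
rewrite (nsq_eq xz) (nsq_eq (adj_null (aT k) xz)); exact: hk.
Qed.

End Growth.

(** The range of P' - P consists of the vectors v - P v with v in the span of s. There |v|^2 is at
    most |v - P v|^2 / (1 - kappa), so chi shrinks squared norms by e / (1 - kappa), while P' - P
    has squared Hilbert-Schmidt norm at most the length of s. Adjoints bring chi to the left. *)
Lemma rank_part S P P' (I : choiceType) (D : set I) (f : I -> X) s (chi : X -> X) (kappa e : R) :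
  subspace S -> is_proj S P -> is_proj (span S s) P' -> frame D f ->
  adj chi chi -> kappa < 1 ->
  (forall v, span [set 0] s v -> nsq (P v) <= kappa * nsq v) -> 0 <= e ->
  (forall v, span [set 0] s v -> nsq (chi (v - P v)) <= e * nsq v) ->
  (HS D f (fun x => (P' (chi x) - P (chi x))%R) <= (e / (1 - kappa) * (size s)%:R)%:E)%E.
Proof.
move=> sS hP hP' hf achi k1 hk e0 he.
have sS' := span_subspace s sS.
have k10 : 0 < 1 - kappa by lra.
have aR : adj (fun x => P' x - P x) (fun x => P' x - P x).
  by apply: adjB; [exact: (proj_adj hP')|exact: (proj_adj hP)].
rewrite (HS_adj hf hf (adj_comp aR achi)).
have [P1 hP1 h1] := span_proj s sS hP hf.
have h1' : (HS D f (fun x => (P' x - P x)%R) <= (size s)%:R%:E)%E.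
  apply: (le_trans _ h1); apply: HS_le => x.
  rewrite (@nsq_eq _ (P1 x - P x)) // opprB addrA subrK.
  apply: (proj_uniq sS' hP'); first exact: (proj_mem hP1).
  exact: (proj2 (hP1 x)).
rewrite -[_ * _]addr0 -[X in (_ + X)%:E](mul0r 0).
apply: (HS_lin (W := fun=> 0) _ _ _ h1') => //.
- by rewrite divr_ge0 // ltW.
- move=> x; rewrite mul0r addr0 /=.
  have [y [v [Sy sv e1]]] := span_split sS (proj_mem hP' x).
  (* Both vectors are orthogonal to S, and their difference belongs to S. *)
  have e2 : nsq ((P' x - P x) - (v - P v)) = 0.
    have m : S (P' x - P x - (v - P v)).
      rewrite e1; have -> : y + v - P x - (v - P v) = y - P x + P v.
        by rewrite (addrAC y) -(addrA (y - P x)); congr (_ + _); rewrite opprB addrCA subrr addr0.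
      apply: subspaceD => //; last exact: (proj_mem hP).
      by apply: subspaceB => //; exact: (proj_mem hP).
    rewrite /nsq ipBl.
    have o1 : ip (v - P v) (P' x - P x - (v - P v)) = 0 by exact: (proj2 (hP v)).
    have o2 := proj2 (hP x) _ m; have o3 := proj2 (hP' x) _ (span_sub s m).
    by rewrite o1 subr0 ipBl; move: o2 o3; rewrite !(ipBl x); lra.
  rewrite (nsq_eq (adj_null achi e2)) (nsq_eq e2).
  apply: (le_trans (he _ sv)); rewrite -mulrA ler_wpM2l //.
  rewrite -(ler_pM2l k10) mulrA divff ?gt_eqF // mul1r (nsqB_proj hP).
  by have := hk _ sv; lra.
- by rewrite /HS esum1 // => i _; rewrite nsq0.
Qed.

(* The trace-norm estimate |tr |J|| <= |X1|_2 |Y1|_2 + |X2|_2 |Y2|_2 for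
   J = Y1^* X1 + Y2^* X2, in arithmetic-mean form. *)
Lemma trace_estimate (I : choiceType) (D : set I) (f : I -> X) (A J X1 Y1 X2 Y2 Y1' Y2' : X -> X)
    (J' : X -> X) (t c1 c2 d1 d2 : R) :
  frame D f -> adj A A -> adj J J' -> adj Y1 Y1' -> adj Y2 Y2' ->
  (forall x, nsq (A x) = nsq (J x)) ->
  (forall x y, ip (J x) y = ip (X1 x) (Y1 y) + ip (X2 x) (Y2 y)) ->
  0 < t ->
  (HS D f X1 <= c1%:E)%E -> (HS D f Y1 <= d1%:E)%E ->
  (HS D f X2 <= c2%:E)%E -> (HS D f Y2 <= d2%:E)%E ->
  (\esum_(i in D) (ip (A (f i)) (f i))%:E <=
     (t^-1 * c1 + t * d1 + (t * c2 + t^-1 * d2))%:E)%E.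
Proof.
move=> hf aA aJ aY1 aY2 e hJ t0 h1 h1' h2 h2'.
(* <A f, f> = <J f, U f> removes the absolute value, and composing with U does not increase
   Hilbert-Schmidt norms. *)
have [U [W [hU aW hW]]] := polar aA aJ e.
have {}h1' : (HS D f (Y1 \o U) <= d1%:E)%E := le_trans (HS_compr hf aY1 aW hW) h1'.
have {}h2' : (HS D f (Y2 \o U) <= d2%:E)%E := le_trans (HS_compr hf aY2 aW hW) h2'.
have ti : 0 < t^-1 by rewrite invr_gt0.
have am (Z Z' : X -> X) (p : R) i : 0 < p ->
    ip (Z (f i)) (Z' (f i)) <= p * nsq (Z (f i)) + p^-1 * nsq (Z' (f i)).
  move=> p0; have := AMGM (Z (f i)) (Z' (f i)) p0; have pi : 0 < p^-1 by rewrite invr_gt0.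
  have : 0 <= p * nsq (Z (f i)) by apply: mulr_ge0; [exact: ltW|exact: nsq_ge0].
  have : 0 <= p^-1 * nsq (Z' (f i)) by apply: mulr_ge0; [exact: ltW|exact: nsq_ge0].
  lra.
have l0 (Z : X -> X) i : 0 <= nsq (Z (f i)) by exact: nsq_ge0.
rewrite -[t^-1 * c1 + _]mul1r -[t * c2 + _]mul1r.
apply: (@esum_lin _ _ _
  (fun i => t^-1 * nsq (X1 (f i)) + t * nsq (Y1 (U (f i))))
  (fun i => t * nsq (X2 (f i)) + t^-1 * nsq (Y2 (U (f i))))) => //.
- by move=> i; apply: addr_ge0; apply: mulr_ge0 => //; solve [exact: ltW|exact: nsq_ge0].
- by move=> i; apply: addr_ge0; apply: mulr_ge0 => //; solve [exact: ltW|exact: nsq_ge0].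
- move=> i _; rewrite hU hJ !mul1r.
  have := am X1 (Y1 \o U) _ i ti; have := am X2 (Y2 \o U) _ i t0.
  by rewrite invrK /=; lra.
- by apply: esum_lin h1 h1' ; solve [exact: ltW|move=> i; exact: nsq_ge0|by []].
- by apply: esum_lin h2 h2' ; solve [exact: ltW|move=> i; exact: nsq_ge0|by []].
Qed.

End SemiHilbertTheory.

(** * Parseval's identity for total orthonormal families *)

Section OrthonormalFamilies.
Context {R : realType} {X : semiHilbertType R} {I : choiceType}.
Variables (D : set I) (f : I -> X).
Hypotheses (of_ : forall i j, D i -> D j -> ip (f i) (f j) = (i == j)%:R)
  (tf : forall x, (forall i, D i -> ip x (f i) = 0) -> nsq x = 0).

Let proj_seq (s : seq I) (x : X) : X := \sum_(i <- s) ip x (f i) *: f i.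

Lemma ip_suml (s : seq I) (c : I -> R) (x : X) :
  ip (\sum_(i <- s) c i *: f i) x = \sum_(i <- s) c i * ip (f i) x.
Proof.
elim: s => [|i s IH]; first by rewrite !big_nil ip0l.
by rewrite !big_cons ip_linear IH.
Qed.

Lemma proj_seq_ip s x j : (forall i, i \in s -> D i) -> uniq s -> j \in s ->
  ip (proj_seq s x) (f j) = ip x (f j).
Proof.
move=> sD us js; rewrite ip_suml (bigD1_seq j) //= (of_ (sD _ js) (sD _ js)) eqxx mulr1.
rewrite big_seq_cond big1 ?addr0 // => i /andP[si ij].
by rewrite (of_ (sD _ si) (sD _ js)) (negbTE ij) mulr0.
Qed.

Lemma nsq_proj_seq s x : (forall i, i \in s -> D i) -> uniq s ->
  nsq (x - proj_seq s x) = nsq x - \sum_(i <- s) ip x (f i) ^+ 2.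
Proof.
move=> sD us; rewrite nsqB.
have -> : ip x (proj_seq s x) = \sum_(i <- s) ip x (f i) ^+ 2.
  by rewrite ipC ip_suml; apply: eq_bigr => i _; rewrite ipC expr2.
have -> : nsq (proj_seq s x) = \sum_(i <- s) ip x (f i) ^+ 2.
  rewrite /nsq {1}/proj_seq ip_suml; apply: eq_big_seq => i si.
  by rewrite (ipC (f i)) proj_seq_ip // expr2.
lra.
Qed.

(** One inequality is Bessel's. For the other, x has null distance to the closure of the finite
    spans by totality, and the partial sum over a finite family is the best approximation in its
    span. *)
Lemma orthonormal_frame : frame D f.
Proof.
move=> x; apply/eqP; rewrite eq_le; apply/andP; split.
  apply: ge_ereal_sup => _ [F [fF FD] <-].
  rewrite fsbig_finite // sumEFin lee_fin -subr_ge0.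
  rewrite -nsq_proj_seq ?nsq_ge0 // => i.
  by rewrite in_fset_set // inE => /FD.
apply/lee_addgt0Pr => e e0.
pose S0 := [set y | exists s : seq I, (forall i, i \in s -> D i) /\ span [set (0 : X)] (map f s) y].
have s0 := @subspace0 R X.
have sS0 : subspace S0.
  split; first by exists [::].
  move=> a y z [s [sD sy]] [t [tD tz]]; exists (s ++ t); split.
    by move=> i; rewrite mem_cat => /orP[/sD|/tD].
  have sub r y' : {subset r <= s ++ t} -> span [set 0] (map f r) y' ->
      span [set 0] (map f (s ++ t)) y'.
    move=> rs; apply: span_min; first exact: span_subspace.
      exact: span_sub.
    by move=> v /mapP[i /rs ir ->]; apply: span_mem => //; exact: map_f.
  apply: (span_subspace _ s0).2; [apply: sub sy|apply: sub tz] => i.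
    by rewrite mem_cat => ->.
  by rewrite mem_cat orbC => ->.
have [p cp hp] := closure_proj sS0 x.
have xp : nsq (x - p) = 0.
  apply: tf => i Di; apply: hp; exists [:: i]; split; first by move=> j; rewrite inE => /eqP ->.
  by exists 1; rewrite scale1r subrr.
have [z [s [sD sz]] hz] := cp e e0.
have {}hz : nsq (x - z) < e.
  have -> : nsq (x - z) = nsq (p - z) by apply: nsq_eq; rewrite opprB addrA subrK.
  by [].
(* A repeated index would be counted twice in the partial sum. *)
pose t := undup s.
have tD i : i \in t -> D i by rewrite mem_undup; exact: sD.
have ut : uniq t by exact: undup_uniq.
have orth w : span [set 0] (map f s) w -> ip (x - proj_seq t x) w = 0.
  apply: (@span_min _ _ _ [set w | ip (x - proj_seq t x) w = 0]).
  - split=> [|a y y' /= h1 h2]; first exact: ip0r.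
    by rewrite ipDr ipZr h1 h2 mulr0 addr0.
  - by move=> _ ->; exact: ip0r.
  - move=> v /mapP[i si ->] /=; rewrite ipBl proj_seq_ip ?subrr //.
    by rewrite mem_undup.
have pm : span [set 0] (map f s) (proj_seq t x).
  rewrite /proj_seq; have : forall i, i \in t -> i \in s by move=> i; rewrite mem_undup.
  elim: (t) => [|i r IH] rs; first by rewrite big_nil; apply: span_sub.
  rewrite big_cons; apply: (span_subspace _ s0).2.
    by apply: span_mem => //; apply: map_f; apply: rs; rewrite inE eqxx.
  by apply: IH => j jr; apply: rs; rewrite inE jr orbT.
have le : nsq (x - proj_seq t x) <= nsq (x - z).
  have -> : x - z = (x - proj_seq t x) + (proj_seq t x - z) by rewrite addrA subrK.
  rewrite (nsqD (x - proj_seq t x)) orth.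
    by have := nsq_ge0 (proj_seq t x - z); lra.
  exact: (subspaceB (span_subspace _ s0)).
apply: (@le_trans _ _ (\sum_(i <- t) ip x (f i) ^+ 2 + e)%:E).
  by rewrite lee_fin; move: le; rewrite nsq_proj_seq //; lra.
rewrite EFinD leeD2r // -sumEFin; apply: ereal_sup_ubound; exists [set` t].
  by split=> // i /= /tD.
by rewrite -fsbig_seq.
Qed.

End OrthonormalFamilies.

(** * L_2 as a real semi-Hilbert space *)

Section ComplexPointwise.
Context {R : realType}.
Implicit Types z w : R[i].

Definition rdot z w : R :=
  complex.Re z * complex.Re w + complex.Im z * complex.Im w.

Lemma rdotC z w : rdot z w = rdot w z.
Proof. by rewrite /rdot mulrC; congr (_ + _); rewrite mulrC. Qed.

Lemma sqmodE z : sqmod z = rdot z z.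
Proof. by rewrite /rdot -!expr2. Qed.

Lemma sqmod_ge0 z : 0 <= sqmod z.
Proof. by rewrite addr_ge0 ?sqr_ge0. Qed.

Lemma ReM z w : complex.Re (z * w) = complex.Re z * complex.Re w - complex.Im z * complex.Im w.
Proof. by case: z w => [a b] [c d]. Qed.

Lemma ImM z w : complex.Im (z * w) = complex.Re z * complex.Im w + complex.Im z * complex.Re w.
Proof. by case: z w => [a b] [c d]. Qed.

Lemma ReD z w : complex.Re (z + w) = complex.Re z + complex.Re w.
Proof. by case: z w => [a b] [c d]. Qed.

Lemma ImD z w : complex.Im (z + w) = complex.Im z + complex.Im w.
Proof. by case: z w => [a b] [c d]. Qed.

Lemma ReB z w : complex.Re (z - w) = complex.Re z - complex.Re w.
Proof. by case: z w => [a b] [c d]. Qed.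

Lemma ImB z w : complex.Im (z - w) = complex.Im z - complex.Im w.
Proof. by case: z w => [a b] [c d]. Qed.

Lemma rdot_le z w : `|rdot z w| <= sqmod z + sqmod w.
Proof.
case: z w => [a b] [c d]; rewrite /rdot /sqmod /= ler_norml; apply/andP.
have := sqr_ge0 (a + c); have := sqr_ge0 (a - c).
have := sqr_ge0 (b + d); have := sqr_ge0 (b - d).
have := sqr_ge0 a; have := sqr_ge0 b; have := sqr_ge0 c; have := sqr_ge0 d.
by split; nra.
Qed.

Lemma sqmodM z w : sqmod (z * w) = sqmod z * sqmod w.
Proof. by case: z w => [a b] [c d]; rewrite /sqmod /=; ring. Qed.

Lemma sqmod_real (r : R) : sqmod r%:C%C = r ^+ 2.
Proof. by rewrite /sqmod /= expr0n addr0. Qed.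

Lemma sqmodD_le z w : sqmod (z + w) <= 2 * sqmod z + 2 * sqmod w.
Proof.
case: z w => [a b] [c d]; rewrite /sqmod /=.
by have := sqr_ge0 (a - c); have := sqr_ge0 (b - d); nra.
Qed.

Lemma sqmod_eq0 z : sqmod z = 0 -> z = 0.
Proof.
case: z => [a b]; rewrite /sqmod /= => /eqP.
by rewrite paddr_eq0 ?sqr_ge0// !sqrf_eq0 => /andP[/eqP-> /eqP->].
Qed.

Lemma Re_mul_conj z w : complex.Re (z * (w^*)%C) = rdot z w.
Proof. by case: z w => [a b] [c d]; rewrite /rdot /= mulrN opprK. Qed.

Lemma Im_mul_conj z w : complex.Im (z * (w^*)%C) = rdot z ('i%C * w).
Proof. by case: z w => [a b] [c d]; rewrite /rdot /=; ring. Qed.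

End ComplexPointwise.

Section L2Functions.
Context {d : measure_display} {T : measurableType d} {R : realType}.
Variable mu : {measure set T -> \bar R}.
Local Notation fn := (T -> R[i]).
Implicit Types f g h : fn.

Lemma cmeasurable_lin (a : R[i]) f g : cmeasurable f -> cmeasurable g ->
  cmeasurable (fun x => a * f x + g x).
Proof.
move=> [rf imf] [rg img]; split.
- rewrite [X in measurable_fun _ X](_ : _ = (fun x => (complex.Re a * complex.Re (f x)
    - complex.Im a * complex.Im (f x)) + complex.Re (g x))); last first.
    by apply/funext => x; rewrite ReD ReM.
  apply: measurable_funD => //; apply: measurable_funB; exact: measurable_funM.
- rewrite [X in measurable_fun _ X](_ : _ = (fun x => (complex.Re a * complex.Im (f x)
    + complex.Im a * complex.Re (f x)) + complex.Im (g x))); last first.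
    by apply/funext => x; rewrite ImD ImM.
  apply: measurable_funD => //; apply: measurable_funD; exact: measurable_funM.
Qed.

Lemma cmeasurable_mul (h : T -> R) f : measurable_fun setT h -> cmeasurable f ->
  cmeasurable (mulop h f).
Proof.
move=> mh [rf imf]; split.
- rewrite [X in measurable_fun _ X](_ : _ = (fun x => h x * complex.Re (f x))).
    exact: measurable_funM.
  by apply/funext => x; rewrite /mulop ReM /= mul0r subr0.
- rewrite [X in measurable_fun _ X](_ : _ = (fun x => h x * complex.Im (f x))).
    exact: measurable_funM.
  by apply/funext => x; rewrite /mulop ImM /= mul0r addr0.
Qed.

Lemma measurable_sqmod f : cmeasurable f -> measurable_fun setT (fun x => sqmod (f x)).
Proof. by move=> [rf imf]; apply: measurable_funD; exact: measurable_funX. Qed.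

Lemma measurable_rdot f g : cmeasurable f -> cmeasurable g ->
  measurable_fun setT (fun x => rdot (f x) (g x)).
Proof. by move=> [rf imf] [rg img]; apply: measurable_funD; exact: measurable_funM. Qed.

Lemma L2_integrable f : L2 mu f -> mu.-integrable setT (EFin \o (fun x => sqmod (f x))).
Proof.
move=> [mf fin]; apply/integrableP; split.
  by apply/measurable_EFinP; exact: measurable_sqmod.
by under eq_integral do rewrite gee0_abs ?lee_fin ?sqmod_ge0//=.
Qed.

Lemma L2_dom f (h : T -> R) : cmeasurable f ->
  mu.-integrable setT (EFin \o h) -> (forall x, sqmod (f x) <= h x) -> L2 mu f.
Proof.
move=> mf hint le; split=> //.
have : mu.-integrable setT (EFin \o (fun x => sqmod (f x))).
  apply: (le_integrable measurableT _ _ hint).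
    by apply/measurable_EFinP; exact: measurable_sqmod.
  move=> x _ /=; rewrite lee_fin ger0_norm ?sqmod_ge0 //.
  exact: le_trans (le x) (ler_norm _).
exact: integrable_lty.
Qed.

Lemma L2_lin (a : R[i]) f g : L2 mu f -> L2 mu g -> L2 mu (fun x => a * f x + g x).
Proof.
move=> Lf Lg.
apply: (@L2_dom _ (fun x => (2 * sqmod a) * sqmod (f x) + 2 * sqmod (g x))).
- by apply: cmeasurable_lin; [case: Lf|case: Lg].
- have := integrableD measurableT (integrableZl measurableT (2 * sqmod a) (L2_integrable Lf))
    (integrableZl measurableT 2 (L2_integrable Lg)).
  by apply: eq_integrable => // x _; rewrite /= EFinD !EFinM.
- by move=> x; apply: (le_trans (sqmodD_le _ _)); rewrite sqmodM mulrA.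
Qed.

Lemma L2_0 : L2 mu (fun=> 0).
Proof.
split; first by split; exact: measurable_cst.
by rewrite integral0_eq // => x _; rewrite /sqmod /= !expr0n addr0.
Qed.

Lemma L2_mul (h : T -> R) c f : measurable_fun setT h -> (forall x, (h x) ^+ 2 <= c) ->
  L2 mu f -> L2 mu (mulop h f).
Proof.
move=> mh hc Lf; apply: (@L2_dom _ (fun x => c * sqmod (f x))).
- by apply: cmeasurable_mul => //; case: Lf.
- exact: (integrableZl measurableT c (L2_integrable Lf)).
- by move=> x; rewrite /mulop sqmodM sqmod_real ler_wpM2r ?sqmod_ge0.
Qed.

Lemma rdot_integrable f g : L2 mu f -> L2 mu g ->
  mu.-integrable setT (EFin \o (fun x => rdot (f x) (g x))).
Proof.
move=> Lf Lg.
apply: (le_integrable measurableT _ _ (integrableD measurableT (L2_integrable Lf) (L2_integrable Lg))).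
  by apply/measurable_EFinP; apply: measurable_rdot; [case: Lf|case: Lg].
move=> x _ /=; rewrite lee_fin; apply: (le_trans (rdot_le _ _)).
exact: ler_norm.
Qed.

Definition N2 f : R := \int[mu]_(x in setT) sqmod (f x).

Lemma N2_ge0 f : 0 <= N2 f.
Proof. by apply: Rintegral_ge0 => x _; exact: sqmod_ge0. Qed.

Lemma N2E f : L2 mu f -> (N2 f)%:E = (\int[mu]_x (sqmod (f x))%:E)%E.
Proof. by move=> Lf; rewrite fineK //; exact: integrable_fin_num (L2_integrable Lf). Qed.

Lemma L2B f g : L2 mu f -> L2 mu g -> L2 mu (fun x => f x - g x).
Proof.
move=> Lf Lg; have := L2_lin (-1) Lg Lf; congr L2; apply/funext => x.
by rewrite mulN1r addrC.
Qed.

Lemma N2B_sym f g : N2 (fun x => f x - g x) = N2 (fun x => g x - f x).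
Proof. by apply: eq_Rintegral => x _; rewrite -opprB /sqmod; case: (g x - f x) => a b /=; ring. Qed.

Lemma N2_tri f g h : L2 mu f -> L2 mu g -> L2 mu h ->
  N2 (fun x => f x - h x) <= 2 * N2 (fun x => f x - g x) + 2 * N2 (fun x => g x - h x).
Proof.
move=> Lf Lg Lh; have L1 := L2_integrable (L2B Lf Lg); have L2 := L2_integrable (L2B Lg Lh).
rewrite /N2 -!RintegralZl // -RintegralD //; last 2 first.
- by have := integrableZl measurableT 2 L1.
- by have := integrableZl measurableT 2 L2.
apply: le_Rintegral => //; first exact: L2_integrable (L2B Lf Lh).
  exact: (integrableD measurableT (integrableZl measurableT 2 L1) (integrableZl measurableT 2 L2)).
by move=> x _; have := sqmodD_le (f x - g x) (g x - h x); rewrite addrA subrK.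
Qed.

Lemma N2_eq0 f : L2 mu f -> N2 f = 0 -> aeq mu f (fun=> 0).
Proof.
move=> Lf h; have : (\int[mu]_x `|(sqmod (f x))%:E| = 0)%E.
  under eq_integral do rewrite gee0_abs ?lee_fin ?sqmod_ge0//.
  by rewrite -N2E // h.
have mf : measurable_fun setT (EFin \o (fun x => sqmod (f x))).
  by apply/measurable_EFinP; apply: measurable_sqmod; case: Lf.
move/(ae_eq_integral_abs mu measurableT mf); apply: filterS => x /(_ I) /= [] h0.
exact: sqmod_eq0.
Qed.

Lemma N2_aeq f g : L2 mu f -> L2 mu g -> aeq mu f g -> N2 (fun x => f x - g x) = 0.
Proof.
move=> Lf Lg h; have L := L2B Lf Lg; apply: EFin_inj; rewrite N2E //.
have mf : measurable_fun setT (EFin \o (fun x => sqmod (f x - g x))).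
  by apply/measurable_EFinP; apply: measurable_sqmod; case: L.
under eq_integral do rewrite -[(sqmod _)%:E]gee0_abs ?lee_fin ?sqmod_ge0//.
apply/(ae_eq_integral_abs mu measurableT mf).
by apply: filterS h => x e _ /=; rewrite e subrr /sqmod /= !expr0n addr0.
Qed.

Lemma summable_increments_cvg (r a : nat -> R) M : (forall k, 0 <= a k) ->
  (forall k, `|r k.+1 - r k| <= a k + (2 ^- k)) ->
  (forall n, \sum_(0 <= k < n) a k <= M) -> cvgn r.
Proof.
move=> a0 hr hM.
have c : cvgn [normed series (telescope r)].
  apply: nondecreasing_is_cvgn.
    by apply/nondecreasing_seqP => n; rewrite /normed_series_of /series /= big_nat_recr //= lerDl.
  exists (M + 2) => _ [n _ <-]; rewrite /normed_series_of /series /=.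
  have h2 : \sum_(0 <= k < n) (2 ^- k) <= (2 : R).
    suff -> : \sum_(0 <= k < n) (2 ^- k) = 2 - 2 * 2 ^- n :> R.
      by rewrite lerBlDr lerDl mulr_ge0 // invr_ge0 exprn_ge0.
    elim: n => [|n IH]; first by rewrite big_geq // expr0 invr1; lra.
    by rewrite big_nat_recr //= IH exprS invfM; lra.
  apply: (@le_trans _ _ (\sum_(0 <= k < n) (a k + 2 ^- k))).
    by apply: ler_sum => k _; exact: hr.
  by rewrite big_split /= lerD.
have := normed_cvg c; rewrite telescopeK => h.
have -> : r = (fun n => (r n - r 0%N) + r 0%N) by apply/funext => n; rewrite subrK.
by apply: is_cvgD => //; exact: is_cvg_cst.
Qed.

(** Riesz-Fischer: a rapidly Cauchy subsequence converges almost everywhere, and Fatou's lemma turns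
    this into convergence in mean square. *)
Lemma L2_complete (u : nat -> fn) : (forall k, L2 mu (u k)) ->
  (forall e : R, 0 < e -> exists N, forall i j, (N <= i)%N -> (N <= j)%N ->
     N2 (fun x => u i x - u j x) < e) ->
  exists2 F, L2 mu F & forall e : R, 0 < e -> exists N, forall k, (N <= k)%N ->
     N2 (fun x => u k x - F x) < e.
Proof.
move=> Lu cu.
(* The factor 2^k is a weight put on the k-th squared increment; what remains, 2^-(k+1), sums to
   1. *)
have cpos k : 0 < (2 ^+ k * (2 ^ k.+1)%:R)^-1 :> R.
  by rewrite invr_gt0 mulr_gt0 ?exprn_gt0 // ltr0n expn_gt0.
have [n hn] := choice (fun k => cu _ (cpos k)).
(* Summing makes m k at least k and at least every n i with i <= k, without n being monotone. *)
pose m k := (\sum_(i < k.+1) (n i).+1)%N.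
have mn k j : (k <= j)%N -> (n k <= m j)%N.
  move=> kj; have kj' : (k < j.+1)%N by [].
  by rewrite /m (bigD1 (Ordinal kj')) //= addSn ltnW // ltnS leq_addr.
have km k : (k <= m k)%N.
  apply: (@leq_trans (\sum_(i < k.+1) 1)%N); last by apply: leq_sum.
  by rewrite sum1_card card_ord.
pose v k := u (m k).
have Lv k : L2 mu (v k) by exact: Lu.
have cv k j : (k <= j)%N -> N2 (fun x => v j x - v k x) < (2 ^+ k * (2 ^ k.+1)%:R)^-1.
  by move=> kj; apply: hn; exact: mn.
pose w k x := (2 ^+ k * sqmod (v k.+1 x - v k x))%:E.
have w0 k x : (0 <= w k x)%E.
  by rewrite lee_fin mulr_ge0 ?sqmod_ge0 ?exprn_ge0.
have mw k : measurable_fun setT (w k).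
  apply/measurable_EFinP; apply: measurable_funM => //; apply: measurable_sqmod.
  by case: (L2B (Lv k.+1) (Lv k)).
pose G x := (\sum_(k <oo) w k x)%E.
have mG : measurable_fun setT G.
  by apply: (@ge0_emeasurable_sum _ _ _ _ w xpredT).
have iG : (\int[mu]_x G x < +oo)%E.
  rewrite integral_nneseries //.
  apply: (@le_lt_trans _ _ 1%E); last by rewrite ltry.
  have := @epsilon_trick R (fun=> 0%E) 1 xpredT (fun=> lexx _) ler01.
  have -> : (\sum_(0 <= i <oo) 0 = 0 :> \bar R)%E by apply: eseries0.
  rewrite add0e => h; apply: (le_trans _ h).
  apply: lee_nneseries => [k _ _|k _]; first by apply: integral_ge0.
  rewrite add0e /w; under eq_integral do rewrite EFinM.
  rewrite ge0_integralZl //; last 2 first.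
  - apply/measurable_EFinP; apply: measurable_sqmod.
    by case: (L2B (Lv k.+1) (Lv k)).
  - by move=> x _; rewrite lee_fin sqmod_ge0.
  rewrite -(N2E (L2B (Lv k.+1) (Lv k))) -EFinM lee_fin.
  have := cv k k.+1 (leqnSn _); rewrite invfM => /ltW h1.
  rewrite mul1r -(@ler_pM2l _ (2 ^+ k)^-1) ?invr_gt0 ?exprn_gt0 //.
  by rewrite mulrA mulVf ?mul1r // expf_eq0 andbF.
have Gfin : {ae mu, forall x, G x \is a fin_num}.
  have : mu.-integrable setT G.
    apply/integrableP; split => //.
    by under eq_integral do rewrite gee0_abs ?nneseries_ge0//.
  by move/(integrable_ae measurableT); apply: filterS => x; exact.
have pw x : G x \is a fin_num -> cvgn (fun k => complex.Re (v k x)) /\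
    cvgn (fun k => complex.Im (v k x)).
  move=> Gx.
  have hs k : \sum_(0 <= i < k) (2 ^+ i * sqmod (v i.+1 x - v i x)) <= fine (G x).
    rewrite -lee_fin fineK // -sumEFin.
    by apply: (@nneseries_lim_ge _ (fun i => w i x)) => i _ _.
  (* The weight 2^k pays for passing from squares to absolute values: |p| <= 2^k p^2 + 2^-k. *)
  have ab (p q : R) k : `|p| <= 2 ^+ k * (p ^+ 2 + q ^+ 2) + 2 ^- k.
    set t := 2 ^+ k; have t0 : 0 < t by rewrite exprn_gt0.
    have q0 : 0 <= t * q ^+ 2 by rewrite mulr_ge0 ?sqr_ge0 ?ltW.
    rewrite -(real_normK (num_real p)).
    rewrite -(ler_pM2l t0) !mulrDr divff ?gt_eqF //.
    have := sqr_ge0 (t * `|p| - 1); have := normr_ge0 p; have := mulr_ge0 (ltW t0) q0.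
    have := sqr_ge0 (t * `|p|); nra.
  split; apply: (@summable_increments_cvg _ (fun k => 2 ^+ k * sqmod (v k.+1 x - v k x)) (fine (G x))) => // k.
  - by rewrite mulr_ge0 ?sqmod_ge0 ?exprn_ge0.
  - by rewrite -ReB; exact: ab.
  - by rewrite mulr_ge0 ?sqmod_ge0 ?exprn_ge0.
  - by rewrite -ImB /sqmod addrC [_ ^+ 2 + _]addrC addrC; exact: ab.
(* An upper limit is measurable everywhere, also on the null set where the subsequence may
   diverge. *)
pose L (c : R[i] -> R) x := fine (limn_esup (fun k => (c (v k x))%:E)).
have mL (c : R[i] -> R) : (forall k, measurable_fun setT (fun x => c (v k x))) ->
    measurable_fun setT (L c).
  move=> mc; apply: (measurableT_comp (fine_measurable measurableT)).
  by apply: measurable_fun_limn_esup => k; apply/measurable_EFinP.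
pose F x := (L (@complex.Re R) x +i* L (@complex.Im R) x)%C.
have mF : cmeasurable F.
  by split; apply: mL => k; case: (Lv k) => -[].
have limE (c : R[i] -> R) x : cvgn (fun k => c (v k x)) ->
    (fun k => c (v k x)) @ \oo --> L c x.
  move=> h; have h' : (fun k => (c (v k x))%:E) @ \oo --> (limn (fun k => c (v k x)))%:E.
    by apply/fine_cvgP; split; [exact: nearW|exact: h].
  by rewrite /L (cvg_limn_einf_sup h').2.
have key k : (\int[mu]_x (sqmod (v k x - F x))%:E <= (2 ^- k)%:E)%E.
  pose f j x := (sqmod (v k x - v (k + j)%N x))%:E.
  have mf j : measurable_fun setT (f j).
    by apply/measurable_EFinP; apply: measurable_sqmod; case: (L2B (Lv k) (Lv (k + j)%N)).
  have f0 j x : (0 <= f j x)%E by rewrite lee_fin sqmod_ge0.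
  have mvF : cmeasurable (fun x => v k x - F x).
    have := cmeasurable_lin (-1) mF (proj1 (Lv k)); congr cmeasurable.
    by apply/funext => x; rewrite mulN1r addrC.
  have me : measurable_fun setT (fun x => limn_einf (f^~ x)).
    have -> : (fun x => limn_einf (f^~ x)) = (fun x => - limn_esup (fun j => - f j x))%E.
      apply/funext => x; rewrite -(oppeK (limn_einf _)); congr (- _)%E.
      by rewrite -[RHS]/(limn_esup (-%E \o (f^~ x))) limn_esupN.
    apply: measurableT_comp => //; apply: measurable_fun_limn_esup => j.
    exact: measurableT_comp.
  have e0 x : (0 <= limn_einf (f^~ x))%E.
    rewrite limn_einf_lim; apply: lime_ge; first exact: is_cvg_einfs.
    by apply: nearW => j; apply: le_ereal_inf_tmp => _ [i _ <-]; exact: f0.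
  rewrite (@ge0_ae_eq_integral _ _ _ mu setT _ (fun x => limn_einf (f^~ x))) //.
  - apply: (le_trans (fatou mu measurableT mf _)) => //.
    rewrite limn_einf_lim; apply: lime_le; first exact: is_cvg_einfs.
    apply: nearW => j; apply: (@le_trans _ _ (\int[mu]_x f j x)%E).
      by apply: ereal_inf_lbound; exists j => /=.
    rewrite -(N2E (L2B (Lv k) (Lv (k + j)%N))) lee_fin N2B_sym.
    apply: (le_trans (ltW (cv _ _ (leq_addr _ _)))).
    by rewrite invfM ler_piMr ?invr_ge0 ?exprn_ge0 // invf_le1 ?ltr0n ?expn_gt0 // ler1n expn_gt0.
  - by apply/measurable_EFinP; exact: measurable_sqmod.
  - by move=> x _; rewrite lee_fin sqmod_ge0.
  - apply: filterS Gfin => x /pw[/limE hr /limE hi] _.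
    apply/esym; have [-> //] : (limn_einf (f^~ x) = (sqmod (v k x - F x))%:E) *
        (limn_esup (f^~ x) = (sqmod (v k x - F x))%:E).
    apply: cvg_limn_einf_sup; apply/fine_cvgP; split; first exact: nearW.
    rewrite /sqmod ReB ImB.
    rewrite (_ : fine \o _ = (fun j => (complex.Re (v k x) - complex.Re (v (k + j)%N x)) ^+ 2
      + (complex.Im (v k x) - complex.Im (v (k + j)%N x)) ^+ 2)); last first.
      by apply/funext => j; rewrite /= -ReB -ImB.
    have sh (c : R[i] -> R) l : (fun j => c (v j x)) @ \oo --> l ->
        (fun j => (c (v k x) - c (v (k + j)%N x)) ^+ 2) @ \oo --> (c (v k x) - l) ^+ 2.
      move=> hc.
      have hB : (fun j => c (v k x) - c (v (k + j)%N x)) @ \oo --> c (v k x) - l.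
        apply: cvgB; first exact: cvg_cst.
        by rewrite -(cvg_shiftn k) in hc; under eq_fun do rewrite addnC.
      exact: (cvgM hB hB).
    by apply: cvgD; [exact: (sh _ _ hr)|exact: (sh _ _ hi)].
have LvF k : L2 mu (fun x => v k x - F x).
  split; last by apply: (le_lt_trans (key k)); rewrite ltry.
  have := cmeasurable_lin (-1) mF (proj1 (Lv k)); congr cmeasurable.
  by apply/funext => x; rewrite mulN1r addrC.
have LF : L2 mu F.
  have := L2B (Lv 0%N) (LvF 0%N); congr L2; apply/funext => x.
  by rewrite opprB addrC subrK.
exists F => // e e0.
have [|N hN] := cu (e / 4); first lra.
have [k hk] : exists k, (N <= m k)%N /\ 2 ^- k < e / 4.
  have e4 : 0 < e / 4 by lra.
  have [K _ hK] := near_infty_natSinv_expn_lt (PosNum e4).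
  exists (maxn K N); split; first exact: leq_trans (leq_maxr K N) (km _).
  by have := hK (maxn K N) (leq_maxl _ _); rewrite /= div1r.
exists N => i Ni; apply: (le_lt_trans (N2_tri (Lu i) (Lv k) LF)).
have := key k; rewrite -(N2E (LvF k)) lee_fin.
have := hN i (m k) Ni hk.1; have := hk.2; rewrite -/(v k).
set p := N2 _; set q := N2 _; lra.
Qed.

(** [Rcomplex] gives the complex numbers their structure of real vector space, so that the
    square-integrable functions form a real module. *)
Definition L2pred : {pred (T -> Rcomplex R)} := fun f => `[< L2 mu f >].

Lemma L2predP f : reflect (L2 mu f) ((f : T -> Rcomplex R) \in L2pred).
Proof. exact: asboolP. Qed.

Lemma scaleRc (a : R) (z : Rcomplex R) : a *: z = (a%:C)%C * (z : R[i]) :> R[i].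
Proof. by case: z => [c e]; rewrite /= /GRing.scale /=; apply/eqP; rewrite eq_complex /= !mul0r subr0 addr0 !eqxx. Qed.

Lemma L2pred_submod_closed : submod_closed L2pred.
Proof.
split; first by apply/L2predP; exact: L2_0.
move=> a f g /L2predP Lf /L2predP Lg; apply/L2predP.
have := L2_lin (a%:C)%C Lf Lg; congr L2; apply/funext => x.
by rewrite -scaleRc.
Qed.

HB.instance Definition _ := GRing.isSubmodClosed.Build R (T -> Rcomplex R) L2pred
  L2pred_submod_closed.

Record L2space := L2Space { L2fun : T -> Rcomplex R; _ : L2fun \in L2pred }.

HB.instance Definition _ := [isSub for L2fun].
HB.instance Definition _ := [Choice of L2space by <:].
HB.instance Definition _ := [SubChoice_isSubLmodule of L2space by <:].

Lemma L2fun_L2 (u : L2space) : L2 mu (L2fun u).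
Proof. by case: u => f hf; apply/L2predP. Qed.

(* The operations on L2space are sealed behind opaque existence proofs, to keep
   conversion from unfolding integrals. *)
Fact toL2_subproof : {F : fn -> L2space | forall f, F f = insubd 0 (f : T -> Rcomplex R)}.
Proof. by exists (fun f => insubd 0 (f : T -> Rcomplex R)). Qed.

Definition toL2 : fn -> L2space := sval toL2_subproof.

Lemma toL2K f : L2 mu f -> L2fun (toL2 f) = f.
Proof.
move=> Lf; rewrite /toL2 (svalP toL2_subproof).
by apply: (@insubdK _ _ L2space); apply/L2predP.
Qed.

Lemma L2funK : cancel L2fun toL2.
Proof. by move=> u; rewrite /toL2 (svalP toL2_subproof); exact: valKd. Qed.

Lemma L2fun_lin (a : R) (u v : L2space) x :
  L2fun (a *: u + v) x = (a%:C)%C * (L2fun u x : R[i]) + L2fun v x :> R[i].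
Proof. by rewrite -scaleRc. Qed.

Lemma L2funD (u v : L2space) x : L2fun (u + v) x = (L2fun u x : R[i]) + L2fun v x :> R[i].
Proof. by []. Qed.

Lemma L2funB (u v : L2space) x : L2fun (u - v) x = (L2fun u x : R[i]) - L2fun v x :> R[i].
Proof. by []. Qed.

Fact ipL2_subproof : {F : L2space -> L2space -> R |
  forall u v, F u v = \int[mu]_(x in setT) rdot (L2fun u x) (L2fun v x)}.
Proof. by exists (fun u v => \int[mu]_(x in setT) rdot (L2fun u x) (L2fun v x)). Qed.

Definition ipL2 : L2space -> L2space -> R := sval ipL2_subproof.

Lemma ipL2_int (u v : L2space) :
  ipL2 u v = \int[mu]_(x in setT) rdot (L2fun u x) (L2fun v x).
Proof. exact: (svalP ipL2_subproof). Qed.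

Lemma ipL2_linear a (u v w : L2space) : ipL2 (a *: u + v) w = a * ipL2 u w + ipL2 v w.
Proof.
have iu := rdot_integrable (L2fun_L2 u) (L2fun_L2 w).
have iv := rdot_integrable (L2fun_L2 v) (L2fun_L2 w).
rewrite !ipL2_int -RintegralZl // -RintegralD //; last exact: (integrableZl measurableT a iu).
apply: eq_Rintegral => x _; rewrite L2fun_lin.
case: (L2fun u x) (L2fun v x) (L2fun w x) => [p q] [r s] [t z].
by rewrite /rdot /=; ring.
Qed.

Lemma ipL2C (u v : L2space) : ipL2 u v = ipL2 v u.
Proof. by rewrite !ipL2_int; apply: eq_Rintegral => x _; exact: rdotC. Qed.

Lemma ipL2E (u : L2space) : ipL2 u u = N2 (L2fun u).
Proof. by rewrite ipL2_int; apply: eq_Rintegral => x _; rewrite sqmodE. Qed.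

Lemma ipL2_ge0 (u : L2space) : 0 <= ipL2 u u.
Proof. by rewrite ipL2E N2_ge0. Qed.

Lemma ipL2_complete (u : nat -> L2space) :
  (forall e : R, 0 < e -> exists N, forall i j, (N <= i)%N -> (N <= j)%N ->
     ipL2 (u i - u j) (u i - u j) < e) ->
  exists v, forall e : R, 0 < e -> exists N, forall k, (N <= k)%N ->
     ipL2 (u k - v) (u k - v) < e.
Proof.
move=> cu; have [|e e0|F LF hF] := @L2_complete (fun k => L2fun (u k)).
- by move=> k; exact: L2fun_L2.
- have [N hN] := cu e e0; exists N => i j hi hj.
  by have := hN i j hi hj; rewrite ipL2E.
- exists (toL2 F) => e /hF[N hN]; exists N => k /hN.
  by rewrite ipL2E; under eq_fun do rewrite -[F _](congr1 (@^~ _) (toL2K LF)).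
Qed.

HB.instance Definition _ := isSemiHilbert.Build R L2space
  ipL2_linear ipL2C ipL2_ge0 ipL2_complete.

Lemma ip_int (u v : L2space) :
  ip u v = \int[mu]_(x in setT) rdot (L2fun u x) (L2fun v x).
Proof. exact: ipL2_int. Qed.

Lemma nsqE (u : L2space) : nsq u = N2 (L2fun u).
Proof. exact: ipL2E. Qed.

Lemma nsq_toL2 f : L2 mu f -> nsq (toL2 f) = N2 f.
Proof. by move=> Lf; rewrite nsqE toL2K. Qed.

Lemma ip_toL2 f g : L2 mu f -> L2 mu g ->
  ip (toL2 f) (toL2 g) = \int[mu]_(x in setT) rdot (f x) (g x).
Proof. by move=> Lf Lg; rewrite ip_int !toL2K. Qed.

Lemma inner_toL2 f g : L2 mu f -> L2 mu g ->
  inner mu f g = (ip (toL2 f) (toL2 g) +i* ip (toL2 f) (toL2 (fun x => 'i%C * g x)))%C.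
Proof.
move=> Lf Lg; have Lig : L2 mu (fun x => 'i%C * g x).
  have := L2_lin 'i%C Lg L2_0; congr L2; apply/funext => x; exact: addr0.
rewrite !ip_toL2 // /inner; congr (_ +i* _)%C; apply: eq_Rintegral => x _.
  exact: Re_mul_conj.
exact: Im_mul_conj.
Qed.

Lemma aeq_nsq f g : L2 mu f -> L2 mu g -> aeq mu f g <-> nsq (toL2 f - toL2 g) = 0.
Proof.
move=> Lf Lg; have L := L2B Lf Lg.
have e : nsq (toL2 f - toL2 g) = N2 (fun x => f x - g x).
  by rewrite nsqE; apply: eq_Rintegral => x _; rewrite L2funB !toL2K.
rewrite e; split; first exact: N2_aeq.
move/(N2_eq0 L); apply: filterS => x /eqP; rewrite subr_eq0 => /eqP //.
Qed.

Fact bmul_subproof : {F : (T -> R) -> L2space -> L2space |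
  forall (h : T -> R) u, F h u = toL2 (mulop h (L2fun u))}.
Proof. by exists (fun (h : T -> R) u => toL2 (mulop h (L2fun u))). Qed.

Definition bmul : (T -> R) -> L2space -> L2space := sval bmul_subproof.

Lemma bmul_def (h : T -> R) (u : L2space) : bmul h u = toL2 (mulop h (L2fun u)).
Proof. exact: (svalP bmul_subproof). Qed.

Section Multiplier.
Variables (h : T -> R) (c : R).
Hypotheses (mh : measurable_fun setT h) (hc : forall x, (h x) ^+ 2 <= c).

Lemma bmul_L2 (u : L2space) : L2 mu (mulop h (L2fun u)).
Proof. exact: (L2_mul mh hc (L2fun_L2 u)). Qed.

Lemma bmulE (u : L2space) x : L2fun (bmul h u) x = ((h x)%:C)%C * (L2fun u x : R[i]) :> R[i].
Proof. by rewrite bmul_def toL2K //; exact: bmul_L2. Qed.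

Lemma bmul_adj : adj (bmul h) (bmul h).
Proof.
move=> u v; rewrite !ip_int; apply: eq_Rintegral => x _; rewrite !bmulE.
by case: (L2fun u x) (L2fun v x) => [p q] [r s]; rewrite /rdot /=; ring.
Qed.

Lemma L2space_eq (u v : L2space) : (forall x, L2fun u x = L2fun v x) -> u = v.
Proof. by move=> e; apply: val_inj; apply/funext. Qed.

Lemma bmul_lin : lin_fun (bmul h).
Proof.
move=> a u v; apply: L2space_eq => x; rewrite bmulE !L2fun_lin !bmulE.
by rewrite mulrDr; congr (_ + _); rewrite mulrCA.
Qed.

Lemma bmul_bound (u : L2space) : nsq (bmul h u) <= c * nsq u.
Proof.
rewrite !nsqE /N2 -RintegralZl //; last exact: L2_integrable (L2fun_L2 u).
apply: le_Rintegral => //.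
- exact: L2_integrable (L2fun_L2 _).
- exact: (integrableZl measurableT c (L2_integrable (L2fun_L2 u))).
- by move=> x _; rewrite bmulE sqmodM sqmod_real ler_wpM2r ?sqmod_ge0.
Qed.

End Multiplier.

End L2Functions.

(** * Orthogonal projections and trace norms *)

Section Operators.
Context {d : measure_display} {T : measurableType d} {R : realType}.
Variable mu : {measure set T -> \bar R}.
Local Notation fn := (T -> R[i]).
Local Notation X := (L2space mu).
Local Notation toX := (@toL2 _ _ _ mu).
Implicit Types (f g h : fn) (S : set fn).

Lemma L2_scale (a : R[i]) f : L2 mu f -> L2 mu (fun x => a * f x).
Proof. by move=> Lf; have := L2_lin a Lf (L2_0 mu); congr L2; apply/funext => x; rewrite addr0. Qed.

Lemma L2D f g : L2 mu f -> L2 mu g -> L2 mu (fun x => f x + g x).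
Proof. by move=> Lf Lg; have := L2_lin 1 Lf Lg; congr L2; apply/funext => x; rewrite mul1r. Qed.

Lemma toL2D f g : L2 mu f -> L2 mu g -> toX (fun x => f x + g x) = toX f + toX g.
Proof. by move=> Lf Lg; apply: L2space_eq => x; rewrite L2funD !toL2K //; exact: L2D. Qed.

Lemma toL2B f g : L2 mu f -> L2 mu g -> toX (fun x => f x - g x) = toX f - toX g.
Proof. by move=> Lf Lg; apply: L2space_eq => x; rewrite L2funB !toL2K //; exact: L2B. Qed.

Fact cscale_subproof : {F : R[i] -> X -> X |
  forall a u, F a u = toX (fun x => a * (L2fun u x : R[i]))}.
Proof. by exists (fun a u => toX (fun x => a * (L2fun u x : R[i]))). Qed.

Definition cscale : R[i] -> X -> X := sval cscale_subproof.

Lemma cscale_def a u : cscale a u = toX (fun x => a * (L2fun u x : R[i])).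
Proof. exact: (svalP cscale_subproof). Qed.

Lemma cscaleE a u x : L2fun (cscale a u) x = a * (L2fun u x : R[i]) :> R[i].
Proof. by rewrite cscale_def toL2K //; apply: L2_scale; exact: L2fun_L2. Qed.

Lemma toL2_scale a f : L2 mu f -> toX (fun x => a * f x) = cscale a (toX f).
Proof. by move=> Lf; rewrite cscale_def toL2K. Qed.

Lemma ip_cscale a (u v : X) : ip (cscale a u) v = ip u (cscale (conjc a) v).
Proof.
rewrite !ip_int; apply: eq_Rintegral => x _; rewrite !cscaleE.
by case: (L2fun u x) (L2fun v x) a => [p q] [r s] [b c]; rewrite /rdot /=; ring.
Qed.

Local Notation J := (cscale 'i%C).

Lemma ip_JJ (u v : X) : ip (J u) (J v) = ip u v.
Proof.
rewrite !ip_int; apply: eq_Rintegral => x _; rewrite !cscaleE.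
by case: (L2fun u x) (L2fun v x) => [p q] [r s]; rewrite /rdot /=; ring.
Qed.

Lemma ip_J (u v : X) : ip (J u) v = - ip u (J v).
Proof.
rewrite ip_cscale -ipNr; congr ip; apply: L2space_eq => x.
rewrite cscaleE -[- J v]sub0r L2funB cscaleE.
by case: (L2fun v x) => p q; apply/eqP; rewrite eq_complex /=; apply/andP; split; apply/eqP; ring.
Qed.

Lemma JJ (u : X) : J (J u) = - u.
Proof.
apply: L2space_eq => x; rewrite !cscaleE -[- u]sub0r L2funB.
by case: (L2fun u x) => p q; apply/eqP; rewrite eq_complex /=; apply/andP; split; apply/eqP; ring.
Qed.

Lemma nsq_J (u : X) : nsq (J u) = nsq u. Proof. exact: ip_JJ. Qed.

Lemma inner_ip f g : L2 mu f -> L2 mu g ->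
  inner mu f g = (ip (toX f) (toX g) +i* ip (toX f) (J (toX g)))%C.
Proof. by move=> Lf Lg; rewrite (inner_toL2 Lf Lg) (toL2_scale 'i%C Lg). Qed.

Lemma inner_eq0 f g : L2 mu f -> L2 mu g ->
  ip (toX f) (toX g) = 0 -> ip (toX f) (J (toX g)) = 0 -> inner mu f g = 0.
Proof. by move=> Lf Lg h1 h2; rewrite inner_ip // h1 h2. Qed.

(* Complex subspaces of L_2, not necessarily closed under a.e. equality. *)
Definition csubspace S := [/\ S `<=` L2 mu, S (fun=> 0) &
  forall (a : R[i]) f g, S f -> S g -> S (fun x => a * f x + g x)].

Definition Xset S : set X := [set u | S (L2fun u)].

Lemma csubspace_scale S a f : csubspace S -> S f -> S (fun x => a * f x).
Proof.
by move=> [_ S0 Sl] Sf; have := Sl a _ _ Sf S0; congr S; apply/funext => x; rewrite addr0.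
Qed.

Lemma Xset_toL2 S f : csubspace S -> S f -> Xset S (toX f).
Proof. by move=> [SL _ _] Sf; rewrite /Xset /= toL2K //; exact: SL. Qed.

Lemma Xset_subspace S : csubspace S -> subspace (Xset S).
Proof.
move=> [SL S0 Sl]; split.
  by have := S0; congr S; apply/funext => x.
move=> a u v Su Sv; have := Sl (a%:C)%C _ _ Su Sv; congr S; apply/funext => x.
by rewrite L2fun_lin.
Qed.

Lemma Xset_J S u a : csubspace S -> Xset S u -> Xset S (cscale a u).
Proof.
move=> cS Su; have := csubspace_scale a cS Su; congr S; apply/funext => x.
by rewrite cscaleE.
Qed.

Section OrthProj.
Context {S : set fn} {P : X -> X} (cS : csubspace S) (hP : is_proj (Xset S) P).

(** S is stable under multiplication by i, so real orthogonality to k and to i k is orthogonality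
    for [inner]. The candidate P f shows that the choice is not the default value, and uniqueness
    identifies the two. *)
Lemma orth_proj_spec f : L2 mu f -> S (orth_proj mu S f) /\
  nsq (toX (orth_proj mu S f) - P (toX f)) = 0.
Proof.
move=> Lf; have [SL _ _] := cS.
have SP : S (L2fun (P (toX f))) := proj_mem hP _.
have : exists h, S h /\ forall k, S k -> inner mu (fun x => f x - h x) k = 0.
  exists (L2fun (P (toX f))); split => // k Sk.
  have LP := L2fun_L2 (P (toX f)); have Lk := SL _ Sk; have Lfh := L2B Lf LP.
  have e : toX (fun x => f x - L2fun (P (toX f)) x) = toX f - P (toX f).
    by rewrite toL2B // L2funK.
  apply: inner_eq0 => //; rewrite e; apply: (proj2 (hP _)); first exact: Xset_toL2.
  by apply: Xset_J => //; exact: Xset_toL2.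
move=> /xgetPex -/(_ (fun=> 0)); rewrite -/(orth_proj mu S f).
move: (orth_proj mu S f) => h [Sh hh]; split=> //.
have Lh := SL _ Sh; rewrite nsqB_sym; apply: (proj_uniq (Xset_subspace cS) hP).
  exact: Xset_toL2.
move=> k Sk; have := hh _ Sk; rewrite inner_ip; [|exact: L2B|exact: L2fun_L2].
by rewrite toL2B // L2funK => /(congr1 (@complex.Re R)).
Qed.

Lemma orth_proj_mem f : L2 mu f -> S (orth_proj mu S f).
Proof. by move=> /orth_proj_spec[]. Qed.

Lemma orth_proj_L2 f : L2 mu f -> L2 mu (orth_proj mu S f).
Proof. by case: cS => SL _ _ /orth_proj_mem /SL. Qed.

Lemma orth_projE f : L2 mu f -> nsq (toX (orth_proj mu S f) - P (toX f)) = 0.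
Proof. by move=> /orth_proj_spec[]. Qed.

Lemma proj_cscale a u : nsq (P (cscale a u) - cscale a (P u)) = 0.
Proof.
apply: (proj_uniq (Xset_subspace cS) hP); first by apply: Xset_J => //; exact: (proj_mem hP).
move=> k Sk.
have -> : cscale a u - cscale a (P u) = cscale a (u - P u).
  by apply: L2space_eq => x; rewrite L2funB !cscaleE L2funB mulrBr.
by rewrite ip_cscale; apply: (proj2 (hP u)); exact: Xset_J.
Qed.

Lemma nsq_cscale_null a u : nsq u = 0 -> nsq (cscale a u) = 0.
Proof.
by move=> h; apply: nsq_weak => z; rewrite ip_cscale; exact: ip_null.
Qed.

Lemma cscaleB a (u v : X) : cscale a (u - v) = cscale a u - cscale a v.
Proof. by apply: L2space_eq => x; rewrite L2funB !cscaleE L2funB mulrBr. Qed.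

Lemma orth_proj_bounded : bounded_op mu (orth_proj mu S).
Proof.
split; first by move=> f; exact: orth_proj_L2.
- move=> a f g Lf Lg; have Lfg := L2_lin a Lf Lg.
  have Pf := orth_proj_L2 Lf; have Pg := orth_proj_L2 Lg.
  apply/aeq_nsq; [exact: orth_proj_L2|exact: L2_lin|].
  have e h k : L2 mu h -> L2 mu k -> toX (fun x => a * h x + k x) = cscale a (toX h) + toX k.
    by move=> Lh Lk; rewrite toL2D ?toL2_scale //; exact: L2_scale.
  apply: nsq_weak => z; rewrite ipBl (ip_eql z (orth_projE Lfg)) !e //.
  rewrite (ip_eql z (adj_linD _ _ (proj_adj hP))) !ipDl (ip_eql z (orth_projE Lg)).
  rewrite (ip_eql z (proj_cscale _ _)).
  have : nsq (cscale a (toX (orth_proj mu S f)) - cscale a (P (toX f))) = 0.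
    by rewrite -cscaleB; apply: nsq_cscale_null; exact: orth_projE.
  by move=> /ip_eql ->; rewrite subrr.
- exists 1 => f Lf; rewrite mul1r ler_sqrt; last exact: N2_ge0.
  rewrite -[leLHS]/(N2 mu _) -[leRHS]/(N2 mu _).
  rewrite -(nsq_toL2 Lf) -(nsq_toL2 (orth_proj_L2 Lf)).
  by rewrite (nsq_eq (orth_projE Lf)); exact: nsq_proj_le hP _.
Qed.

End OrthProj.

Fact lift_subproof : {F : (fn -> fn) -> X -> X | forall K u, F K u = toX (K (L2fun u))}.
Proof. by exists (fun K u => toX (K (L2fun u))). Qed.

Definition lift : (fn -> fn) -> X -> X := sval lift_subproof.

Lemma liftE K u : lift K u = toX (K (L2fun u)).
Proof. exact: (svalP lift_subproof). Qed.

Lemma cscale1 (u : X) : cscale 1 u = u.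
Proof. by apply: L2space_eq => x; rewrite cscaleE mul1r. Qed.

Lemma lift_lin A a (z w y : X) : bounded_op mu A ->
  ip (lift A (cscale a z + w)) y = ip (cscale a (lift A z)) y + ip (lift A w) y.
Proof.
move=> [AL Alin _].
have LA (u : X) : L2 mu (A (L2fun u)) by apply: AL; exact: L2fun_L2.
have L1 := L2_lin a (L2fun_L2 z) (L2fun_L2 w).
have h := Alin a _ _ (L2fun_L2 z) (L2fun_L2 w).
have {}h := (aeq_nsq (AL _ L1) (L2_lin a (LA z) (LA w))).1 h.
rewrite -ipDl !(liftE A z) !(liftE A w) -(toL2_scale a (LA z)) -(toL2D (L2_scale a (LA z)) (LA w)) -(ip_eql y h).
rewrite liftE; have -> // : L2fun (cscale a z + w) = (fun x => a * (L2fun z x : R[i]) + L2fun w x).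
by apply/funext => x; rewrite L2funD cscaleE.
Qed.

Lemma lift_cscale A a (z y : X) : bounded_op mu A ->
  ip (lift A (cscale a z)) y = ip (cscale a (lift A z)) y.
Proof.
move=> bA; have := lift_lin 1 0 0 y bA; rewrite !cscale1 addr0 => h0.
by have := lift_lin a z 0 y bA; rewrite addr0; lra.
Qed.

Lemma lift_add A (z w y : X) : bounded_op mu A ->
  ip (lift A (z + w)) y = ip (lift A z) y + ip (lift A w) y.
Proof. by move=> bA; have := lift_lin 1 z w y bA; rewrite !cscale1. Qed.

Lemma cscaleD a (u v : X) : cscale a (u + v) = cscale a u + cscale a v.
Proof. by apply: L2space_eq => x; rewrite L2funD !cscaleE L2funD mulrDr. Qed.

(** Positivity makes <A z, z> real, that is, A z is orthogonal to i z in the real sense; this is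
    polarized at z = x + i y. *)
Lemma positive_adj A : positive_op mu A -> adj (lift A) (lift A).
Proof.
move=> [bA Apos]; have [AL _ _] := bA.
have LA (u : X) : L2 mu (A (L2fun u)) by apply: AL; exact: L2fun_L2.
have hJ z : ip (lift A z) (J z) = 0.
  have Lz := L2fun_L2 z; have := Apos _ Lz; rewrite (inner_ip (LA z) Lz) L2funK -liftE.
  by rewrite lecE /= => /andP[/eqP ->].
move=> x y.
have := hJ (x + J y); have hx := hJ x; have hy := hJ (J y).
rewrite cscaleD !(lift_add _ _ _ bA) !(ipDr (J x)) hx hy.
rewrite !(lift_cscale _ _ _ bA) JJ ipNr ip_JJ (ipC x); lra.
Qed.

(** A complex orthonormal basis yields the real one made of e and i e; the boolean says which of the
    two. *)
Definition frameD S : set (fn * bool) := S `*`` (fun=> [set: bool]).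

Definition frameF (p : fn * bool) : X :=
  toX (if p.2 then (fun x => 'i%C * p.1 x) else p.1).

Lemma esum_bool (a : bool -> \bar R) : (forall b, 0 <= a b)%E ->
  (\esum_(b in [set: bool]) a b = a true + a false)%E.
Proof.
move=> a0; rewrite (esumID [set true]) //.
have -> : [set: bool] `&` [set true] = [set true] by rewrite setTI.
have -> : [set: bool] `&` ~` [set true] = [set false].
  by apply/seteqP; split => -[] //= [] _; exact.
by rewrite !esum_set1.
Qed.

Lemma esum_frameD S (a : fn * bool -> \bar R) : (forall p, 0 <= a p)%E ->
  (\esum_(p in frameD S) a p = \esum_(e in S) (a (e, true) + a (e, false)))%E.
Proof.
move=> a0; rewrite /frameD.
have := @esum_esum R _ _ S (fun=> [set: bool]) (fun e b => a (e, b)).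
move=> /(_ (fun _ _ _ _ => a0 _)) h.
transitivity (\esum_(k in S `*`` (fun=> [set: bool])) a (k.1, k.2)).
  by apply: eq_esum => -[].
by rewrite -h; apply: eq_esum => e _; rewrite esum_bool.
Qed.

Lemma orthonormal_basis_frame S : orthonormal_basis mu S -> frame (frameD S) frameF.
Proof.
move=> [[SL S1 So] Stot]; apply: orthonormal_frame.
  move=> [e b] [e' b'] /= [Se _] [Se' _]; rewrite /= in Se Se'.
  have Le := SL _ Se; have Le' := SL _ Se'.
  have fE (q : fn) c : L2 mu q -> frameF (q, c) = if c then J (toX q) else toX q.
    by move=> Lq; rewrite /frameF /=; case: c => //; rewrite toL2_scale.
  rewrite !fE // xpair_eqE.
  have [ee|ne] := eqVneq e e'.
    rewrite -{e'}ee in Se' Le' *.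
    have := S1 _ Se; rewrite (inner_ip Le Le) => h.
    have h1 : ip (toX e) (toX e) = 1 by have := congr1 (@complex.Re R) h.
    have h2 : ip (toX e) (J (toX e)) = 0 by have := congr1 (@complex.Im R) h.
    by case: b b' => -[] /=; rewrite ?ip_JJ ?h1 ?h2 // ipC.
  have := So _ _ Se Se' (elimN eqP ne); rewrite (inner_ip Le Le') => h.
  have h1 : ip (toX e) (toX e') = 0 by have := congr1 (@complex.Re R) h.
  have h2 : ip (toX e) (J (toX e')) = 0 by have := congr1 (@complex.Im R) h.
  by case: b b' => -[] /=; rewrite ?ip_JJ ?h1 ?h2 // ip_J h2 oppr0.
move=> u hu; have Lu := L2fun_L2 u.
have z0 : toX (fun=> 0) = 0 by apply: L2space_eq => x; rewrite toL2K //; exact: L2_0.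
have : aeq mu (L2fun u) (fun=> 0).
  apply: Stot => // e Se; have Le := SL _ Se.
  apply: inner_eq0 => //; rewrite L2funK.
    by have := hu (e, false) (conj Se I); rewrite /frameF.
  by have := hu (e, true) (conj Se I); rewrite /frameF /= toL2_scale.
by move/(aeq_nsq Lu (L2_0 mu)); rewrite L2funK z0 subr0.
Qed.

Lemma orthonormal_basis_exists : exists S, orthonormal_basis mu S.
Proof.
have [|S [oS mS]] := @Zorn_bigcup fn (orthonormal mu).
  move=> F Fo tF; split.
  - by move=> e [S FS Se]; case: (Fo _ FS) => + _ _; exact.
  - by move=> e [S FS Se]; case: (Fo _ FS) => _ + _; exact.
  - move=> e e' [S FS Se] [S' FS' Se'].
    have [SS|SS] := tF _ _ FS FS'.
      by case: (Fo _ FS') => _ _; apply => //; exact: SS.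
    by case: (Fo _ FS) => _ _; apply => //; exact: SS.
exists S; split=> // f Lf of_.
have z0 : toX (fun=> 0) = 0 by apply: L2space_eq => x; rewrite toL2K //; exact: L2_0.
apply/(aeq_nsq Lf (L2_0 mu)); rewrite z0 subr0; apply/eqP/negPn/negP => nf.
have [SL S1 So] := oS.
pose r := (Num.sqrt (nsq (toX f)))^-1.
have r2 : r ^+ 2 * nsq (toX f) = 1.
  by rewrite exprVn sqr_sqrtr ?nsq_ge0 // mulVf.
pose e := fun x => (r%:C)%C * f x.
have Le : L2 mu e by exact: L2_scale.
have eE : toX e = r *: toX f.
  by apply: L2space_eq => x; rewrite toL2K // /e -(addr0 (_ *: _)) L2fun_lin toL2K // addr0.
have oe s : S s -> inner mu e s = 0.
  move=> Ss; have Ls := SL _ Ss; have := of_ _ Ss; rewrite (inner_ip Lf Ls) => h.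
  apply: inner_eq0 => //; rewrite eE ipZl.
    by have /= -> := congr1 (@complex.Re R) h; rewrite mulr0.
  by have /= -> := congr1 (@complex.Im R) h; rewrite mulr0.
have oe' s : S s -> inner mu s e = 0.
  move=> Ss; have Ls := SL _ Ss; have := oe _ Ss; rewrite (inner_ip Le Ls) => h.
  apply: inner_eq0 => //; first by rewrite ipC; have := congr1 (@complex.Re R) h.
  by rewrite ipC ip_J; have /= -> := congr1 (@complex.Im R) h; rewrite oppr0.
have ee : inner mu e e = 1.
  rewrite (inner_ip Le Le); have -> : ip (toX e) (toX e) = 1.
    by rewrite -/(nsq _) eE nsqZ r2.
  have -> : ip (toX e) (J (toX e)) = 0 by have := ip_J (toX e) (toX e); rewrite ipC; lra.
  by [].
have oSe : orthonormal mu (S `|` [set e]).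
  split.
  - by move=> s [/SL|->].
  - by move=> s [/S1|->].
  - by move=> s s' [Ss|->] [Ss'|->] //; [exact: So|move=> _; exact: oe'|move=> _; exact: oe].
have Se : ~ S e by move=> Se; have := oe _ Se; rewrite ee => /eqP; rewrite oner_eq0.
by apply: (mS (S `|` [set e])) => //; split; [move=> s; left|move=> /(_ e (or_intror erefl))].
Qed.

Lemma ip_Jself (u : X) : ip u (J u) = 0.
Proof. by have := ip_J u u; rewrite ipC; lra. Qed.

Lemma toL2_0 : toX (fun=> 0) = 0.
Proof. by apply: L2space_eq => x; rewrite toL2K //; exact: L2_0. Qed.

Lemma positive_ip A (u : X) : positive_op mu A -> 0 <= ip (lift A u) u.
Proof.
move=> [[AL _ _] Apos]; have Lu := L2fun_L2 u.
have := Apos _ Lu; rewrite (inner_ip (AL _ Lu) Lu) L2funK -liftE.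
by rewrite lecE /= => /andP[].
Qed.

Lemma abs_op_nsq K A (u : X) : (forall f, L2 mu f -> L2 mu (K f)) ->
  positive_op mu A ->
  (exists2 K', is_adjoint mu K K' & forall f, L2 mu f -> aeq mu (A (A f)) (K' (K f))) ->
  nsq (lift A u) = nsq (lift K u).
Proof.
move=> KL pA [K' [[K'L _ _] hK'] hA]; have [[AL _ _] _] := pA.
have Lu := L2fun_L2 u; have LAu := AL _ Lu; have LKu := KL _ Lu.
have e1 : nsq (lift A u) = ip (lift A (lift A u)) u.
  by rewrite (positive_adj pA).
have e2 := (aeq_nsq (AL _ LAu) (K'L _ LKu)).1 (hA _ Lu).
have e3 : lift A (lift A u) = toX (A (A (L2fun u))) by rewrite !liftE toL2K.
rewrite e1 e3 (ip_eql u e2) ipC.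
have := hK' _ _ Lu LKu; rewrite (inner_ip LKu LKu) (inner_ip Lu (K'L _ LKu)) L2funK.
by rewrite -liftE => /(congr1 (@complex.Re R)) /= <-.
Qed.

Lemma inner_Re_lift A S e : (forall f, L2 mu f -> L2 mu (A f)) ->
  orthonormal_basis mu S -> S e ->
  complex.Re (inner mu (A e) e) = ip (lift A (frameF (e, false))) (frameF (e, false)).
Proof.
move=> AL [[SL _ _] _] Se; have Le := SL _ Se.
by rewrite (inner_ip (AL _ Le) Le) /= liftE /frameF /= toL2K.
Qed.

(** The trace is a supremum over bases, so the bound is required for each of them, and for every
    self-adjoint A with |A x| = |K x|. The sum over e and i e only enlarges the trace of a positive
    operator. *)
Lemma trace_norm_bounds K (K1 : X -> X) c : (forall f, L2 mu f -> L2 mu (K f)) ->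
  adj (lift K) K1 -> 0 <= c ->
  (forall S (A : X -> X), orthonormal_basis mu S -> adj A A ->
    (forall x, nsq (A x) = nsq (lift K x)) ->
    (\esum_(p in frameD S) (ip (A (frameF p)) (frameF p))%:E <= c%:E)%E) ->
  (0 <= trace_norm mu K)%E /\ (trace_norm mu K <= c%:E)%E.
Proof.
move=> KL aK c0 H.
suff t S : orthonormal_basis mu S ->
    (0 <= \esum_(e in S) (complex.Re (inner mu (abs_op mu K e) e))%:E <= c%:E)%E.
  have [S0 oS0] := orthonormal_basis_exists; split.
    have /andP[h _] := t _ oS0; apply: (le_trans h).
    by apply: ereal_sup_ubound; exists S0.
  by apply: ge_ereal_sup => _ [S oS <-]; case/andP: (t _ oS).
move=> oS; rewrite /abs_op; set P := [set _ | _].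
have [[A PA]|nP] := pselect (exists A, P A); last first.
  have -> : xget (fun _ _ => 0) P = (fun _ _ => 0).
    by rewrite xgetPN // => A PA; apply: nP; exists A.
  rewrite esum1 ?lexx ?lee_fin // => e Se.
  have [[SL _ _] _] := oS.
  by rewrite (inner_ip (L2_0 mu) (SL _ Se)) toL2_0 /= ip0l.
have := xgetPex (fun _ _ => 0) (ex_intro _ A PA).
move: (xget _ _) => {PA}A [pA hA]; have [[AL _ _] _] := pA.
have ge0 p : (0 <= (ip (lift A (frameF p)) (frameF p))%:E)%E.
  by rewrite lee_fin; exact: positive_ip.
have -> : (\esum_(e in S) (complex.Re (inner mu (A e) e))%:E =
    \esum_(e in S) (ip (lift A (frameF (e, false))) (frameF (e, false)))%:E)%E.
  by apply: eq_esum => e Se; rewrite (inner_Re_lift AL oS Se).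
apply/andP; split; first exact: esum_ge0.
apply: (le_trans _ (H S (lift A) oS (positive_adj pA) _)); last first.
  by move=> x; exact: abs_op_nsq.
by rewrite esum_frameD //; apply: le_esum => e Se; rewrite leeDr.
Qed.

(** * Compressed projections and their traces *)

Section Compression.
Context {L : set fn} {P : X -> X} (cL : csubspace L) (hP : is_proj (Xset L) P).
Variable h : T -> R.
Hypotheses (mh : measurable_fun setT h) (h1 : forall x, (h x) ^+ 2 <= 1).
Let Q := orth_proj mu L.
Let K := compress h Q.

Lemma toL2_mulop f : L2 mu f -> toX (mulop h f) = bmul h (toX f).
Proof. by move=> Lf; rewrite bmul_def toL2K. Qed.

Lemma compress_L2 (W : fn -> fn) f : (forall f, L2 mu f -> L2 mu (W f)) ->
  L2 mu f -> L2 mu (compress h W f).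
Proof. by move=> hW Lf; apply: (L2_mul mh h1); apply: hW; exact: (L2_mul mh h1). Qed.

Lemma bmul_cscale a u : bmul h (cscale a u) = cscale a (bmul h u).
Proof.
apply: L2space_eq => x.
by rewrite (bmulE mh h1) !cscaleE (bmulE mh h1) mulrCA.
Qed.

Lemma lift_compress u : nsq (lift K u - bmul h (P (bmul h u))) = 0.
Proof.
have Lu := L2fun_L2 u; have Lm := L2_mul mh h1 Lu.
rewrite liftE /K /compress toL2_mulop; last exact: orth_proj_L2 cL hP _ Lm.
apply: (adj_null (bmul_adj mh h1)).
by rewrite (nsq_eq (y := 0)) ?nsq0 // subr0 bmul_def; exact: orth_projE cL hP _ Lm.
Qed.

Lemma lift_compress_ip u v : ip (lift K u) v = ip (P (bmul h u)) (P (bmul h v)).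
Proof.
rewrite (ip_eql v (lift_compress u)) (bmul_adj mh h1).
by rewrite [LHS]ipC -(proj_ip hP (bmul h v) (proj_mem hP _)) ipC.
Qed.

Lemma compress_positive : bounded_op mu K -> positive_op mu K.
Proof.
move=> bK; split=> // f Lf; have [KL _ _] := bK.
rewrite (inner_ip (KL _ Lf) Lf) lecE /=.
have -> : toX (K f) = lift K (toX f) by rewrite liftE toL2K.
rewrite !lift_compress_ip ip_ge0 andbT bmul_cscale.
by rewrite ipC (ip_eql _ (proj_cscale cL hP _ _)) ipC ip_Jself.
Qed.

(** K = h Q h is positive, hence one possible square root of its own square. By uniqueness the
    chosen absolute value has the same form, and <K u, u> = |Q h u|^2 turns the trace into a
    Hilbert-Schmidt sum. The vectors i e contribute as much as the vectors e. *)
Lemma compress_HS S : trace_class mu K -> orthonormal_basis mu S ->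
  (HS (frameD S) frameF (P \o bmul h) < +oo)%E.
Proof.
move=> [bK]; have pK := compress_positive bK; have aK := positive_adj pK.
have [KL _ _] := bK; rewrite /trace_norm /abs_op.
have : exists A, positive_op mu A /\ exists2 K', is_adjoint mu K K' &
    forall f, L2 mu f -> aeq mu (A (A f)) (K' (K f)).
  exists K; split=> //; exists K => [|f Lf]; last exact: aeW.
  split=> // f g Lf Lg.
  rewrite (inner_ip (KL _ Lf) Lg) (inner_ip Lf (KL _ Lg)).
  have -> : toX (K f) = lift K (toX f) by rewrite liftE toL2K.
  have -> : toX (K g) = lift K (toX g) by rewrite liftE toL2K.
  rewrite !aK; congr (_ +i* _)%C.
  by rewrite ipC (lift_cscale _ _ _ bK) ipC.
move=> /xgetPex -/(_ (fun _ _ => 0)); move: (xget _ _) => A [pA hA].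
have [[AL _ _] _] := pA.
move=> tr oS.
have E u : ip (lift A u) u = nsq (P (bmul h u)).
  rewrite -[RHS]/(ip _ _) -lift_compress_ip.
  have [M hM] : exists M, forall x : X, nsq (lift K x) <= M * nsq x.
    exists 1 => x; rewrite (nsq_eq (lift_compress x)) mul1r.
    have b1 := bmul_bound mh h1 (P (bmul h x)).
    have b2 := nsq_proj_le hP (bmul h x); have b3 := bmul_bound mh h1 x.
    by move: b1 b2 b3; rewrite !mul1r => b1 b2 b3; exact: le_trans b1 (le_trans b2 b3).
  apply: (sqrt_uniq (positive_adj pA) aK _ _ hM).
  - by move=> x; exact: positive_ip.
  - by move=> x; exact: positive_ip.
  - by move=> x; exact: abs_op_nsq.
have t1 : (\esum_(e in S) (nsq (P (bmul h (frameF (e, false)))))%:E < +oo)%E.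
  apply: (le_lt_trans _ tr); apply: ereal_sup_ubound; exists S => //.
  by apply: eq_esum => e Se; rewrite (inner_Re_lift AL oS Se) E.
rewrite /HS esum_frameD; last by move=> p; rewrite lee_fin nsq_ge0.
rewrite esumD; [|by move=> e _; rewrite lee_fin nsq_ge0..].
apply: lte_add_pinfty => //.
have -> // : (\esum_(e in S) (nsq ((P \o bmul h) (frameF (e, true))))%:E =
  \esum_(e in S) (nsq (P (bmul h (frameF (e, false)))))%:E)%E.
apply: eq_esum => e Se; have [[SL _ _] _] := oS; have Le := SL _ Se.
rewrite /frameF /= (toL2_scale _ Le) bmul_cscale.
by rewrite (nsq_eq (proj_cscale cL hP _ _)) nsq_J.
Qed.

End Compression.

End Operators.

Section TraceClass.
Context {d : measure_display} {T : measurableType d} {R : realType}.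
Variable mu : {measure set T -> \bar R}.
Local Notation fn := (T -> R[i]).
Local Notation X := (L2space mu).
Local Notation toX := (@toL2 _ _ _ mu).

Lemma HS_opnorm_self (I : choiceType) (D : set I) (f : I -> X) Y Y' c :
  frame D f -> adj Y Y' -> (HS D f Y <= c%:E)%E ->
  forall x, nsq (Y x) <= c * nsq x.
Proof.
by move=> hf aY hc; apply: (HS_opnorm hf (adjC aY)); rewrite -(HS_adj hf hf aY).
Qed.

Lemma HS_frames (I I' : choiceType) (D : set I) (f : I -> X) (D' : set I') (f' : I' -> X) Y Y' :
  frame D f -> frame D' f' -> adj Y Y' -> HS D f Y = HS D' f' Y.
Proof. by move=> hf hf' aY; rewrite (HS_adj hf hf' aY) (HS_adj hf' hf' aY). Qed.

Lemma L2norm_le (f g : fn) : L2 mu f -> L2 mu g -> nsq (toX f) <= nsq (toX g) ->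
  L2norm mu f <= L2norm mu g.
Proof. by move=> Lf Lg; rewrite !nsq_toL2 // ler_sqrt //; exact: N2_ge0. Qed.

Section Compress.
Variable h : T -> R.
Hypotheses (mh : measurable_fun setT h) (h1 : forall x, (h x) ^+ 2 <= 1).

Lemma L2_mulop (f : fn) : L2 mu f -> L2 mu (mulop h f).
Proof. exact: (L2_mul mh h1). Qed.

Lemma L2norm_mulop (f : fn) : L2 mu f -> L2norm mu (mulop h f) <= L2norm mu f.
Proof.
move=> Lf; apply: L2norm_le => //; first exact: L2_mulop.
by rewrite toL2_mulop //; have := bmul_bound mh h1 (toX f); rewrite mul1r.
Qed.

Lemma compress_bounded K : bounded_op mu K -> bounded_op mu (compress h K).
Proof.
move=> [KL Klin [M hM]]; split.
- by move=> f; exact: compress_L2.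
- move=> a f g Lf Lg; have := Klin a _ _ (L2_mulop Lf) (L2_mulop Lg).
  have -> : (fun x => a * mulop h f x + mulop h g x) = mulop h (fun x => a * f x + g x).
    by apply/funext => x; rewrite /mulop mulrDr; congr (_ + _); rewrite mulrCA.
  apply: filterS => x; rewrite /compress /= => e; rewrite {1}/mulop e.
  by rewrite /mulop mulrDr; congr (_ + _); rewrite mulrCA.
- exists `|M| => f Lf; have Lm := L2_mulop Lf.
  apply: (le_trans (L2norm_mulop (KL _ Lm))); apply: (le_trans (hM _ Lm)).
  have n0 : 0 <= L2norm mu (mulop h f) by exact: sqrtr_ge0.
  apply: (@le_trans _ _ (`|M| * L2norm mu (mulop h f))).
    by rewrite ler_wpM2r // ler_norm.
  by rewrite ler_wpM2l //; exact: L2norm_mulop.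
Qed.

Section TwoProjections.
Context {S L : set fn} {P Q : X -> X}.
Hypotheses (cS : csubspace mu S) (cL : csubspace mu L).
Hypotheses (hP : is_proj (Xset S) P) (hQ : is_proj (Xset L) Q).
Variables (S0 : set fn) (oS0 : orthonormal_basis mu S0).
Let D0 := frameD S0.
Let F0 := @frameF _ _ _ mu.

Lemma trace_class_proj c : (HS D0 F0 (P \o bmul h) <= c%:E)%E ->
  trace_class mu (compress h (orth_proj mu S)).
Proof.
move=> hc; have f0 : frame D0 F0 := orthonormal_basis_frame oS0.
have bK := compress_bounded (orth_proj_bounded cS hP); split=> //.
have aK := positive_adj (compress_positive cS hP mh h1 bK).
have aY := adj_comp (proj_adj hP) (bmul_adj mh h1).
have c0 : 0 <= c by rewrite -lee_fin; apply: le_trans hc; exact: HS_ge0.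
have [KL _ _] := bK.
suff [_ h2] : (0 <= trace_norm mu (compress h (orth_proj mu S)))%E /\
    (trace_norm mu (compress h (orth_proj mu S)) <= (c + c)%:E)%E.
  by apply: (le_lt_trans h2); rewrite ltry.
apply: (trace_norm_bounds KL aK); first by rewrite addr_ge0.
move=> S' A oS' aA eA; have f' := orthonormal_basis_frame oS'.
have hc' : (HS (frameD S') F0 (P \o bmul h) <= c%:E)%E by rewrite (HS_frames f' f0 aY).
have z : (HS (frameD S') F0 (fun=> 0%R) <= 0%:E)%E.
  by rewrite /HS esum1 // => i _; rewrite nsq0.
have a0 : adj (fun _ : X => (0 : X)) (fun _ : X => (0 : X)).
  by move=> x y; rewrite ip0l ip0r.
have := trace_estimate f' aA aK aY a0 eA _ ltr01 hc' hc' z z.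
rewrite invr1 !mul1r !addr0; apply => x y.
by rewrite (lift_compress_ip cS hP mh h1) ip0l addr0.
Qed.

(** The factors that are not small are weighted by the free parameter t: fixing t first makes 3 c t
    small, then e handles 2 e / t. The term 2 e + 2 c bounding P h comes from P = (P - Q) + Q. *)
Lemma trace_norm_diff c e t : 0 < t ->
  (HS D0 F0 (Q \o bmul h) <= c%:E)%E ->
  (HS D0 F0 (fun x => (P (bmul h x) - Q (bmul h x))%R) <= e%:E)%E ->
  let K := compress h (fun f x => orth_proj mu S f x - orth_proj mu L f x) in
  (0 <= trace_norm mu K)%E /\
  (trace_norm mu K <= (2 * e / t + t * (2 * e + 3 * c))%:E)%E.
Proof.
move=> t0 hc he K; have f0 : frame D0 F0 := orthonormal_basis_frame oS0.
have c0 : 0 <= c by rewrite -lee_fin; apply: le_trans hc; exact: HS_ge0.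
have e0 : 0 <= e by rewrite -lee_fin; apply: le_trans he; exact: HS_ge0.
have am := bmul_adj (mu := mu) mh h1.
have aP := proj_adj hP; have aQ := proj_adj hQ.
have aY1 := adj_comp aP am; have aY2 := adj_comp aQ am.
have aD := adj_comp (adjB aP aQ) am.
have KL f : L2 mu f -> L2 mu (K f).
  apply: compress_L2 => // g Lg; apply: L2B; first exact: orth_proj_L2 cS hP _ Lg.
  exact: orth_proj_L2 cL hQ _ Lg.
have KE (x y : X) : ip (lift K x) y = ip (P (bmul h x) - Q (bmul h x)) (bmul h y).
  have Lm := L2_mulop (L2fun_L2 x).
  have LP := orth_proj_L2 cS hP Lm; have LQ := orth_proj_L2 cL hQ Lm.
  rewrite liftE /K /compress (toL2_mulop _ (L2B LP LQ)) am (toL2B LP LQ) !ipBl.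
  by rewrite (ip_eql _ (orth_projE cS hP Lm)) (ip_eql _ (orth_projE cL hQ Lm)) -bmul_def.
have aK : adj (lift (mu := mu) K) (lift (mu := mu) K).
  move=> x y; rewrite KE [RHS]ipC KE !ipBl aP aQ.
  by rewrite (ipC (P _)) (ipC (Q _)) (ipC (bmul h x)) (ipC (bmul h x)).
apply: (trace_norm_bounds KL aK).
  apply: addr_ge0; first by apply: divr_ge0; [lra|exact: ltW].
  by apply: mulr_ge0; [exact: ltW|lra].
move=> S' A oS' aA eA; have f' := orthonormal_basis_frame oS'.
have hQ' : (HS (frameD S') F0 (Q \o bmul h) <= c%:E)%E by rewrite (HS_frames f' f0 aY2).
have hD' : (HS (frameD S') F0 (fun x => (P (bmul h x) - Q (bmul h x))%R) <= e%:E)%E.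
  by rewrite (HS_frames f' f0 aD).
have hP' : (HS (frameD S') F0 (P \o bmul h) <= (2 * e + 2 * c)%:E)%E.
  apply: HS_lin hD' hQ' => // x /=.
  by have := nsqD_le (P (bmul h x) - Q (bmul h x)) (Q (bmul h x)); rewrite subrK.
have := trace_estimate f' aA aK aY1 aD eA _ t0 hD' hP' hQ' hD'.
have -> : t^-1 * e + t * (2 * e + 2 * c) + (t * c + t^-1 * e) =
  2 * e / t + t * (2 * e + 3 * c) by ring.
apply => x y; rewrite KE /= !ipBl !ipBr.
have e1 : ip (P (bmul h x)) (bmul h y) = ip (P (bmul h x)) (P (bmul h y)).
  by rewrite [LHS]ipC -(proj_ip hP (bmul h y) (proj_mem hP _)) ipC.
have e2 : ip (Q (bmul h x)) (bmul h y) = ip (Q (bmul h x)) (Q (bmul h y)).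
  by rewrite [LHS]ipC -(proj_ip hQ (bmul h y) (proj_mem hQ _)) ipC.
by rewrite e1 e2; lra.
Qed.

End TwoProjections.
End Compress.

Lemma nsq_int_le (u v w z : X) (a b c : R) :
  (forall x, sqmod (L2fun u x : R[i]) <= a * sqmod (L2fun v x : R[i]) +
     b * sqmod (L2fun w x : R[i]) + c * sqmod (L2fun z x : R[i])) ->
  nsq u <= a * nsq v + b * nsq w + c * nsq z.
Proof.
move=> le; rewrite !nsqE /N2.
have iu := L2_integrable (L2fun_L2 u); have iv := L2_integrable (L2fun_L2 v).
have iw := L2_integrable (L2fun_L2 w); have iz := L2_integrable (L2fun_L2 z).
have iv' := integrableZl measurableT a iv; have iw' := integrableZl measurableT b iw.
have iz' := integrableZl measurableT c iz.
have ivw := integrableD measurableT iv' iw'.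
rewrite -!RintegralZl // -(RintegralD measurableT iv' iw') -(RintegralD measurableT ivw iz').
by apply: le_Rintegral => //; exact: (integrableD measurableT ivw iz').
Qed.

Lemma closed_csubspace L : closed_linear_subspace mu L -> csubspace mu L.
Proof. by move=> [[_ L0 Ll _] LL _]; split. Qed.

Lemma closed_proj L : closed_linear_subspace mu L -> projectable (Xset (mu := mu) L).
Proof.
move=> cL; have cL' := closed_csubspace cL; have [_ _ Lc] := cL.
apply: closed_projectable; first exact: Xset_subspace.
move=> u cu; exists u; last by rewrite subrr nsq0.
apply: Lc => [|e e0]; first exact: L2fun_L2.
have e2 : 0 < e ^+ 2 by rewrite exprn_gt0.
have [s Ls hs] := cu _ e2; exists (L2fun s) => //.
rewrite -(ger0_norm (ltW e0)) -sqrtr_sqr ltr_sqrt //.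
rewrite -[ltLHS]/(N2 mu _) -nsq_toL2; last exact: L2B (L2fun_L2 u) (L2fun_L2 s).
by rewrite (toL2B (L2fun_L2 u) (L2fun_L2 s)) !L2funK.
Qed.

End TraceClass.

(** * Multiplication operators *)

Section Multipliers.
Context {d : measure_display} {T : measurableType d} {R : realType}.
Variable mu : {measure set T -> \bar R}.
Local Notation fn := (T -> R[i]).
Local Notation X := (L2space mu).
Local Notation toX := (@toL2 _ _ _ mu).

Definition chi (A : set T) : X -> X := bmul (\1_A).

Lemma indic_sq (A : set T) x : (\1_A x : R) ^+ 2 = (x \in A)%:R.
Proof. by rewrite indicE; case: (x \in A); rewrite ?expr1n // expr0n. Qed.

Lemma indic_sq1 (A : set T) x : (\1_A x : R) ^+ 2 <= 1.
Proof. by rewrite indic_sq; case: (x \in A). Qed.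

Lemma bmul_sq (h : T -> R) c (u : X) x : measurable_fun setT h -> (forall x, (h x) ^+ 2 <= c) ->
  sqmod (L2fun (bmul h u) x : R[i]) = h x ^+ 2 * sqmod (L2fun u x : R[i]).
Proof. by move=> mh hc; rewrite (bmulE mh hc) sqmodM sqmod_real. Qed.

Section Indicator.
Variables (A : set T) (mA : measurable A).

Lemma chi_sq (u : X) x : sqmod (L2fun (chi A u) x : R[i]) = (x \in A)%:R * sqmod (L2fun u x : R[i]).
Proof. by rewrite (bmul_sq _ _ (measurable_indic mA) (@indic_sq1 A)) indic_sq. Qed.

Lemma chi_adj : adj (chi A) (chi A).
Proof. exact: (bmul_adj (measurable_indic mA) (@indic_sq1 A)). Qed.

Lemma chi_lin : lin_fun (chi A).
Proof. exact: (bmul_lin (measurable_indic mA) (@indic_sq1 A)). Qed.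

Lemma chi_le (u : X) : nsq (chi A u) <= nsq u.
Proof. by have := bmul_bound (measurable_indic mA) (@indic_sq1 A) u; rewrite mul1r. Qed.

End Indicator.

Lemma nsq_ptw_le (u v : X) (a : R) :
  (forall x, sqmod (L2fun u x : R[i]) <= a * sqmod (L2fun v x : R[i])) -> nsq u <= a * nsq v.
Proof.
move=> h; have := @nsq_int_le _ _ _ mu u v 0 0 a 0 0; rewrite !mul0r !addr0; apply => x.
by rewrite !mul0r !addr0.
Qed.

Section Exhaustion.
Variable (B : nat -> set T).
Hypotheses (mB : forall k, measurable (B k)) (B_incr : forall k l, (k <= l)%N -> B k `<=` B l)
  (B_cover : forall x, exists k, B k x).

Lemma chi_tail (u : X) e : 0 < e -> exists N, forall k, (N <= k)%N -> nsq (chi (~` B k) u) < e.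
Proof.
move=> e0; have mBc k : measurable (~` B k) by exact: measurableC.
pose f k x := (sqmod (L2fun (chi (~` B k) u) x : R[i]))%:E.
have Lu := L2fun_L2 u.
have mf k : measurable_fun setT (f k).
  by apply/measurable_EFinP; apply: measurable_sqmod; case: (L2fun_L2 (chi (~` B k) u)).
have [||||_ _] := @dominated_convergence _ T R mu setT measurableT f (cst 0%E)
    (EFin \o (fun x => sqmod (L2fun u x : R[i]))) mf.
- exact: measurable_cst.
- apply: aeW => x _; have [k Bk] := B_cover x.
  apply: cvg_near_cst; exists k => // l kl; rewrite /f chi_sq //.
  by rewrite memNset ?mul0r // => h; apply: h; exact: B_incr kl _ Bk.
- exact: L2_integrable.
- apply: aeW => x k _; rewrite /f chi_sq // gee0_abs ?lee_fin ?mulr_ge0 ?sqmod_ge0 //.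
  by rewrite ler_piMl ?sqmod_ge0 //; case: (_ \in _).
rewrite integral0 => /fine_cvgP[_] /cvgrPdist_lt /(_ e e0)[N _ hN].
exists N => k /hN; rewrite sub0r normrN /= => h.
by rewrite nsqE; apply: le_lt_trans h; rewrite ler_norm.
Qed.

End Exhaustion.

Section Weight.
Variable (g : T -> R).
Hypotheses (mg : measurable_fun setT g) (g01 : forall x, 0 < g x <= 1).
Let s x := Num.sqrt (g x).

Definition wmul : X -> X := bmul (fun x => Num.sqrt (g x)).

Lemma measurable_sqrt_fun : measurable_fun setT s.
Proof.
apply: (measurableT_comp (f := @Num.sqrt R)) => //.
by apply: continuous_measurable_fun; exact: sqrt_continuous.
Qed.

Lemma weight_sqrt_sq x : s x ^+ 2 = g x.
Proof. by rewrite sqr_sqrtr //; case/andP: (g01 x) => /ltW. Qed.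

Lemma weight_sqrt_sq1 x : s x ^+ 2 <= 1.
Proof. by rewrite weight_sqrt_sq; case/andP: (g01 x). Qed.

Lemma weight_sqrt01 x : 0 <= s x <= 1.
Proof. by rewrite sqrtr_ge0 /= -(expr_le1 (n := 2)) ?sqrtr_ge0 // weight_sqrt_sq1. Qed.

Lemma wmul_sq u x : sqmod (L2fun (wmul u) x : R[i]) = g x * sqmod (L2fun u x : R[i]).
Proof. by rewrite (bmul_sq _ _ measurable_sqrt_fun weight_sqrt_sq1) weight_sqrt_sq. Qed.

Lemma wmul_adj : adj wmul wmul.
Proof. exact: (bmul_adj measurable_sqrt_fun weight_sqrt_sq1). Qed.

Lemma wmul_lin : lin_fun wmul.
Proof. exact: (bmul_lin measurable_sqrt_fun weight_sqrt_sq1). Qed.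

Lemma wmulE u x : L2fun (wmul u) x = ((s x)%:C)%C * (L2fun u x : R[i]) :> R[i].
Proof. exact: (bmulE measurable_sqrt_fun weight_sqrt_sq1). Qed.

Lemma wmul_le u : nsq (wmul u) <= nsq u.
Proof. by have := bmul_bound measurable_sqrt_fun weight_sqrt_sq1 u; rewrite mul1r. Qed.

Lemma compl_sq u x : sqmod (L2fun (u - wmul u) x : R[i]) = (1 - s x) ^+ 2 * sqmod (L2fun u x : R[i]).
Proof.
rewrite L2funB wmulE; have -> : (L2fun u x : R[i]) - ((s x)%:C)%C * (L2fun u x : R[i]) =
    ((1 - s x)%:C)%C * (L2fun u x : R[i]).
  by case: (L2fun u x) => p q; apply/eqP; rewrite eq_complex /=;
    apply/andP; split; apply/eqP; ring.
by rewrite sqmodM sqmod_real.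
Qed.

(** Pointwise (1 - s)^2 <= 1 - s^2 for s in [0, 1]. This feeds [proj_perturb]. *)
Lemma compl_le u : nsq (u - wmul u) <= nsq u - nsq (wmul u).
Proof.
have := @nsq_int_le _ _ _ mu (u - wmul u) u (wmul u) 0 1 (-1) 0.
rewrite mul1r mulN1r mul0r addr0; apply => x.
rewrite compl_sq wmul_sq mul1r mulN1r mul0r addr0.
have h : (1 - s x) ^+ 2 * sqmod (L2fun u x : R[i]) <= (1 - g x) * sqmod (L2fun u x : R[i]).
  rewrite ler_wpM2r ?sqmod_ge0 // -weight_sqrt_sq.
  by have /andP[] := weight_sqrt01 x; nra.
by apply: (le_trans h); rewrite mulrBl mul1r.
Qed.

(** The defect has density 1 - g, at most e on the union of A and B and at most 1 elsewhere. *)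
Lemma wmul_defect (A B : set T) e u : measurable A -> measurable B -> 0 <= e ->
  (forall x, A x \/ B x -> 1 - g x <= e) ->
  nsq u - nsq (wmul u) <= e * nsq u + nsq (chi (~` B) (chi (~` A) u)).
Proof.
move=> mA mB e0 h.
have := @nsq_int_le _ _ _ mu u (wmul u) u (chi (~` B) (chi (~` A) u)) 1 e 1.
rewrite !mul1r => le; suff : nsq u <= nsq (wmul u) + e * nsq u + nsq (chi (~` B) (chi (~` A) u)) by lra.
apply: le => x; rewrite wmul_sq !chi_sq; [|exact: measurableC..].
have s0 := sqmod_ge0 (L2fun u x : R[i]); have /andP[g0 g1] := g01 x.
set q := sqmod _ in s0 *; set b := (x \in ~` B)%:R : R; set a := (x \in ~` A)%:R : R.
have [hAB|hAB] := pselect (A x \/ B x).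
  have := h x hAB => h1; have ab0 : 0 <= b * (a * q).
    by rewrite !mulr_ge0 // /a /b ler0n.
  have : (1 - g x) * q <= e * q by exact: ler_wpM2r.
  lra.
have -> : b = 1 by rewrite /b mem_set //= => Bx; apply: hAB; right.
have -> : a = 1 by rewrite /a mem_set //= => Ax; apply: hAB; left.
have : 0 <= g x * q by rewrite mulr_ge0 // ltW.
have : 0 <= e * q by rewrite mulr_ge0.
lra.
Qed.

Lemma chi_compl_le (B : set T) e u : measurable B -> (forall x, B x -> 1 - g x <= e) ->
  nsq (chi B u - wmul (chi B u)) <= e * nsq (chi B u).
Proof.
move=> mB h; apply: nsq_ptw_le => x; rewrite compl_sq chi_sq //.
case: (boolP (x \in B)) => [/set_mem /h he|_]; last by rewrite !mul0r !mulr0.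
rewrite !mul1r ler_wpM2r ?sqmod_ge0 //; apply: le_trans he.
by rewrite -weight_sqrt_sq; have /andP[] := weight_sqrt01 x; nra.
Qed.

Lemma chi_wmulC (B : set T) u : measurable B -> chi B (wmul u) = wmul (chi B u).
Proof.
move=> mB; apply: L2space_eq => x.
rewrite wmulE /chi !(bmulE (measurable_indic mB) (@indic_sq1 B)) wmulE.
by rewrite mulrCA.
Qed.

End Weight.
End Multipliers.

(** * The finite-dimensional part *)

Section FiniteDimensional.
Context {d : measure_display} {T : measurableType d} {R : realType}.
Variable mu : {measure set T -> \bar R}.
Local Notation fn := (T -> R[i]).
Local Notation X := (L2space mu).
Local Notation toX := (@toL2 _ _ _ mu).

Lemma image_csubspace (V : set fn) (s : T -> R) : linear_subspace mu V ->
  mulop s @` V `<=` L2 mu -> csubspace mu (mulop s @` V).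
Proof.
move=> [_ V0 Vl _] VL; split=> //.
  by exists (fun=> 0) => //; apply/funext => x; rewrite /mulop mulr0.
move=> a _ _ [f Vf <-] [g Vg <-]; exists (fun x => a * f x + g x); first exact: Vl.
by apply/funext => x; rewrite /mulop mulrDr; congr (_ + _); rewrite mulrCA.
Qed.

Section Spanning.
Variables (V : set fn) (n : nat) (v : 'I_n -> fn).
Hypotheses (lV : linear_subspace mu V) (Vv : forall i, V (v i))
  (Vspan : forall f, V f -> exists c : 'I_n -> R[i], aeq mu f (fun x => \sum_(i < n) c i * v i x)).
Variable s : T -> R.
Hypothesis VL : mulop s @` V `<=` L2 mu.

(** The vectors sqrt(g) v_i together with i times them: their real span is the complex span, of real
    dimension at most 2 n. *)
Definition real_span : seq X :=
  [seq toX (mulop s (v i)) | i <- enum 'I_n] ++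
  [seq cscale 'i%C (toX (mulop s (v i))) | i <- enum 'I_n].

Lemma size_real_span : size real_span = (n + n)%N.
Proof. by rewrite size_cat !size_map -!enumT !size_enum_ord. Qed.

Lemma real_span_sub : span [set 0] real_span `<=` Xset (mulop s @` V).
Proof.
have cV := image_csubspace lV VL; have sV := Xset_subspace cV.
apply: span_min => //; first by move=> _ ->; case: sV.
have Vi i : Xset (mu := mu) (mulop s @` V) (toX (mulop s (v i))).
  by apply: Xset_toL2 => //; exists (v i).
move=> w; rewrite mem_cat => /orP[] /mapP[i _ ->]; first exact: Vi.
by apply: Xset_J.
Qed.

Lemma real_span_mem phi : V phi ->
  exists2 x, span [set 0] real_span x & nsq (toX (mulop s phi) - x) = 0.
Proof.
move=> Vphi; have [c hc] := Vspan Vphi.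
have s0 := @subspace0 R X; have sS := span_subspace real_span s0.
pose w i := toX (mulop s (v i)).
pose x := \sum_(i < n) (complex.Re (c i) *: w i + complex.Im (c i) *: cscale 'i%C (w i)).
have Lw i : L2 mu (mulop s (v i)) by apply: VL; exists (v i).
have xE t : L2fun x t = (s t)%:C%C * (\sum_(i < n) c i * v i t) :> R[i].
  have -> : L2fun x t = \sum_(i < n) (c i * (L2fun (w i) t : R[i])) :> R[i].
    rewrite /x; elim/big_ind2: _ => //.
      by move=> a b a' b' <- <-; rewrite L2funD.
    move=> i _; rewrite L2fun_lin -(addr0 (_ *: cscale _ _)) L2fun_lin cscaleE.
    rewrite (_ : L2fun 0 t = 0 :> R[i]) // addr0.
    case: (L2fun (w i) t) (c i) => [p q] [a b]; apply/eqP; rewrite eq_complex /=.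
    by apply/andP; split; apply/eqP; ring.
  by rewrite mulr_sumr; apply: eq_bigr => i _; rewrite /w toL2K // /mulop mulrCA.
exists x.
  rewrite /x; elim/big_ind: _ => //; first by case: sS.
    by move=> a b; exact: subspaceD.
  move=> i _; apply: subspaceD => //; apply: subspaceZ => //; apply: span_mem => //.
    by rewrite mem_cat map_f ?mem_enum.
  by rewrite mem_cat orbC (map_f (fun i => cscale 'i%C (toX (mulop s (v i))))) ?mem_enum.
have Lp : L2 mu (mulop s phi) by apply: VL; exists phi.
rewrite -(L2funK x); apply/(aeq_nsq Lp (L2fun_L2 x)).
by apply: filterS hc => t ht; rewrite xE /mulop ht.
Qed.

End Spanning.

(** If u is a projection of v, the cosine of their angle is |u| / |v|. The minimum with pi covers
    the case of an infinite angle, cosine being monotone only on [0, pi]; the maximum with 0 keeps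
    the bound monotone under squaring. *)
Lemma angle_bound (A B : set fn) alpha : A `<=` L2 mu -> B `<=` L2 mu -> 0 < alpha ->
  (alpha%:E <= angle mu A B)%E ->
  forall u v : X, Xset A u -> Xset B v -> ip u v = nsq u ->
  nsq u <= (Num.max 0 (cos (Num.min alpha pi))) ^+ 2 * nsq v.
Proof.
move=> AL BL a0 ha u v Au Bv huv.
set k := Num.max 0 _; have k0 : 0 <= k by rewrite le_max lexx.
have [u0|u0] := eqVneq (nsq u) 0; first by rewrite u0 mulr_ge0 ?sqr_ge0 ?nsq_ge0.
have up : 0 < nsq u by rewrite lt_def u0 nsq_ge0.
have v0 : nsq v != 0.
  by apply/eqP => v0; move: huv; rewrite ip_nullr // => e; rewrite -e eqxx in u0.
have vp : 0 < nsq v by rewrite lt_def v0 nsq_ge0.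
pose t := vec_angle mu (L2fun u) (L2fun v).
have ht : alpha <= t.
  rewrite -lee_fin; apply: (le_trans ha); apply: ereal_inf_lbound.
  have nz (w : X) : nsq w != 0 -> ~ aeq mu (L2fun w) (fun=> 0).
    move=> w0 /(aeq_nsq (L2fun_L2 w) (L2_0 mu)); rewrite L2funK toL2_0 subr0 => h.
    by rewrite h eqxx in w0.
  by exists (L2fun u, L2fun v) => //=; split=> //; exact: nz.
pose r := Num.sqrt (nsq u) / Num.sqrt (nsq v).
have su : 0 < Num.sqrt (nsq u) by rewrite sqrtr_gt0.
have sv : 0 < Num.sqrt (nsq v) by rewrite sqrtr_gt0.
have r0 : 0 <= r by rewrite divr_ge0 // ltW.
have r1 : r <= 1.
  rewrite ler_pdivrMr // mul1r ler_sqrt ?nsq_ge0 //.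
  have := CS u v; rewrite huv expr2 ler_pM2l //.
have tE : t = acos r.
  rewrite /t /vec_angle (inner_ip (L2fun_L2 u) (L2fun_L2 v)) !L2funK /= huv.
  congr acos; rewrite /L2norm -/(N2 mu (L2fun u)) -/(N2 mu (L2fun v)) -!nsqE /r.
  rewrite -{1}(sqr_sqrtr (nsq_ge0 u)) expr2 invfM mulrACA divff ?gt_eqF // mul1r.
  by [].
have rN : -1 <= r by apply: le_trans r0; lra.
have rb : -1 <= r <= 1 by rewrite rN.
have tpi : t <= pi by rewrite tE acos_lepi.
have api : Num.min alpha pi = alpha by apply/min_idPl; exact: le_trans ht tpi.
have rk : r <= k.
  have -> : r = cos t by rewrite tE acosK // in_itv /= rb.
  rewrite le_max; apply/orP; right; rewrite api.
  rewrite le_eqVlt; have [->|nat_] := eqVneq t alpha; first by rewrite eqxx.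
  apply/orP; right; rewrite ltr_cos ?in_itv /=.
  - by rewrite lt_def nat_ ht.
  - by rewrite (ltW a0) (le_trans ht tpi).
  - by rewrite (le_trans (ltW a0) ht) tpi.
have -> : nsq u = r ^+ 2 * nsq v.
  by rewrite exprMn exprVn !sqr_sqrtr ?nsq_ge0 // divfK.
by rewrite ler_wpM2r ?nsq_ge0 // lerXn2r // nnegrE.
Qed.

Lemma angle_const_lt1 alpha : 0 < alpha ->
  (Num.max 0 (cos (Num.min alpha pi)) : R) ^+ 2 < 1.
Proof.
move=> a0; have pi0 : 0 < pi :> R by exact: pi_gt0.
set a := Num.min _ _; have ap : 0 < a by rewrite lt_min a0.
have api : a <= pi by rewrite ge_min lexx orbT.
have c1 : cos a < 1.
  rewrite -cos0 ltr_cos ?in_itv /= ?lexx ?(ltW ap) //.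
  exact: ltW.
rewrite -[ltRHS](expr1n _ 2) ltrXn2r ?nnegrE //; last by rewrite gt_max ltr01.
Qed.

Lemma L2_exhaust (B : nat -> set T) (phi : fn) D : (forall k, measurable (B k)) ->
  (forall k l, (k <= l)%N -> B k `<=` B l) -> (forall x, exists k, B k x) ->
  cmeasurable phi -> (forall k, L2 mu (mulop \1_(B k) phi)) ->
  (forall k, N2 mu (mulop \1_(B k) phi) <= D) -> L2 mu phi.
Proof.
move=> mB Bi Bc mphi LB hD; split=> //.
pose f k x := (sqmod (mulop \1_(B k) phi x))%:E.
have mf k : measurable_fun setT (f k).
  by apply/measurable_EFinP; apply: measurable_sqmod; case: (LB k).
have -> : (\int[mu]_x (sqmod (phi x))%:E = \int[mu]_x limn_einf (f^~ x))%E.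
  apply: eq_integral => x _; apply/esym.
  have [-> //] : (limn_einf (f^~ x) = (sqmod (phi x))%:E) * (limn_esup (f^~ x) = (sqmod (phi x))%:E).
  apply: cvg_limn_einf_sup; have [k Bk] := Bc x.
  apply: cvg_near_cst; exists k => // l /= kl; rewrite /f /mulop indicE mem_set ?mul1r //.
  exact: Bi kl _ Bk.
apply: (le_lt_trans (fatou mu measurableT mf _)) => [k x _|]; first by rewrite lee_fin sqmod_ge0.
apply: (@le_lt_trans _ _ D%:E); last by rewrite ltry.
rewrite limn_einf_lim; apply: lime_le; first exact: is_cvg_einfs.
apply: nearW => j; apply: (@le_trans _ _ (\int[mu]_x f j x)%E).
  by apply: ereal_inf_lbound; exists j => /=.
by rewrite -(N2E (LB j)) lee_fin.
Qed.

(** * Escape of mass to infinity for functions outside L_2 *)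

Section Blowup.
Variables (V : set fn) (n : nat) (v : 'I_n -> fn).
Hypotheses (lV : linear_subspace mu V) (Vv : forall i, V (v i))
  (Vspan : forall f, V f -> exists c : 'I_n -> R[i], aeq mu f (fun x => \sum_(i < n) c i * v i x)).
Variable g : T -> R.
Hypotheses (mg : measurable_fun setT g) (g01 : forall x, 0 < g x <= 1).
Let s x := Num.sqrt (g x).
Hypothesis VL : mulop s @` V `<=` L2 mu.
Hypothesis V_L2 : forall phi, V phi -> L2 mu phi -> aeq mu phi (fun=> 0).
Variable (B : nat -> set T).
Hypotheses (mB : forall k, measurable (B k)) (B_incr : forall k l, (k <= l)%N -> B k `<=` B l)
  (B_cover : forall x, exists k, B k x)
  (gB : forall k, exists2 c, 0 < c & forall x, B k x -> c <= g x).

Let h k x := \1_(B k) x * (s x)^-1.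

(** Multiplication by [h k] is bounded, as g is bounded below on B k, and sends sqrt(g) phi to the
    restriction of phi to B k. Bounded seminorms put phi in L_2 by Fatou, hence make it null; so the
    growth lemma applies to the real span of sqrt(g) V. *)
Lemma weight_blowup M : exists k, forall phi, V phi ->
  L2 mu (mulop \1_(B k) phi) /\
  M * nsq (toX (mulop s phi)) <= nsq (toX (mulop \1_(B k) phi)).
Proof.
have sp x : 0 < s x by rewrite sqrtr_gt0; case/andP: (g01 x).
have mh k : measurable_fun setT (h k).
  apply: measurable_funM; first exact: measurable_indic.
  have -> : (fun x => (s x)^-1) = (fun x => s x `^ (-1)).
    by apply/funext => x; rewrite powR_inv1 // ltW.
  apply: (measurableT_comp (measurable_powR (-1))); exact: measurable_sqrt_fun.
have hE k x : h k x ^+ 2 = (x \in B k)%:R / g x.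
  by rewrite exprMn exprVn indic_sq weight_sqrt_sq.
have hc k : exists c, forall x, h k x ^+ 2 <= c.
  have [c c0 hc] := gB k; exists c^-1 => x; rewrite hE.
  have [/set_mem Bx|_] := boolP (x \in B k); last by rewrite mul0r invr_ge0 ltW.
  rewrite mul1r lef_pV2 ?posrE //; first exact: hc.
  by case/andP: (g01 x).
have [c {}hc] := choice hc.
pose Tk k := bmul (mu := mu) (h k).
have TE k phi : V phi -> Tk k (toX (mulop s phi)) = toX (mulop \1_(B k) phi).
  move=> Vphi; have Lp : L2 mu (mulop s phi) by apply: VL; exists phi.
  rewrite /Tk bmul_def toL2K //; congr toX; apply/funext => x.
  rewrite /mulop mulrA; congr (_ * _).
  rewrite -rmorphM /h divfK // gt_eqF //; exact: sp.
have LB k phi : V phi -> L2 mu (mulop \1_(B k) phi).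
  move=> Vphi; have Lp : L2 mu (mulop s phi) by apply: VL; exists phi.
  have := L2_mul (mh k) (hc k) Lp; congr L2; apply/funext => x.
  by rewrite /mulop mulrA; congr (_ * _); rewrite -rmorphM /h divfK // gt_eqF //; exact: sp.
have aT k : adj (Tk k) (Tk k) := bmul_adj (mh k) (hc k).
have mT k l x : (k <= l)%N -> nsq (Tk k x) <= nsq (Tk l x).
  move=> kl; rewrite -[leRHS]mul1r; apply: nsq_ptw_le => t.
  rewrite mul1r (bmul_sq _ _ (mh k) (hc k)) (bmul_sq _ _ (mh l) (hc l)) !hE.
  rewrite ler_wpM2r ?sqmod_ge0 // ler_wpM2r ?invr_ge0 ?(ltW (proj1 (andP (g01 t)))) //.
  by rewrite ler_nat; case: (boolP (t \in B k)) => // /set_mem /(B_incr kl) /mem_set ->.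
have bT k : exists c, forall x, nsq (Tk k x) <= c * nsq x.
  by exists (c k) => x; exact: (bmul_bound (mh k) (hc k)).
have nz x : span [set 0] (real_span v s) x ->
    (exists D, forall k, nsq (Tk k x) <= D) -> nsq x = 0.
  move=> /(real_span_sub lV Vv VL) [phi Vphi xE] [D]; rewrite -(L2funK x) -xE => hD.
  have mphi : cmeasurable phi by case: lV => Vm _ _ _; exact: Vm.
  have Lphi : L2 mu phi.
    apply: (L2_exhaust mB B_incr B_cover mphi (D := D)) => k; first exact: LB.
    by rewrite -nsq_toL2 -?TE //; exact: LB.
  have Lp : L2 mu (mulop s phi) by apply: VL; exists phi.
  have := V_L2 Vphi Lphi => h0.
  have /(aeq_nsq Lp (L2_0 mu)) : aeq mu (mulop s phi) (fun=> 0).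
    by apply: filterS h0 => t; rewrite /mulop => ->; rewrite mulr0.
  by rewrite toL2_0 subr0.
have [k hk] := seminorm_growth aT mT bT nz M.
exists k => phi Vphi; split; first exact: LB.
have [x hx e] := real_span_mem Vv Vspan VL Vphi.
by rewrite (nsq_eq e) -TE // (nsq_eq (adj_null (aT k) e)) hk.
Qed.

End Blowup.
End FiniteDimensional.

(** * The deformed projections *)

Section Perturbation.
Context {d : measure_display} {T : measurableType d} {R : realType}.
Variable mu : {measure set T -> \bar R}.
Local Notation fn := (T -> R[i]).
Local Notation X := (L2space mu).
Local Notation toX := (@toL2 _ _ _ mu).

Lemma HS_scale (I : choiceType) (D : set I) (F : I -> X) Y Z a c : 0 <= a ->
  (forall x, nsq (Y x) <= a * nsq (Z x)) -> (HS D F Z <= c%:E)%E ->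
  (HS D F Y <= (a * c)%:E)%E.
Proof.
move=> a0 h hZ; have := HS_lin a0 (lexx 0) (Y := Y) (Z := Z) (W := Z) _ hZ hZ.
by rewrite mul0r addr0; apply => x; rewrite mul0r addr0.
Qed.

Section WeightedProjection.
Variables (I : choiceType) (D : set I) (F : I -> X).
Hypothesis fr : frame D F.
Variable g : T -> R.
Hypotheses (mg : measurable_fun setT g) (g01 : forall x, 0 < g x <= 1).
Variable B : set T.
Hypothesis mB : measurable B.

(** [proj_perturb] summed over the vectors chi_B f_i. *)
Lemma perturb_HS (S : set X) (Q P : X -> X) c e dl :
  subspace S -> is_proj S Q -> is_proj (wmul g @` S) P ->
  0 <= e <= 1 / 8 -> (forall x, S x -> nsq x - nsq (wmul g x) <= e * nsq x) ->
  0 <= dl -> (forall x, B x -> 1 - g x <= dl) ->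
  (HS D F (Q \o chi B) <= c%:E)%E ->
  (HS D F (fun x => (P (chi B x) - Q (chi B x))%R) <= ((24 * e + 10 * dl) * c)%:E)%E.
Proof.
move=> sS hQ hP e8 he dl0 hdl hc.
have aQ := proj_adj hQ; have aC := chi_adj (mu := mu) mB; have aW := wmul_adj (mu := mu) mg g01.
(* Through the adjoint, 1 - sqrt(g) stands to the left next to chi_B, where it is pointwise
   small. *)
have aD : adj (fun x => Q (chi B x - wmul g (chi B x)))
              (fun x => chi B (Q x) - wmul g (chi B (Q x))).
  by move=> x y; rewrite aQ ipBl ipBr aW !aC chi_wmulC.
have hW : (HS D F (fun x => Q (chi B x - wmul g (chi B x))%R) <= (dl * c)%:E)%E.
  rewrite (HS_adj fr fr aD); apply: (@HS_scale _ _ _ _ (chi B \o Q)) => // [x|].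
    exact: chi_compl_le.
  by rewrite -(HS_adj fr fr (adj_comp aQ aC)).
have e0 : 0 <= e by case/andP: e8.
have := HS_lin (a := 24 * e) (b := 10) _ _ _ hc hW.
have <- : (24 * e + 10 * dl) * c = 24 * e * c + 10 * (dl * c) by ring.
apply; [by rewrite mulr_ge0|by []|] => x.
exact: (proj_perturb sS hQ hP (wmul_lin mg g01) aW (wmul_le mg g01) (compl_le mg g01) e8 he).
Qed.

End WeightedProjection.

Lemma span_map (T0 : X -> X) (S : set X) s x : lin_fun T0 ->
  span S s x -> span (T0 @` S) (map T0 s) (T0 x).
Proof.
move=> lT; elim: s x => [|v s IH] x /=; first by exists x.
by move=> [c hx]; exists c; rewrite -linear_funZ // -linear_funB //; exact: IH.
Qed.

Lemma span_cat (S : set X) s1 s2 x y : subspace S ->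
  span S s1 x -> span [set 0] s2 y -> span S (s1 ++ s2) (x + y).
Proof.
move=> sS hx hy; have sST := span_subspace (s1 ++ s2) sS.
apply: subspaceD => //.
  move: hx; apply: span_min => //; first exact: span_sub.
  by move=> v vs; apply: span_mem; rewrite ?mem_cat ?vs.
move: hy; apply: span_min => //; first by move=> _ ->; case: sST.
by move=> v vs; apply: span_mem; rewrite ?mem_cat ?vs ?orbT.
Qed.

(** Spanning holds only almost everywhere, so the algebraic span can be smaller than the space by
    null functions. *)
Lemma is_proj_dense (S S' : set X) P : S `<=` S' ->
  (forall x, S' x -> exists2 y, S y & nsq (x - y) = 0) -> is_proj S P -> is_proj S' P.
Proof.
move=> SS' h hP x; split; first exact/SS'/(proj_mem hP).
move=> k /h[y Sy e]; rewrite ipC (ip_eql _ e) ipC; exact: (proj2 (hP x)).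
Qed.

Lemma chi_split (A : set T) (x : X) : measurable A -> x = chi A x + chi (~` A) x.
Proof.
move=> mA; have mC : measurable (~` A) by exact: measurableC.
apply: L2space_eq => t; rewrite L2funD /chi.
rewrite (bmulE (measurable_indic mA) (@indic_sq1 _ _ _ A)).
rewrite (bmulE (measurable_indic mC) (@indic_sq1 _ _ _ _)) !indicE in_setC.
by case: (t \in A); rewrite /= ?rmorph1 ?rmorph0 !mul1r !mul0r ?addr0 ?add0r.
Qed.

(** * Projections onto sqrt g_n H for single n and in the limit *)

Section DeformedProjections.
Local Notation Xset := (@Xset _ _ _ mu).
Variables (L V : set fn) (E0 : set T) (g : nat -> T -> R) (n0 : nat) (v : 'I_n0 -> fn).
Hypotheses (cL : csubspace mu L) (lV : linear_subspace mu V) (Vv : forall i, V (v i))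
  (Vspan : forall f, V f ->
     exists c : 'I_n0 -> R[i], aeq mu f (fun x => \sum_(i < n0) c i * v i x)).
Variables (Q : X -> X) (hQ : is_proj (Xset L) Q).
Variables (I : choiceType) (D : set I) (F : I -> X) (fr : frame D F).
Hypotheses (mg : forall n, measurable_fun setT (g n)) (g01 : forall n x, 0 < g n x <= 1).
Local Notation sg n := (fun x => Num.sqrt (g n x)).
Hypothesis VL : forall n, mulop (sg n) @` V `<=` L2 mu.
Hypothesis V_L2 : forall phi, V phi -> L2 mu phi -> aeq mu phi (fun=> 0).
Variables (alpha0 : R) (alpha0_gt0 : 0 < alpha0).
Hypothesis hangle : forall n,
  (alpha0%:E <= angle mu (mulop (sg n) @` L) (mulop (sg n) @` V))%E.
Hypothesis HSg : forall n, (HS D F (Q \o bmul (fun x => Num.sqrt (1 - g n x))) < +oo)%E.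
Variable B : nat -> set T.
Hypotheses (mB : forall k, measurable (B k)) (B_incr : forall k l, (k <= l)%N -> B k `<=` B l)
  (B_cover : forall x, exists k, B k x).
Hypothesis HSB : forall k, (HS D F (Q \o chi (B k)) < +oo)%E.
Hypotheses (mE0 : measurable E0) (HSE0 : (HS D F (Q \o chi (~` E0)) < +oo)%E).
Hypothesis gB : forall k, exists2 c, 0 < c & forall n x, B k x -> c <= g n x.
Hypothesis g_cvg : forall k e, 0 < e -> exists N, forall n, (N <= n)%N ->
  forall x, E0 x \/ B k x -> 1 - g n x <= e.

Local Notation H n := (mulop (sg n) @` sum_space L V).
Local Notation W n := (@wmul _ _ _ mu (g n)).

Let aQ := proj_adj hQ.
Let sL := Xset_subspace cL.

(** For x in L the mass outside E0 and B k is at most e / 2 of the whole: chi_(E \ B k) chi_(E \ E0)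
    Q tends to 0 in Hilbert-Schmidt norm, hence in operator norm. On E0 and B k the weights are
    uniformly close to 1. *)
Lemma defect_small e : 0 < e -> exists N, forall n, (N <= n)%N ->
  forall x, Xset L x -> nsq x - nsq (W n x) <= e * nsq x.
Proof.
move=> e0; have mE : measurable (~` E0) by exact: measurableC.
have mBc k : measurable (~` B k) by exact: measurableC.
have e2 : 0 < e / 2 by rewrite divr_gt0.
have HY : (HS D F (chi (~` E0) \o Q) < +oo)%E.
  by rewrite -(HS_adj fr fr (adj_comp aQ (chi_adj mE))).
have [k hk] := HS_strong0 HY (fun k => chi_le (mBc k)) (chi_tail mB B_incr B_cover) e2.
have {hk} := hk k (leqnn k).
have aC := adj_comp (chi_adj (mu := mu) (mBc k)) (chi_adj (mu := mu) mE).
move=> /(HS_opnorm_self fr (adj_comp aC aQ)) hk.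
have [N hN] := g_cvg k e2; exists N => n /hN h x Lx.
have := wmul_defect (mg n) (g01 n) x mE0 (mB k) (ltW e2) h.
have := hk x; have /(adj_null aC)/nsq_eq /= := proj_id sL hQ Lx.
move=> -> => ?; lra.
Qed.

Lemma mulop_indic_bound (A : set T) phi c n : 0 <= c -> measurable A -> V phi ->
  L2 mu (mulop \1_A phi) -> (forall x, A x -> 1 <= c * g n x) ->
  nsq (toX (mulop \1_A phi)) <= c * nsq (toX (mulop (sg n) phi)).
Proof.
move=> c0 mA Vphi LA h; have Lp : L2 mu (mulop (sg n) phi) by apply: VL; exists phi.
apply: nsq_ptw_le => x; rewrite !toL2K // /mulop !sqmodM !sqmod_real indic_sq.
rewrite (weight_sqrt_sq (g01 n)) mulrA ler_wpM2r ?sqmod_ge0 //.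
have [/set_mem /h //|_] := boolP (x \in A).
by rewrite mulr_ge0 // ltW //; case/andP: (g01 n x).
Qed.

Lemma V_chi_small k e : 0 < e -> exists N, forall n, (N <= n)%N -> forall phi, V phi ->
  nsq (chi (B k) (toX (mulop (sg n) phi))) <= e * nsq (toX (mulop (sg n) phi)).
Proof.
move=> e0; have [c c0 hc] := gB k.
(* The mass on B k is at most |sqrt g_0 phi|^2 / c. The blow-up bounds |sqrt g_0 phi|^2 by c e / 2
   times the mass of phi on B j, itself at most 2 |sqrt g_n phi|^2 when g_n >= 1/2 there. *)
have [|j hj] := weight_blowup lV Vv Vspan (mg 0%N) (g01 0%N) (@VL 0%N) V_L2
  mB B_incr B_cover _ (2 / (c * e)).
  by move=> l; have [c' c'0 hc'] := gB l; exists c' => // x; exact: hc'.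
have [|N hN] := @g_cvg j (1 / 2); first by rewrite divr_gt0.
exists N => n /hN h phi Vphi; have [Lj {}hj] := hj _ Vphi.
have Lp m : L2 mu (mulop (sg m) phi) by apply: VL; exists phi.
have h1 : nsq (toX (mulop \1_(B j) phi)) <= 2 * nsq (toX (mulop (sg n) phi)).
  by apply: mulop_indic_bound => // x Bx; have := h x (or_intror Bx); lra.
have h2 : nsq (chi (B k) (toX (mulop (sg n) phi))) <= c^-1 * nsq (toX (mulop (sg 0%N) phi)).
  apply: nsq_ptw_le => x; rewrite chi_sq // !toL2K // /mulop !sqmodM !sqmod_real.
  rewrite !weight_sqrt_sq // !mulrA ler_wpM2r ?sqmod_ge0 //.
  have /andP[gn gn1] := g01 n x; have /andP[g0 _] := g01 0%N x.
  have [/set_mem /(hc 0%N) hx|_] := boolP (x \in B k).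
    by rewrite mul1r (le_trans gn1) // mulrC ler_pdivlMr // mul1r.
  by rewrite mul0r mulr_ge0 ?invr_ge0 ?ltW.
apply: (le_trans h2); have := le_trans hj h1.
rewrite -ler_pdivlMl ?divr_gt0 ?mulr_gt0 // => h3.
apply: (@le_trans _ _ (c^-1 * ((2 / (c * e))^-1 * (2 * nsq (toX (mulop (sg n) phi)))))).
  by rewrite ler_wpM2l // invr_ge0 ltW.
rewrite le_eqVlt; apply/orP; left; apply/eqP; field.
by rewrite !gt_eqF.
Qed.

Lemma angle_contraction : exists2 kappa : R, kappa < 1 & forall n P x,
  is_proj (W n @` Xset L) P -> Xset (mulop (sg n) @` V) x -> nsq (P x) <= kappa * nsq x.
Proof.
exists (Num.max 0 (cos (Num.min alpha0 pi)) ^+ 2); first exact: angle_const_lt1.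
move=> n P x hP Vx.
have LL : mulop (sg n) @` L `<=` L2 mu.
  move=> _ [f Lf <-]; apply: (L2_mul (measurable_sqrt_fun (mg n)) (weight_sqrt_sq1 (g01 n))).
  by case: cL => h _ _; exact: h.
apply: (angle_bound LL (VL (n := n)) alpha0_gt0 (hangle n) _ Vx).
  have [y Ly <-] := proj_mem hP x; exists (L2fun y) => //.
  by apply/funext => t; rewrite wmulE.
by rewrite (nsq_proj hP) ipC.
Qed.

Lemma csubspace_H n : csubspace mu (H n).
Proof.
have [LL L0 Ll] := cL; have [_ V0 Vl _] := lV; split.
- move=> _ [_ [f Lf [h Vh <-]] <-].
  have L1 : L2 mu (mulop (sg n) f).
    exact: (L2_mul (measurable_sqrt_fun (mg n)) (weight_sqrt_sq1 (g01 n)) (LL _ Lf)).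
  have L2' : L2 mu (mulop (sg n) h) by apply: VL; exists h.
  by have := L2D L1 L2'; congr L2; apply/funext => x; rewrite /mulop mulrDr.
- exists (fun=> 0); last by apply/funext => x; rewrite /mulop mulr0.
  by exists (fun=> 0) => //; exists (fun=> 0) => //; apply/funext => x; rewrite addr0.
- move=> a _ _ [_ [f Lf [h Vh <-]] <-] [_ [f' Lf' [h' Vh' <-]] <-].
  exists (fun x => (a * f x + f' x) + (a * h x + h' x)).
    by exists (fun x => a * f x + f' x); [exact: Ll|exists (fun x => a * h x + h' x) => //; exact: Vl].
  by apply/funext => x; rewrite /mulop; ring.
Qed.

(** Presents H from a part S of L and finitely many further vectors: S is L itself for large n, and
    a subspace of finite codimension when n is arbitrary. *)
Lemma H_proj n (S : set X) s P : subspace S -> S `<=` Xset L ->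
  (forall x, x \in s -> Xset L x) -> Xset L `<=` span S s ->
  is_proj (span (W n @` S) (map (W n) s ++ real_span mu v (sg n))) P ->
  is_proj (Xset (H n)) P.
Proof.
move=> sS SL ssL LS; have lW := wmul_lin (mu := mu) (mg n) (g01 n).
have [_ V0 _ _] := lV; have [LL L0 _] := cL.
have sH := Xset_subspace (csubspace_H n).
have WH x : Xset L x -> Xset (H n) (W n x).
  move=> Lx; exists (L2fun x); last by apply/funext => t; rewrite wmulE.
  by exists (L2fun x) => //; exists (fun=> 0) => //; apply/funext => t; rewrite addr0.
apply: is_proj_dense.
  apply: span_min => //; first by move=> _ [x Sx <-]; exact/WH/SL.
  move=> x; rewrite mem_cat => /orP[/mapP[y ys ->]|xs]; first exact/WH/ssL.
  have : span [set 0] (real_span mu v (sg n)) x by apply: span_mem => //; exact: subspace0.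
  move=> /(real_span_sub lV Vv (VL (n := n))) [h Vh hx]; exists h => //.
  by exists (fun=> 0) => //; exists h => //; apply/funext => t; rewrite add0r.
move=> x [_ [f Lf [h Vh <-]] hx].
have [y hy e] := real_span_mem Vv Vspan (VL (n := n)) Vh.
exists (W n (toX f) + y).
  apply: span_cat => //; first exact: linear_image_subspace.
  by apply: span_map => //; apply: LS; exact: Xset_toL2.
have -> : x = W n (toX f) + toX (mulop (sg n) h).
  have Lh : L2 mu (mulop (sg n) h) by apply: VL; exists h.
  apply: L2space_eq => t; rewrite -hx L2funD (wmulE (mg n) (g01 n)) toL2K; last exact: LL.
  by rewrite toL2K // /mulop mulrDr.
by rewrite opprD addrACA subrr add0r.
Qed.

Lemma wmul_compl n x :
  nsq x - nsq (W n x) <= nsq (bmul (fun t => Num.sqrt (1 - g n t)) x).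
Proof.
have m1 : measurable_fun setT (fun t => Num.sqrt (1 - g n t)).
  by apply: measurable_sqrt_fun; exact: measurable_funB.
have s1 t : Num.sqrt (1 - g n t) ^+ 2 = 1 - g n t.
  by rewrite sqr_sqrtr // subr_ge0; case/andP: (g01 n t).
have s2 t : Num.sqrt (1 - g n t) ^+ 2 <= 1.
  by rewrite s1; case/andP: (g01 n t) => ? ?; lra.
have := @nsq_int_le _ _ _ mu x (W n x) (bmul (fun t => Num.sqrt (1 - g n t)) x) 0 1 1 0.
rewrite !mul1r mul0r addr0 => h; suff : nsq x <= nsq (W n x) + nsq (bmul (fun t => Num.sqrt (1 - g n t)) x) by lra.
apply: h => t; rewrite (wmul_sq (mg n) (g01 n)) (bmul_sq _ _ m1 s2) s1 !mul1r mul0r addr0.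
by rewrite -mulrDl addrC subrK mul1r.
Qed.

Lemma HS_fin (Y : X -> X) : (HS D F Y < +oo)%E -> exists c, (HS D F Y <= c%:E)%E.
Proof. by move=> h; exists (fine (HS D F Y)); rewrite fineK // ge0_fin_numE // HS_ge0. Qed.

(** Here only finiteness matters. [HS_small] gives a finite-codimensional part of L with defect at
    most 1/8; the rest of L and V change the projection by a finite rank, and on B k the trivial
    bound 1 - g_n <= 1 is enough. *)
Lemma H_proj_HS n k : exists P c, is_proj (Xset (H n)) P /\ (HS D F (P \o chi (B k)) <= c%:E)%E.
Proof.
have m1 : measurable_fun setT (fun t => Num.sqrt (1 - g n t)).
  by apply: measurable_sqrt_fun; exact: measurable_funB.
have s2 t : Num.sqrt (1 - g n t) ^+ 2 <= 1.
  by case/andP: (g01 n t) => ? ?; rewrite sqr_sqrtr; lra.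
have lW := wmul_lin (mu := mu) (mg n) (g01 n); have Wle := wmul_le (mu := mu) (mg n) (g01 n).
have e8 : 0 < 1 / 8 :> R by rewrite divr_gt0.
have [s ss hs] := HS_small hQ fr (bmul_adj m1 s2) (HSg n) e8.
have [Q' hQ'] := ortho_in_projectable s sL hQ.
have sL' := ortho_in_subspace s sL.
have defect x : ortho_in (Xset L) s x -> nsq x - nsq (W n x) <= 1 / 8 * nsq x.
  by move=> [Lx xs]; apply: le_trans (hs x Lx xs); exact: wmul_compl.
have [P hP] : projectable (W n @` ortho_in (Xset L) s).
  by apply: (image_projectable sL' hQ' lW Wle _ defect); lra.
have [c hc] := HS_fin (HSB k).
have hc' : (HS D F (Q' \o chi (B k)) <= c%:E)%E.
  apply: le_trans hc; apply: HS_le => x /=.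
  by apply: (proj_mono hQ' hQ) => // y [].
have g1 x : B k x -> 1 - g n x <= 1 by case/andP: (g01 n x) => ? ? _; lra.
have e8' : 0 <= (1 / 8 : R) <= 1 / 8 by rewrite lexx ltW.
have h1 := perturb_HS fr (mg n) (g01 n) (mB k) sL' hQ' hP e8' defect ler01 g1 hc'.
have sW := linear_image_subspace lW sL'.
have [P' hP' h2] := span_proj (map (W n) s ++ real_span mu v (sg n)) sW hP fr.
have aC := chi_adj (mu := mu) (mB k).
have aD := adjB (proj_adj hP') (proj_adj hP).
have h3 : (HS D F ((fun x => (P' x - P x)%R) \o chi (B k)) <=
    (size (map (W n) s ++ real_span mu v (sg n)))%:R%:E)%E.
  rewrite (HS_adj fr fr (adj_comp aD aC)); apply: le_trans h2.
  by apply: HS_le => x; exact: chi_le.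
have h4 : (HS D F (P \o chi (B k)) <= (2 * ((24 * (1 / 8) + 10 * 1) * c) + 2 * c)%:E)%E.
  apply: HS_lin h1 hc' => // x /=.
  by rewrite -{1}(subrK (Q' (chi (B k) x)) (P _)); exact: nsqD_le.
exists P'; eexists; split.
  apply: (H_proj sL' _ ss _ hP'); first by move=> x [].
  exact: ortho_in_span.
apply: (HS_lin (a := 2) (b := 2) _ _ _ h3 h4) => // x /=.
by rewrite -{1}(subrK (P (chi (B k) x)) (P' _)); exact: nsqD_le.
Qed.

Lemma H_proj_cvg k tau : 0 < tau -> exists N, forall n, (N <= n)%N ->
  exists2 P, is_proj (Xset (H n)) P &
    (HS D F (fun x => (P (chi (B k) x) - Q (chi (B k) x))%R) <= tau%:E)%E.
Proof.
move=> tau0; have [kappa k1 hkappa] := angle_contraction.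
pose m := (n0 + n0)%:R : R; have m0 : 0 <= m by rewrite ler0n.
have k10 : 0 < 1 - kappa by rewrite subr_gt0.
(* Solves 2 (18 th / (1 - kappa) m) + 2 th = tau, the final sum of the two Hilbert-Schmidt
   bounds. *)
pose th := tau / (36 / (1 - kappa) * m + 2).
have q0 : 0 <= 36 / (1 - kappa) * m by rewrite mulr_ge0 // divr_ge0 // ltW.
have th0 : 0 < th by rewrite divr_gt0 // ltr_wpDl.
have [c hc] := HS_fin (HSB k).
have c0 : 0 <= c by rewrite -lee_fin; apply: le_trans hc; exact: HS_ge0.
have c1 : 0 < 34 * c + 1 by rewrite ltr_wpDl // mulr_ge0.
(* 34 = 24 + 10 are the coefficients of [perturb_HS] with both errors equal to eta; the added 1
   keeps the denominator positive. *)
pose eta := Num.min (1 / 8) (th / (34 * c + 1)).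
have e80 : 0 < 1 / 8 :> R by rewrite divr_gt0.
have eta0 : 0 < eta by rewrite lt_min e80 divr_gt0.
have eta8 : 0 <= eta <= 1 / 8 by rewrite ltW //= ge_min lexx.
have eta_c : (24 * eta + 10 * eta) * c <= th.
  have : eta <= th / (34 * c + 1) by rewrite ge_min lexx orbT.
  by rewrite ler_pdivlMr //; nra.
have mBc j : measurable (~` B j) by exact: measurableC.
have aC := chi_adj (mu := mu) (mB k).
(* Q is not local, so smallness of x on B k says nothing of Q x there. The mass of x on a larger B j
   is small as well, and what lies outside B j reaches B k through Q only weakly. *)
have [j /(_ j (leqnn j)) hj] :=
  HS_strong0 (HSB k) (fun j => chi_le (mBc j)) (chi_tail mB B_incr B_cover) th0.
have aCj := chi_adj (mu := mu) (mBc j).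
have {}hj := HS_opnorm fr (adj_comp aCj (adj_comp aQ aC)) hj.
have [N1 hN1] := V_chi_small k th0; have [N2 hN2] := V_chi_small j th0.
have [N3 hN3] := defect_small eta0; have [N4 hN4] := g_cvg k eta0.
exists (maxn (maxn N1 N2) (maxn N3 N4)) => n.
rewrite !geq_max => /andP[/andP[/hN1 V1 /hN2 V2] /andP[/hN3 defect /hN4 gk]].
have lW := wmul_lin (mu := mu) (mg n) (g01 n); have Wle := wmul_le (mu := mu) (mg n) (g01 n).
have [P hP] : projectable (W n @` Xset L).
  by apply: (image_projectable sL hQ lW Wle _ defect); case/andP: eta8 => ? ?; lra.
have h1 : (HS D F (fun x => (P (chi (B k) x) - Q (chi (B k) x))%R) <= th%:E)%E.
  apply: (le_trans (perturb_HS fr (mg n) (g01 n) (mB k) sL hQ hP eta8 defect (ltW eta0) _ hc)).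
    by move=> x Bx; apply: gk; right.
  by rewrite lee_fin.
have aD := adj_comp (adjB (proj_adj hP) aQ) aC.
have opD := HS_opnorm fr aD h1.
have [P' hP' _] := span_proj (real_span mu v (sg n)) (linear_image_subspace lW sL) hP fr.
have spanV x : span [set 0] (real_span mu v (sg n)) x ->
    Xset (mulop (sg n) @` V) x /\ exists2 phi, V phi & x = toX (mulop (sg n) phi).
  move=> /(real_span_sub lV Vv (VL (n := n))) Vx; split => //.
  by case: Vx => phi Vphi e; exists phi => //; rewrite e L2funK.
have h2 : (HS D F (fun x => (P' (chi (B k) x) - P (chi (B k) x))%R) <=
    (18 * th / (1 - kappa) * m)%:E)%E.
  rewrite /m -(size_real_span mu v (sg n)).
  apply: (rank_part (linear_image_subspace lW sL) hP hP' fr aC k1).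
  - by move=> x /spanV[Vx _]; exact: hkappa.
  - by rewrite mulr_ge0 // ltW.
  move=> x /spanV[_ [phi Vphi xE]].
  have := V1 _ Vphi; have := V2 _ Vphi; rewrite -xE => b2 b1.
  have b3 := opD x; have b4 := hj x.
  have split_x : x = chi (B j) x + chi (~` B j) x by exact: chi_split.
  have b5 : nsq (chi (B k) (Q (chi (B j) x))) <= th * nsq x.
    by apply: le_trans b2; apply: (le_trans (chi_le (mB k) _)); exact: nsq_proj_le.
  have b6 : nsq (chi (B k) (Q x)) <= 4 * (th * nsq x).
    rewrite {1}split_x (nsq_eq (adj_linD _ _ (adj_comp aC aQ))).
    apply: (le_trans (nsqD_le _ _)) => /=; move: b4 b5 => /=; lra.
  (* The three terms have squares at most th, th and 4 th times |x|^2; two applications of |u - w|^2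
     <= 2 |u|^2 + 2 |w|^2 give 16 th, below the 18 th allowed. *)
  have -> : chi (B k) (x - P x) = chi (B k) x - chi (B k) (P x - Q x) - chi (B k) (Q x).
    by rewrite !(linear_funB _ _ (chi_lin (mB k))) opprB -addrA [_ - _ - _]addrAC subrr sub0r.
  have thx : 0 <= th * nsq x by rewrite mulr_ge0 ?nsq_ge0 // ltW.
  have := nsqB_le (chi (B k) x - chi (B k) (P x - Q x)) (chi (B k) (Q x)).
  have := nsqB_le (chi (B k) x) (chi (B k) (P x - Q x)); move: b3 => /=; lra.
exists P'.
  apply: (H_proj sL (@subset_refl _ _) (s := [::])) => //.
apply: (le_trans (HS_lin (a := 2) (b := 2) (W := fun x => P (chi (B k) x) - Q (chi (B k) x)) _ _ _ h2 h1)) => //.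
  by move=> x /=; rewrite -(subrKA (P (chi (B k) x))); exact: nsqD_le.
rewrite lee_fin le_eqVlt; apply/orP; left; apply/eqP; rewrite /th; field.
by rewrite -natrD !gt_eqF // ltr_wpDl ?mulr_ge0 ?mulr_gt0.
Qed.

End DeformedProjections.
End Perturbation.

(** * Proof of the proposition *)

Section BoundedExhaustion.
Context {R : realType} {E : completeMetricType R}.

Lemma measurable_metric_ball (x : E) (r : R) :
  measurable ([set y | mdist x y < r] : set (borel E)).
Proof.
apply: sub_sigma_algebra; rewrite /= openE => y /= xy; apply/metricType_numDomainType.nbhs_mdistP.
exists (r - mdist x y); first by rewrite /= subr_gt0.
by move=> z /= yz; have := metric_triangle x y z; lra.
Qed.

(** Balls with integer radii are adjoined to A, shifted by one index so that index 0 is A itself.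
    The balls need a center, hence the separate case of an empty space. *)
Lemma bounded_exhaustion (A : set (borel E)) :
  measurable A -> metric_bounded (A : set E) ->
  exists B : nat -> set (borel E), [/\ B 0%N = A, forall k, measurable (B k),
    forall k, metric_bounded (B k : set E), forall k l, (k <= l)%N -> B k `<=` B l &
    forall x, exists k, B k x].
Proof.
move=> mA [M hM]; have [[x0 _]|nE] := pselect (exists x : E, True); last first.
  exists (fun=> A); split=> //; [by move=> _; exists M|by move=> *; exact: subset_refl|].
  by move=> x; exfalso; apply: nE; exists x.
pose ball_ k : set E := [set y | mdist x0 y < k%:R :> R].
pose B k : set E := if k is j.+1 then A `|` ball_ j else A.
have BA k : A `<=` B k by case: k => [//|k] x; left.
exists B; split=> //.
- by case=> [//|k]; apply: measurableU => //; exact: measurable_metric_ball.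
- move=> k; have [K hK] : exists K : R, forall x, B k x -> mdist x0 x <= K.
    have [K hK] : exists K : R, forall x, A x -> mdist x0 x <= K.
      have [[a Aa]|nA] := pselect (exists a, A a).
        by exists (mdist x0 a + M) => x /(hM _ _ Aa); have := metric_triangle x0 a x; lra.
      by exists 0 => x Ax; exfalso; apply: nA; exists x.
    exists (Num.max K k%:R) => x; case: k => [|k] /=; first by move=> /hK; rewrite le_max => ->.
    case=> [/hK|]; rewrite le_max; first by move=> ->.
    by move=> /ltW xk; apply/orP; right; apply: (le_trans xk); rewrite ler_nat.
  exists (K + K) => x y /hK hx /hK hy; have := metric_triangle x x0 y.
  by rewrite (metric_sym x x0); lra.
- move=> [|k] l kl x; first exact: BA.
  case: l kl => // l kl; case=> [Ax|xk]; first by left.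
  by right; apply: (lt_le_trans xk); rewrite ler_nat.
- move=> x; exists (Num.truncn (mdist x0 x)).+2; right.
  by rewrite /ball_ /= truncnS_gt.
Qed.

End BoundedExhaustion.

Lemma ereal_cvg0 {R : realType} (u : nat -> \bar R) :
  (forall e : R, 0 < e -> exists N, forall n, (N <= n)%N -> (0 <= u n)%E /\ (u n <= e%:E)%E) ->
  u n @[n --> \oo] --> 0%E.
Proof.
move=> h; apply/fine_cvgP; split.
  have [N hN] := h 1 ltr01; exists N => // n /hN[u0 u1].
  by rewrite ge0_fin_numE // (le_lt_trans u1) // ltry.
apply/cvgrPdist_le => e e0; have [N hN] := h e e0; exists N => // n /hN[u0 u1].
rewrite sub0r normrN /= ger0_norm ?fine_ge0 //.
by rewrite -lee_fin fineK // ge0_fin_numE // (le_lt_trans u1) // ltry.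
Qed.

Theorem proposition6 (R : realType) (E : completeMetricType R)
    (mu : {sigma_finite_measure set (borel E) -> \bar R})
    (L V : set (borel E -> R[i])) (E0 : set (borel E))
    (g : nat -> borel E -> R) :
  let Q := orth_proj mu L in
  let H := sum_space L V in
  let sqrtg n x : R := Num.sqrt (g n x) in
  let sqrt1g n x : R := Num.sqrt (1 - g n x) in
  locally_compact [set: E] ->
  closed_linear_subspace mu L ->
  I1loc mu Q ->
  linear_subspace mu V -> V `<=` L2loc mu -> finite_dimensional mu V ->
  measurable E0 ->
  (* (a) *)
  trace_class mu (compress \1_(~` E0) Q) ->
  (* (b) *)
  mulop \1_E0 @` V `<=` L2 mu ->
  (* (c) *)
  (forall phi, V phi ->
     (exists2 psi, L psi & aeq mu (mulop \1_E0 phi) (mulop \1_E0 psi)) ->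
     aeq mu phi (fun=> 0)) ->
  (* (d) *)
  (forall phi, L phi -> aeq mu (mulop \1_E0 phi) (fun=> 0) ->
     aeq mu phi (fun=> 0)) ->
  (forall phi, V phi -> L2 mu phi -> aeq mu phi (fun=> 0)) ->
  (forall n, measurable_fun setT (g n)) ->
  (forall n x, 0 < g n x <= 1) ->
  (* (1) *)
  (forall n, trace_class mu (compress (sqrt1g n) Q)) ->
  (* (2) *)
  (forall n, mulop (sqrtg n) @` V `<=` L2 mu) ->
  (* (3) *)
  (exists2 alpha0 : R, 0 < alpha0 &
     forall n, (alpha0%:E <= angle mu (mulop (sqrtg n) @` L)
                                     (mulop (sqrtg n) @` V))%E) ->
  (* (4); the real-valued sup makes the supremum over the empty set 0 *)
  (forall B : set E, metric_bounded B ->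
     (0 < ereal_inf [set (g nx.1 nx.2)%:E | nx in
                       [set: nat] `*` (E0 `|` B)])%E /\
     sup [set `|g n x - 1| | x in E0 `|` B] @[n --> \oo] --> (0 : R)) ->
  cvg_I1loc mu (fun n => orth_proj mu (mulop (sqrtg n) @` H)) Q.
Proof.
move=> Q0 H sg s1g _ clL IQ lV _ [n0 [v [Vv Vspan]]] mE0 trE0 _ _ _ V_L2 mg g01 trg VL
  [alpha0 alpha0_gt0 hangle] h4.
have cL := closed_csubspace clL; have [Q hQ] := closed_proj clL.
have [S0 oS0] := orthonormal_basis_exists mu.
have fr := orthonormal_basis_frame oS0.
have cH n := csubspace_H cL lV mg g01 VL n.
have HSg n : (HS (frameD S0) (frameF mu) (Q \o bmul (s1g n)) < +oo)%E.
  apply: (compress_HS cL hQ _ _ (trg n)) => //; first by apply: measurable_sqrt_fun; exact: measurable_funB.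
  by move=> x; case/andP: (g01 n x) => ? ?; rewrite sqr_sqrtr; lra.
have HSE0 : (HS (frameD S0) (frameF mu) (Q \o chi (~` E0)) < +oo)%E.
  have mC : measurable (~` E0) by exact: measurableC.
  exact: (compress_HS cL hQ (measurable_indic mC) (@indic_sq1 _ _ _ _) trE0).
have HSb (A : set (borel E)) : measurable A -> metric_bounded (A : set E) ->
    (HS (frameD S0) (frameF mu) (Q \o chi A) < +oo)%E.
  move=> mA bA; exact: (compress_HS cL hQ (measurable_indic mA) (@indic_sq1 _ _ _ A) (IQ.2 A mA bA)).
have gb (A : set (borel E)) : metric_bounded (A : set E) ->
    exists2 c, 0 < c & forall n x, A x -> c <= g n x.
  move=> /h4[+ _]; set i := ereal_inf _ => i0.
  have hi n x : A x -> (i <= (g n x)%:E)%E.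
    by move=> Ax; apply: ereal_inf_lbound; exists (n, x) => //; split=> //; right.
  (* An infinite infimum forces A to be empty, and any constant serves. *)
  case: i i0 hi => [r| |] // r0 hi; first by exists r => // n x /(hi n); rewrite lee_fin.
  by exists 1 => // n x /(hi n); rewrite leye_eq.
have gc (A : set (borel E)) e : metric_bounded (A : set E) -> 0 < e ->
    exists N, forall n, (N <= n)%N -> forall x, E0 x \/ A x -> 1 - g n x <= e.
  move=> /h4[_ /cvgrPdist_le cv] e0; have [N _ hN] := cv e e0; exists N => n /hN.
  rewrite sub0r normrN => hn x hx; apply: (le_trans _ hn); apply: (le_trans _ (ler_norm _)).
  apply: (@le_trans _ _ `|g n x - 1|); first by rewrite distrC ler_norm.
  (* The real supremum is genuine because 0 < g <= 1 bounds the set by 1. *)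
  apply: sup_ubound; last by exists x.
  exists 1 => _ [y _ <-]; case/andP: (g01 n y) => y0 y1.
  by rewrite distrC ger0_norm; lra.
have I1 n : I1loc mu (orth_proj mu (mulop (sg n) @` H)).
  split.
    have b0 : metric_bounded (set0 : set E) by exists 0.
    (* Only the existence of the projection is wanted, so a constant sequence of empty sets is
       enough. *)
    have [P [_ [hP _]]] := H_proj_HS cL lV Vv Vspan hQ fr mg g01 VL HSg
      (B := fun=> set0) (fun=> measurable0) (fun=> HSb _ measurable0 b0) n 0%N.
    exact: orth_proj_bounded (cH n) hP.
  move=> A mA bA; have [P [c [hP hc]]] := H_proj_HS cL lV Vv Vspan hQ fr mg g01 VL HSg
    (B := fun=> A) (fun=> mA) (fun=> HSb _ mA bA) n 0%N.
  exact: (trace_class_proj (measurable_indic mA) (@indic_sq1 _ _ _ A) (cH n) hP oS0 hc).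
apply: (And3 I1 IQ).
(* The exhaustion starts at A, so that the estimate at index 0 is the one for [chi A]. *)
move=> A mA bA; have [B [B0 mB bB B_incr B_cover]] := bounded_exhaustion mA bA.
have cvg tau := H_proj_cvg cL lV Vv Vspan hQ fr mg g01 VL V_L2 alpha0_gt0 hangle mB B_incr
  B_cover (fun k => HSb _ (mB k) (bB k)) mE0 HSE0 (fun k => gb _ (bB k))
  (fun k e => gc _ e (bB k)) 0%N (tau := tau).
rewrite B0 in cvg.
have [c hc] := HS_fin (HSb _ mA bA).
have c0 : 0 <= c by rewrite -lee_fin; apply: le_trans hc; exact: HS_ge0.
apply: ereal_cvg0 => tau tau0.
have c1 : 0 < 3 * c + 1 by rewrite ltr_wpDl // mulr_ge0.
(* First t makes the term 3 c t at most tau / 2, then e makes the terms in e equal to tau / 2. *)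
pose t := tau / 2 / (3 * c + 1); have t0 : 0 < t by rewrite !divr_gt0.
pose e := tau / 2 / (2 / t + 2 * t).
have d0 : 0 < 2 / t + 2 * t by apply: addr_gt0; [apply: divr_gt0|apply: mulr_gt0].
have e0 : 0 < e by rewrite !divr_gt0.
have [N hN] := cvg e e0; exists N => n /hN[P hP he].
have [h0 h1] := trace_norm_diff (measurable_indic mA) (@indic_sq1 _ _ _ A) (cH n) cL hP hQ oS0
  t0 hc he.
split=> //; apply: (le_trans h1); rewrite lee_fin.
have te : t * (3 * c) <= tau / 2.
  by rewrite /t mulrAC ler_pdivrMr // ler_wpM2l ?divr_ge0 ?ltW //; lra.
have ee : e * (2 / t + 2 * t) = tau / 2 by rewrite /e divfK // gt_eqF.
have -> : 2 * e / t + t * (2 * e + 3 * c) = e * (2 / t + 2 * t) + t * (3 * c) by ring.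
rewrite ee; lra.
Qed.
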